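(* Let $L>0$, $\Omega=(0,L)$, $k\in\mathbb N$, and let $\lambda_k$ be the $k$-th eigenvalue of the logarithmic Laplacian $L_\Delta$ in $\Omega$. For $N\in\mathbb N$ with $N+2\ge k$ and $h:=\frac{L}{N+1}>0$, set $$\lambda_{k,h}:=\inf_{\substack{M_h\subset\mathcal V_h\\ \dim(M_h)=k}}\ \max_{\substack{u_h\in M_h\setminus\{0\}\\ \|u_h\|_{L^2(\Omega)}=1}}\mathcal E_L(u_h,u_h),$$ where $M_h$ ranges over linear subspaces of $\mathcal V_h$. Then $\lambda_{k,h}\to\lambda_k$ as $h\to0$. Here, $\lambda_{k,h}$ equals the $k$-th eigenvalue of the stiffness matrix $\mathcal A_h^L=(\mathcal E_L(\varphi_i,\varphi_j))_{i,j=0}^{N+1}$.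
   Context: The logarithmic Laplacian $L_\Delta$ in dimension one is the operator $$L_\Delta u(x)=\int_{x-1}^{x+1}\frac{u(x)-u(y)}{|x-y|}\,dy-\int_{\mathbb R\setminus(x-1,x+1)}\frac{u(y)}{|x-y|}\,dy+\rho_1u(x),$$ with $\rho_1=2\ln2+\psi(\tfrac12)-\gamma$, $\psi=\Gamma'/\Gamma$, $\gamma=-\Gamma'(1)$. $\mathbb H(\Omega)$ is the space of $u\in L^2(\mathbb R)$ with $u=0$ on $\mathbb R\setminus\Omega$ and $\int_{\mathbb R}\int_{x-1}^{x+1}\frac{|u(x)-u(y)|^2}{|x-y|}\,dy\,dx<\infty$. For $u,v\in\mathbb H(\Omega)$, $$\mathcal E_L(u,v)=\frac12\int_{\mathbb R}\int_{x-1}^{x+1}\frac{(u(x)-u(y))(v(x)-v(y))}{|x-y|}\,dy\,dx-\iint_{|x-y|\ge1}\frac{u(x)v(y)}{|x-y|}\,dx\,dy+\rho_1\int_{\mathbb R}uv\,dx.$$ A number $\lambda$ is an eigenvalue of $L_\Delta$ in $\Omega$ if there is $u\in\mathbb H(\Omega)\setminus\{0\}$ with $\mathcal E_L(u,v)=\lambda\int_\Omega uv\,dx$ for all $v\in\mathbb H(\Omega)$; the eigenvalues, counted with multiplicity, form a sequence $\lambda_1<\lambda_2\le\dots\to\infty$ and satisfy $$\lambda_k=\inf_{\substack{M\subset\mathbb H(\Omega)\\ \dim(M)=k}}\ \max_{\substack{u\in M\setminus\{0\}\\ \|u\|_{L^2(\Omega)}=1}}\mathcal E_L(u,u),\qquad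 k\in\mathbb N.$$ Discretization: $x_i=ih$ for $i=0,\dots,N+1$ and $\Omega_i=(x_i,x_{i+1})$ for $i=0,\dots,N$; $\mathcal V_h$ is the space of functions $v:\mathbb R\to\mathbb R$ that are continuous on $\Omega$, vanish on $\mathbb R\setminus\Omega$, and are polynomials of degree at most one on each $\Omega_i$ (jumps at $0$ and $L$ are allowed). It has dimension $N+2$ and (up to values on null sets) the basis $\varphi_0,\dots,\varphi_{N+1}$: for $1\le i\le N$, $\varphi_i(x)=\frac{x-x_{i-1}}h$ on $[x_{i-1},x_i]$, $\varphi_i(x)=\frac{x_{i+1}-x}h$ on $[x_i,x_{i+1}]$, and $\varphi_i=0$ elsewhere; $\varphi_0(x)=\frac{x_1-x}h$ on $[x_0,x_1]$ and $0$ elsewhere; $\varphi_{N+1}(x)=\frac{x-x_N}h$ on $[x_N,x_{N+1}]$ and $0$ elsewhere. The eigenvalues of the symmetric matrix $\mathcal A_h^L$ are listed in nondecreasing order, counted with multiplicity.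
   Formalization: The claim that λ_{k,h} is the k-th eigenvalue of the stiffness matrix is false for ordinary eigenvalues (L=1, N=0, k=1: 0.846 versus 0.423); it is stated and proved for eigenvalues of the stiffness matrix relative to the L² mass matrix of the hat functions. *)

(* Defs.v *)
From HB Require Import structures.
From mathcomp Require Import all_boot all_order all_algebra.
From mathcomp Require Import all_classical all_reals all_analysis.

Set Implicit Arguments.
Unset Strict Implicit.
Unset Printing Implicit Defensive.

Import Order.TTheory GRing.Theory Num.Theory.
Import numFieldNormedType.Exports.

Local Open Scope classical_set_scope.
Local Open Scope ring_scope.

Section LogLaplacian.
Context {R : realType}.
Implicit Types (L s l : R) (u v : R -> R) (k n : nat).

Local Notation mu := (@lebesgue_measure R).

Definition Gamma s : R :=
  \int[mu]_(t in `]0, +oo[) (t `^ (s - 1) * expR (- t)).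
Definition digamma s : R := derive1 Gamma s / Gamma s.
Definition euler_gamma : R := - derive1 Gamma 1.
Definition rho1 : R := 2 * ln 2 + digamma (1 / 2) - euler_gamma.

Definition Omega L : set R := `]0, L[.

(* Elements of L^2 are represented by functions, so membership, linear
   independence and dimension below are invariant under changes on null sets. *)
Definition ae0 u : Prop := {ae mu, forall x, u x = 0}.

Definition H_space L : set (R -> R) :=
  [set u | [/\ u \in Lfun mu 2%:E,
    {ae mu, forall x, ~ Omega L x -> u x = 0} &
    (\int[mu]_x \int[mu]_(y in `](x - 1)%R, (x + 1)%R[)
       ((`|u x - u y| ^+ 2 / `|x - y|)%:E) < +oo)%E]].

(* The value of the first integrand at y = x is 0, since 0^-1 = 0. *)
Definition E_L u v : R :=
  2^-1 * (\int[mu]_x \int[mu]_(y in `](x - 1), (x + 1)[)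
            ((u x - u y) * (v x - v y) / `|x - y|))
  - \int[(mu \x mu)%E]_(z in [set z | 1 <= `|z.1 - z.2|])
      (u z.1 * v z.2 / `|z.1 - z.2|)
  + rho1 * \int[mu]_x (u x * v x).

Definition L2dot L u v : R := \int[mu]_(x in Omega L) (u x * v x).
Definition L2norm L u : R := Num.sqrt (L2dot L u u).

Definition lin_comb n (c : 'I_n -> R) (b : 'I_n -> R -> R) : R -> R :=
  fun x => \sum_(i < n) c i * b i x.

Definition linear_subspace (M : set (R -> R)) : Prop :=
  M (fun=> 0) /\
  forall (a : R) u v, M u -> M v -> M (fun x => a * u x + v x).

Definition has_dim (M : set (R -> R)) n : Prop :=
  exists b : 'I_n -> R -> R,
    [/\ forall i, M (b i),
        forall c, ae0 (lin_comb c b) -> forall i, c i = 0 &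
        forall u, M u -> exists c, ae0 (fun x => u x - lin_comb c b x)].

Definition eigenspace L l : set (R -> R) :=
  [set u | H_space L u /\
    forall v, H_space L v -> E_L u v = l * L2dot L u v].

Definition is_eigenvalue L l : Prop :=
  exists2 u, eigenspace L l u & ~ ae0 u.

(* [lam 0 <= lam 1 <= ...] lists the eigenvalues in Omega, each repeated
   according to its multiplicity; the k-th eigenvalue (k >= 1) is
   [lam k.-1]. *)
Definition eigenvalue_sequence L (lam : nat -> R) : Prop :=
  [/\ {homo lam : i j / (i <= j)%N >-> i <= j},
      range lam = [set l | is_eigenvalue L l] &
      forall l, is_eigenvalue L l ->
        exists2 m, ([set j | lam j = l] #= `I_m)%card &
                   has_dim (eigenspace L l) m].

Definition is_max (A : set R) (m : R) : Prop := A m /\ ubound A m.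

Definition minmax L (V : set (R -> R)) k : R :=
  inf [set m | exists M : set (R -> R),
    [/\ M `<=` V, linear_subspace M, has_dim M k &
        is_max [set E_L u u | u in M `&` [set u | L2norm L u = 1]] m]].

Definition mesh L N : R := L / N.+1%:R.
Definition node L N (i : nat) : R := i%:R * mesh L N.

Definition V_h L N : set (R -> R) :=
  [set v | [/\ {within Omega L, continuous v},
    forall x, ~ Omega L x -> v x = 0 &
    forall i, (i <= N)%N -> exists2 p : {poly R}, (size p <= 2)%N &
      forall x, node L N i < x < node L N i.+1 -> v x = p.[x]]].

Definition lambda_h L N k : R := minmax L (V_h L N) k.

Definition hat L N (i : 'I_N.+2) : R -> R := fun x =>
  if (0 < i)%N && (node L N i.-1 <= x <= node L N i)
  then (x - node L N i.-1) / mesh L N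
  else if (i < N.+1)%N && (node L N i <= x <= node L N i.+1)
  then (node L N i.+1 - x) / mesh L N
  else 0.

Definition stiffness L N : 'M[R]_N.+2 :=
  \matrix_(i, j) E_L (hat L i) (hat L j).
Definition mass L N : 'M[R]_N.+2 :=
  \matrix_(i, j) L2dot L (hat L i) (hat L j).

(* [s] lists in nondecreasing order, with multiplicity, the numbers l such
   that A c = l B c for some c != 0; B is meant to be invertible. For the
   stiffness matrix, the constraint ||u_h|| = 1 on u_h = sum_i c_i phi_i reads
   c^T B c = 1 with B the mass matrix, so its eigenvalues are relative to B. *)
Definition eigenvalues_rel n (A B : 'M[R]_n) (s : seq R) : Prop :=
  sorted <=%R s /\
  char_poly (invmx B *m A) = \prod_(a <- s) ('X - a%:P).

End LogLaplacian.

(* Main.v *)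
(** Up to a multiple of the L^2 product, E_L is half the near-diagonal Dirichlet form
    D(u) = \iint_{|x-y|<1} |u(x)-u(y)|^2 / |x-y|, because the far part is bounded on L^2(0,L).
    Three facts about the energy space H(Omega) suffice. (i) V_h becomes dense in it: a
    function u is approximated by the quasi-interpolant whose nodal values are averages of u
    against the kernel 1/|z - x_i| restricted to 4h <= |z - x_i| < delta. The total mass
    ln(delta/4h) of this kernel tends to infinity, and that gain is exactly what makes the
    interpolation stable in D, uniformly in h. The same operator has finite rank and is
    uniformly close to the identity in L^2 on bounded energy sets, so (ii) the embedding
    H(Omega) -> L^2 is compact. (iii) E_L(., v) is continuous for the L^2 distance on bounded
    energy sets.

    The discrete min-max values are the eigenvalues s_0 <= s_1 <= ... of the pencil
    (stiffness, mass), by Courant's argument. Testing with approximations of exact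
    eigenvectors gives limsup s_k <= lam_k. If s_k stayed below lam_k - e along an
    ultrafilter, the limits of the first k+1 discrete eigenvectors would be k+1 orthonormal
    exact eigenvectors with eigenvalues below lam_k, which contradicts the multiplicity
    count. *)
Require Import Defs.
From HB Require Import structures.
From mathcomp Require Import all_boot all_order all_algebra.
From mathcomp Require Import all_classical all_reals all_analysis.
From mathcomp Require Import measurable_realfun.
From mathcomp Require Import ring lra.

Set Implicit Arguments.
Unset Strict Implicit.
Unset Printing Implicit Defensive.

Import Order.TTheory GRing.Theory Num.Theory.
Import numFieldNormedType.Exports.

Local Open Scope classical_set_scope.
Local Open Scope ring_scope.

(** * The truncated kernel 1/|x-y| and its seminorms *)

Section Kernel.
Context {R : realType}.
Local Notation mu := (@lebesgue_measure R).
Implicit Types (a b c x y : R) (u v w : R -> R).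

(** The obstacle is the part of the form at distances between h and 1. There the kernel is
    integrable in each variable, with mass 2 ln(1/h), so a squared L^2 error r is only known to cost
    at most 8 ln(1/h) r in energy. Averages over single cells would bound r by the energy itself,
    and the product would diverge. Spreading each average over all the scales from 4h to delta
    divides r by ln(delta/4h), which is comparable to ln(1/h), and the two logarithms cancel.

    What remains is a fixed multiple of the energy of u at distances below 2 delta; no rate in h is
    left. Smallness comes from delta alone: the near-diagonal energy of a fixed u tends to 0 with
    delta, and the mesh is refined after delta has been chosen.

    Functions are not quotiented by null sets. The L^2 pairing on them is therefore only
    semidefinite, and the spectral argument is written modulo vectors of zero norm. *)

Definition ker a b (z : R * R) : R :=
  if (a <= `|z.1 - z.2|) && (`|z.1 - z.2| < b) then `|z.1 - z.2|^-1 else 0.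

Lemma ker_ge0 a b z : 0 <= ker a b z.
Proof. by rewrite /ker; case: ifP. Qed.

Lemma ker_sym a b x y : ker a b (x, y) = ker a b (y, x).
Proof. by rewrite /ker /= distrC. Qed.

Lemma measurable_dist : measurable_fun setT (fun z : R * R => `|z.1 - z.2|).
Proof.
apply: measurableT_comp => //; apply: measurable_funB.
  exact: measurable_fst.
exact: measurable_snd.
Qed.

Lemma measurable_invnorm d (T : measurableType d) (f : T -> R) :
  measurable_fun setT f -> measurable_fun setT (fun z => `|f z|^-1).
Proof.
(* The power -1 agrees with the inverse on nonnegative reals, including [0^-1 = 0], and its
   measurability is at hand. *)
move=> mf; rewrite (_ : (fun _ => _) = (fun z => `|f z| `^ (-1))).
  apply: (@measurableT_comp _ _ _ _ _ _ (fun r : R => r `^ (-1))).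
    exact: measurable_powR.
  exact: measurableT_comp.
by apply/funext => z; rewrite powR_inv1.
Qed.

Lemma measurable_ker a b : measurable_fun setT (ker a b).
Proof.
apply: measurable_fun_ifT => /=.
- apply: measurable_and.
    by apply: measurable_fun_ler => //; exact: measurable_dist.
  by apply: measurable_fun_ltr => //; exact: measurable_dist.
- apply: measurable_invnorm; apply: measurable_funB.
    exact: measurable_fst.
  exact: measurable_snd.
- exact: measurable_cst.
Qed.

(** Uniqueness of Lebesgue measure reduces translation invariance to half-open intervals. *)
Lemma pushforward_translation x (A : set R) : measurable A ->
  pushforward mu (fun t : measurableTypeR R => (x + t : measurableTypeR R)) A
  = mu A.
Proof.
have mx : measurable_fun setT (fun t : measurableTypeR R => (x + t)).
  by apply: measurable_funD => //; exact: measurable_cst.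
pose m' : set _ -> \bar R := @pushforward _ _ _ _ R mu (fun t : measurableTypeR R => (x + t)).
move=> mA; apply/esym/lebesgue_measure_unique => //= _ [[a b]] _ <-.
rewrite /pushforward (_ : _ @^-1` _ = `](a - x), (b - x)]%classic).
  rewrite !lebesgue_measure_itv/= !lte_fin ltrD2r; case: ifP => // _.
  by rewrite -!EFinB; congr EFin; lra.
by apply/seteqP; split => t /=; rewrite !in_itv/=; lra.
Qed.

Lemma ge0_integral_translation x (f : R -> \bar R) :
  measurable_fun setT f -> (forall t, 0 <= f t)%E ->
  (\int[mu]_t f (x + t)%R = \int[mu]_t f t)%E.
Proof.
move=> mf f0.
have mx : measurable_fun setT (fun t : measurableTypeR R => (x + t : measurableTypeR R)).
  by apply: measurable_funD => //; exact: measurable_cst.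
rewrite -[LHS](@ge0_integral_pushforward _ _ _ _ _ _ mx mu setT f) //.
by apply: eq_measure_integral => A mA _; exact: pushforward_translation.
Qed.

Lemma ge0_integral_opp (f : R -> \bar R) :
  measurable_fun setT f -> (forall t, 0 <= f t)%E ->
  (\int[mu]_t f (- t)%R = \int[mu]_t f t)%E.
Proof.
move=> mf f0.
have mx : measurable_fun setT (-%R : measurableTypeR R -> measurableTypeR R) by [].
rewrite -[LHS](@ge0_integral_pushforward _ _ _ _ _ _ mx mu setT f) //.
by apply: eq_measure_integral => A mA _; exact: lebesgue_measureN.
Qed.

Lemma integral_inv a b : 0 < a -> a <= b ->
  (\int[mu]_(t in `[a, b[) (t^-1)%:E = (ln b - ln a)%:E)%E.
Proof.
move=> a0; rewrite le_eqVlt => /predU1P[<-|ab].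
  by rewrite set_itvco0// integral_set0 subrr.
have dv x : x \in `]a, b[ -> is_derive x 1 (@ln R) x^-1.
  by rewrite in_itv/= => /andP[ax xb]; apply: is_derive1_ln; exact: lt_trans ax.
have cinv : {within `[a, b], continuous (fun t : R => t^-1)}.
  apply: continuous_in_subspaceT => x; rewrite inE/= in_itv/= => /andP[ax _].
  by apply: inv_continuous; rewrite gt_eqF// (lt_le_trans a0).
rewrite integral_itv_bndo_bndc; last first.
  apply/measurable_EFinP; apply: measurable_funS (subspace_continuous_measurable_fun _ cinv) => //.
  by move=> t /=; rewrite !in_itv/= => /andP[-> /ltW].
rewrite (continuous_FTC2 ab cinv (F := @ln R))//.
- split.
  + by move=> x /dv[].
  + by apply: cvg_at_right_filter; exact: continuous_ln.
  + by apply: cvg_at_left_filter; apply: continuous_ln; exact: lt_trans ab.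
- by move=> x /dv h; rewrite derive1E derive_val.
Qed.

(** The half of the kernel on positive offsets: two mirror images make up [ker], and single ones,
    placed at a node, are the averaging weights of the quasi-interpolant. Its mass ln b - ln a is
    the source of every logarithm below. *)
Definition oker a b t : R := if (a <= t) && (t < b) then `|t|^-1 else 0.

Lemma oker_ge0 a b t : 0 <= oker a b t.
Proof. by rewrite /oker; case: ifP. Qed.

Lemma measurable_oker a b : measurable_fun setT (oker a b).
Proof.
apply: measurable_fun_ifT => /=.
- by apply: measurable_and; [exact: measurable_fun_ler|exact: measurable_fun_ltr].
- exact: measurable_invnorm.
- exact: measurable_cst.
Qed.

Lemma integral_oker a b : 0 < a -> a <= b ->
  (\int[mu]_t (oker a b t)%:E = (ln b - ln a)%:E)%E.
Proof.
move=> a0 ab; rewrite -(integral_inv a0 ab) [RHS]integral_mkcond.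
apply: eq_integral => t _; rewrite patchE /oker mem_setE in_itv/=.
by case: ifPn => // /andP[at' _]; rewrite ger0_norm// (le_trans (ltW a0)).
Qed.

Lemma integral_oker_right a b p : 0 < a -> a <= b ->
  (\int[mu]_z (oker a b (z - p))%:E = (ln b - ln a)%:E)%E.
Proof.
move=> a0 ab; rewrite -(integral_oker a0 ab).
have m : measurable_fun setT (EFin \o oker a b).
  by apply/measurable_EFinP; exact: measurable_oker.
rewrite -[RHS](ge0_integral_translation (- p) m); last by move=> t; rewrite lee_fin oker_ge0.
by apply: eq_integral => t _; rewrite addrC.
Qed.

Lemma integral_oker_left a b p : 0 < a -> a <= b ->
  (\int[mu]_z (oker a b (p - z))%:E = (ln b - ln a)%:E)%E.
Proof.
move=> a0 ab; rewrite -(integral_oker_right (- p) a0 ab).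
rewrite -[LHS](@ge0_integral_opp (fun z => (oker a b (p - z))%:E)).
- by apply: eq_integral => z _; rewrite !opprK addrC.
- apply/measurable_EFinP; apply: (measurableT_comp (measurable_oker a b)).
  by apply: measurable_funB => //; exact: measurable_cst.
- by move=> z; rewrite lee_fin oker_ge0.
Qed.

Lemma integral_ker a b x : 0 < a -> a <= b ->
  (\int[mu]_y (ker a b (x, y))%:E = (2 * (ln b - ln a))%:E)%E.
Proof.
move=> a0 ab.
have -> : (\int[mu]_y (ker a b (x, y))%:E =
    \int[mu]_y ((oker a b (y - x))%:E + (oker a b (x - y))%:E))%E.
  apply: eq_integral => y _; rewrite /ker /oker /= -EFinD; congr EFin.
  have [t0|t0] := leP 0 (x - y).
    rewrite ger0_norm//; have -> : (a <= y - x) = false by apply/negbTE; rewrite -ltNge; lra.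
    by rewrite add0r.
  rewrite distrC; have t1 : 0 <= y - x by lra.
  rewrite (ger0_norm t1); have -> : (a <= x - y) = false by apply/negbTE; rewrite -ltNge; lra.
  by rewrite addr0.
have m1 : measurable_fun (setT : set (measurableTypeR R)) (fun y => (oker a b (y - x))%:E).
  apply/measurable_EFinP; apply: (measurableT_comp (measurable_oker a b)).
  by apply: measurable_funB => //; exact: measurable_cst.
have m2 : measurable_fun (setT : set (measurableTypeR R)) (fun y => (oker a b (x - y))%:E).
  apply/measurable_EFinP; apply: (measurableT_comp (measurable_oker a b)).
  by apply: measurable_funB => //; exact: measurable_cst.
rewrite ge0_integralD//; try by move=> y _; rewrite lee_fin oker_ge0.
rewrite integral_oker_right// integral_oker_left// -EFinD; congr EFin; lra.
Qed.
End Kernel.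

Ltac pos := rewrite ?lee_fin -?EFinM -?EFinD ?lee_fin; repeat first
  [exact: sqr_ge0 | exact: ker_ge0 | exact: ler0n | done | apply: mulr_ge0 | apply: addr_ge0].

(** * Energy on shells of distances *)

Section Seminorm.
Context {R : realType}.
Local Notation mu := (@lebesgue_measure R).
Implicit Types (a b c x y : R) (u v w : R -> R).

(** Extended real values let the estimates hold for every measurable function; finiteness is then a
    membership condition. *)
Definition normq u : \bar R := (\int[mu]_x ((u x) ^+ 2)%:E)%E.

Definition Dq a b u : \bar R :=
  (\int[(mu \x mu)%E]_z ((u z.1 - u z.2) ^+ 2 * ker a b z)%:E)%E.

Lemma measurable_fst_comp u : measurable_fun setT u ->
  measurable_fun setT (fun z : R * R => u z.1).
Proof. by move=> mu_; apply: (measurableT_comp mu_); exact: measurable_fst. Qed.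

Lemma measurable_snd_comp u : measurable_fun setT u ->
  measurable_fun setT (fun z : R * R => u z.2).
Proof. by move=> mu_; apply: (measurableT_comp mu_); exact: measurable_snd. Qed.

Lemma measurable_Dq a b u : measurable_fun setT u ->
  measurable_fun setT (fun z : R * R => (u z.1 - u z.2) ^+ 2 * ker a b z).
Proof.
move=> mu_; apply: measurable_funM; last exact: measurable_ker.
apply: measurable_funX; apply: measurable_funB.
  exact: measurable_fst_comp.
exact: measurable_snd_comp.
Qed.

Lemma Dq_ge0 a b u : (0 <= Dq a b u)%E.
Proof.
by apply: integral_ge0 => z _; rewrite lee_fin mulr_ge0 ?sqr_ge0 ?ker_ge0.
Qed.

Lemma Dq_iter a b u : measurable_fun setT u ->
  (Dq a b u = \int[mu]_x \int[mu]_y ((u x - u y) ^+ 2 * ker a b (x, y))%:E)%E.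
Proof.
move=> mu_; rewrite /Dq fubini_tonelli1//.
  by apply/measurable_EFinP; exact: measurable_Dq.
by move=> z; rewrite lee_fin mulr_ge0 ?sqr_ge0 ?ker_ge0.
Qed.

Lemma le_ker a b a' b' z : a' <= a -> b <= b' -> ker a b z <= ker a' b' z.
Proof.
move=> aa bb; rewrite /ker; case: ifPn => [/andP[h1 h2]|_]; last by case: ifP.
by rewrite (le_trans aa h1) (lt_le_trans h2 bb).
Qed.

Lemma le_Dq a b a' b' u : measurable_fun setT u -> a' <= a -> b <= b' ->
  (Dq a b u <= Dq a' b' u)%E.
Proof.
move=> mu_ aa bb; apply: ge0_le_integral => //.
- by move=> z _; rewrite lee_fin mulr_ge0 ?sqr_ge0 ?ker_ge0.
- by apply/measurable_EFinP; exact: measurable_Dq.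
- by apply/measurable_EFinP; exact: measurable_Dq.
- by move=> z _; rewrite lee_fin ler_wpM2l ?sqr_ge0// le_ker.
Qed.

Lemma integral_sqr_ker a b u : measurable_fun setT u -> 0 < a -> a <= b ->
  (\int[(mu \x mu)%E]_z ((u z.1) ^+ 2 * ker a b z)%:E =
    (2 * (ln b - ln a))%:E * normq u)%E.
Proof.
move=> mu_ a0 ab.
rewrite fubini_tonelli1/=; last 2 first.
- apply/measurable_EFinP; apply: measurable_funM; last exact: measurable_ker.
  by apply: measurable_funX; exact: measurable_fst_comp.
- by move=> z; rewrite lee_fin mulr_ge0 ?sqr_ge0 ?ker_ge0.
have l0 : 0 <= 2 * (ln b - ln a) by rewrite mulr_ge0// subr_ge0 ler_ln ?posrE// (lt_le_trans a0).
rewrite -[RHS]ge0_integralZl//; last 2 first.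
- by apply/measurable_EFinP; exact: measurable_funX.
- by move=> x _; rewrite lee_fin sqr_ge0.
apply: eq_integral => x _; rewrite /fubini_F/=.
under eq_integral do rewrite EFinM.
rewrite ge0_integralZl ?integral_ker//; first by rewrite muleC.
- by apply/measurable_EFinP; apply: measurableT_comp; [exact: measurable_ker|].
- by move=> y _; rewrite lee_fin ker_ge0.
by rewrite lee_fin sqr_ge0.
Qed.

Lemma integral_sqr_ker2 a b u : measurable_fun setT u -> 0 < a -> a <= b ->
  (\int[(mu \x mu)%E]_z ((u z.2) ^+ 2 * ker a b z)%:E =
    (2 * (ln b - ln a))%:E * normq u)%E.
Proof.
move=> mu_ a0 ab; rewrite -integral_sqr_ker//.
rewrite fubini_tonelli2/=; last 2 first.
- apply/measurable_EFinP; apply: measurable_funM; last exact: measurable_ker.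
  by apply: measurable_funX; exact: measurable_snd_comp.
- by move=> z; rewrite lee_fin mulr_ge0 ?sqr_ge0 ?ker_ge0.
rewrite fubini_tonelli1/=; last 2 first.
- apply/measurable_EFinP; apply: measurable_funM; last exact: measurable_ker.
  by apply: measurable_funX; exact: measurable_fst_comp.
- by move=> z; rewrite lee_fin mulr_ge0 ?sqr_ge0 ?ker_ge0.
by apply: eq_integral => x _; apply: eq_integral => y _ /=; rewrite ker_sym.
Qed.

Lemma sqrB_le (r s : R) : (r - s) ^+ 2 <= 2 * r ^+ 2 + 2 * s ^+ 2.
Proof. by have := sqr_ge0 (r + s); nra. Qed.

Lemma sqrD_le (r s : R) : (r + s) ^+ 2 <= 2 * r ^+ 2 + 2 * s ^+ 2.
Proof. by have := sqr_ge0 (r - s); nra. Qed.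

(** Away from the diagonal the kernel has mass 2 (ln b - ln a) in either variable, so the energy is
    an L^2 quantity. The 8 is that 2, times 2 from [sqrB_le], times 2 for the two variables. *)
Lemma Dq_le_normq a b u : measurable_fun setT u -> 0 < a -> a <= b ->
  (Dq a b u <= (8 * (ln b - ln a))%:E * normq u)%E.
Proof.
move=> mu_ a0 ab.
have -> : ((8 * (ln b - ln a))%:E * normq u =
   2%:E * ((2 * (ln b - ln a))%:E * normq u)+
   2%:E * ((2 * (ln b - ln a))%:E * normq u))%E.
  have l0 : 0 <= 2 * (ln b - ln a) by rewrite mulr_ge0// subr_ge0 ler_ln ?posrE// (lt_le_trans a0).
  rewrite !muleA -!EFinM -ge0_muleDl; last 2 first.
  - by rewrite lee_fin mulr_ge0.
  - by rewrite lee_fin mulr_ge0.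
  by rewrite -EFinD; congr (_%:E * _)%E; lra.
rewrite -{1}integral_sqr_ker// -integral_sqr_ker2//.
have m1 : measurable_fun setT (fun z : R * R => (u z.1) ^+ 2 * ker a b z).
  apply: measurable_funM; last exact: measurable_ker.
  by apply: measurable_funX; exact: measurable_fst_comp.
have m2 : measurable_fun setT (fun z : R * R => (u z.2) ^+ 2 * ker a b z).
  apply: measurable_funM; last exact: measurable_ker.
  by apply: measurable_funX; exact: measurable_snd_comp.
rewrite -!ge0_integralZl//; last 4 first.
- exact/measurable_EFinP.
- by move=> z _; rewrite lee_fin mulr_ge0 ?sqr_ge0 ?ker_ge0.
- exact/measurable_EFinP.
- by move=> z _; rewrite lee_fin mulr_ge0 ?sqr_ge0 ?ker_ge0.
rewrite -ge0_integralD//; last 4 first.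
- by move=> z _; pos.
- by apply/measurable_EFinP; apply: measurable_funM.
- by move=> z _; pos.
- by apply/measurable_EFinP; apply: measurable_funM.
apply: ge0_le_integral => //.
- by move=> z _; rewrite lee_fin mulr_ge0 ?sqr_ge0 ?ker_ge0.
- by apply/measurable_EFinP; exact: measurable_Dq.
- by apply/measurable_EFinP; apply: measurable_funD; apply: measurable_funM.
- move=> z _; rewrite -!EFinM -EFinD lee_fin.
  by have := ler_wpM2r (ker_ge0 a b z) (sqrB_le (u z.1) (u z.2)); lra.
Qed.

Lemma le_DqD a b u v : measurable_fun setT u -> measurable_fun setT v ->
  (Dq a b (fun x => u x + v x)%R <= 2%:E * Dq a b u + 2%:E * Dq a b v)%E.
Proof.
move=> mu_ mv.
have m1 := measurable_Dq a b mu_; have m2 := measurable_Dq a b mv.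
rewrite -!ge0_integralZl//; last 4 first.
- exact/measurable_EFinP.
- by move=> z _; rewrite lee_fin mulr_ge0 ?sqr_ge0 ?ker_ge0.
- exact/measurable_EFinP.
- by move=> z _; rewrite lee_fin mulr_ge0 ?sqr_ge0 ?ker_ge0.
rewrite -ge0_integralD//; last 4 first.
- by move=> z _; pos.
- by apply/measurable_EFinP; apply: measurable_funM.
- by move=> z _; pos.
- by apply/measurable_EFinP; apply: measurable_funM.
apply: ge0_le_integral => //.
- by move=> z _; rewrite lee_fin mulr_ge0 ?sqr_ge0 ?ker_ge0.
- by apply/measurable_EFinP; apply: (@measurable_Dq a b (fun x => u x + v x)); exact: measurable_funD.
- by apply/measurable_EFinP; apply: measurable_funD; apply: measurable_funM.
- move=> z _; rewrite -!EFinM -EFinD lee_fin.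
  by have := ler_wpM2r (ker_ge0 a b z) (sqrD_le (u z.1 - u z.2) (v z.1 - v z.2)); lra.
Qed.

Lemma le_normqD u v : measurable_fun setT u -> measurable_fun setT v ->
  (normq (fun x => u x + v x)%R <= 2%:E * normq u + 2%:E * normq v)%E.
Proof.
move=> mu_ mv.
have m1 := measurable_funX 2 mu_; have m2 := measurable_funX 2 mv.
rewrite -!ge0_integralZl//; last 4 first.
- exact/measurable_EFinP.
- by move=> z _; rewrite lee_fin sqr_ge0.
- exact/measurable_EFinP.
- by move=> z _; rewrite lee_fin sqr_ge0.
rewrite -ge0_integralD//; last 4 first.
- by move=> z _; pos.
- by apply/measurable_EFinP; apply: measurable_funM.
- by move=> z _; pos.
- by apply/measurable_EFinP; apply: measurable_funM.
apply: ge0_le_integral => //.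
- by move=> z _; rewrite lee_fin sqr_ge0.
- by apply/measurable_EFinP; apply: measurable_funX; exact: measurable_funD.
- by apply/measurable_EFinP; apply: measurable_funD; apply: measurable_funM.
- by move=> z _; rewrite -!EFinM -EFinD lee_fin sqrD_le.
Qed.

Lemma DqZ a b c u : measurable_fun setT u ->
  (Dq a b (fun x => c * u x)%R = (c ^+ 2)%:E * Dq a b u)%E.
Proof.
move=> mu_; rewrite -ge0_integralZl ?lee_fin ?sqr_ge0//; last 2 first.
- by apply/measurable_EFinP; exact: measurable_Dq.
- by move=> z _; rewrite lee_fin mulr_ge0 ?sqr_ge0 ?ker_ge0.
by apply: eq_integral => z _; rewrite -EFinM; congr EFin; ring.
Qed.

(** The shells are half open, so adjacent ones tile without overlap. *)
Lemma kerD a b c z : a <= b -> b <= c -> ker a c z = ker a b z + ker b c z.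
Proof.
move=> ab bc; rewrite /ker; have [h|h] := ltP `|z.1 - z.2| b; last first.
  by rewrite (le_trans ab h) /= add0r.
by rewrite (lt_le_trans h bc) /= addr0.
Qed.

Lemma Dq_split a b c u : measurable_fun setT u -> a <= b -> b <= c ->
  (Dq a c u = Dq a b u + Dq b c u)%E.
Proof.
move=> mu_ ab bc; rewrite -ge0_integralD//; last 4 first.
- by move=> z _; rewrite lee_fin mulr_ge0 ?sqr_ge0 ?ker_ge0.
- by apply/measurable_EFinP; exact: measurable_Dq.
- by move=> z _; rewrite lee_fin mulr_ge0 ?sqr_ge0 ?ker_ge0.
- by apply/measurable_EFinP; exact: measurable_Dq.
by apply: eq_integral => z _; rewrite -EFinD -mulrDr -kerD.
Qed.

(** Monotone convergence: off the diagonal the integrands are eventually constant, and on it the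
    factor (u x - u y)^2 vanishes. *)
Lemma Dq_cvg u : measurable_fun setT u ->
  (Dq n.+1%:R^-1 1 u @[n --> \oo] --> Dq 0 1 u)%E.
Proof.
move=> mu_; pose g n (z : R * R) := ((u z.1 - u z.2) ^+ 2 * ker n.+1%:R^-1 1 z)%:E.
have -> : Dq 0 1 u = (\int[(mu \x mu)%E]_z (fun z => limn (g ^~ z)) z)%E.
  apply: eq_integral => z _; apply/esym/cvg_lim => //.
  have [zz|zz] := eqVneq z.1 z.2.
    rewrite /g zz subrr expr0n/= mul0r; under eq_fun do rewrite mul0r.
    exact: cvg_cst.
  apply: cvg_near_cst.
  have d0 : 0 < `|z.1 - z.2| by rewrite normr_gt0 subr_eq0.
  near=> n; rewrite /g /ker ltW//=; last first.
    by near: n; apply: near_infty_natSinv_lt (PosNum d0).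
  by rewrite ltW.
apply: (@cvg_monotone_convergence _ _ _ _ setT) => //.
- by move=> n; apply/measurable_EFinP; exact: measurable_Dq.
- by move=> n z _; rewrite lee_fin mulr_ge0 ?sqr_ge0 ?ker_ge0.
- move=> z _ n m nm; rewrite lee_fin ler_wpM2l ?sqr_ge0// le_ker//.
  by rewrite lef_pV2 ?posrE// ler_nat.
Unshelve. all: by end_near. Qed.

Lemma normr_Ninner x y : (`|x - y| < 1) = (y \in `](x - 1), (x + 1)[).
Proof. by rewrite in_itv/= ltr_norml; apply/idP/idP => /andP[]; lra. Qed.

End Seminorm.

(** * The discriminant criterion *)

Section QuadraticForm.
Context {R : realType}.

(** The degenerate case [r = 0] is covered, which gives Cauchy-Schwarz for semidefinite forms. *)
Lemma discriminant_le (p q r : R) :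
  (forall t, 0 <= p + 2 * q * t + r * t ^+ 2) -> q ^+ 2 <= p * r.
Proof.
move=> h; have p0 : 0 <= p by have := h 0; rewrite expr0n/= !mulr0 !addr0.
have [r0|r0] := ltP 0 r.
  have := h (- q / r); rewrite (_ : _ + _ = p - q ^+ 2 / r); last by field; rewrite gt_eqF.
  by rewrite subr_ge0 ler_pdivrMr.
have [q0|q0] := eqVneq q 0.
  rewrite q0 expr0n/=; rewrite mulr_ge0//.
  (* If r < 0, the chosen s satisfies s >= 1 and s (-r) = p + 1 - r, so that p + r s^2 <= r - 1 <
     0. *)
  rewrite leNgt; apply/negP => rn; have := h ((p + 1) / (- r) + 1); rewrite q0.
  have s1 : 1 <= (p + 1) / - r + 1 by rewrite lerDr divr_ge0; lra.
  set s := _ + 1 in s1 *; have : s * (- r) = p + 1 - r by rewrite /s; field; lra.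
  nra.
(* At this t the linear term is -(p + 1), and the trinomial is at most -1 because r <= 0. *)
have := h (- (p + 1) / (2 * q)).
rewrite (_ : 2 * q * _ = - (p + 1)); last by field.
have := sqr_ge0 (- (p + 1) / (2 * q)); set s := (_ ^+ 2); nra.
Qed.
End QuadraticForm.

(** * Weighted L^2 pairings *)

Section WeightedDot.
Context {R : realType} d (T : measurableType d) (m : {measure set T -> \bar R}).
Variable w : T -> R.
Hypotheses (mw : measurable_fun setT w) (w0 : forall x, 0 <= w x).
Implicit Types (f g h : T -> R).

(** Three instances are used: weight 1 on the line for L^2, [ker] on the plane applied to
    differences for the Dirichlet form, and the averaging weights for the nodal values. *)
Definition W2 f := measurable_fun setT f /\ (\int[m]_x (f x ^+ 2 * w x)%:E < +oo)%E.
Definition wdot f g : R := \int[m]_x (f x * g x * w x).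

Lemma W2_integrable f g : W2 f -> W2 g ->
  m.-integrable setT (EFin \o (fun x => f x * g x * w x)).
Proof.
move=> [mf f2] [mg g2].
have sq h : measurable_fun setT h -> (\int[m]_x (h x ^+ 2 * w x)%:E < +oo)%E ->
    m.-integrable setT (EFin \o (fun x => h x ^+ 2 * w x)).
  move=> mh h2; apply/integrableP; split.
    by apply/measurable_EFinP; apply: measurable_funM => //; exact: measurable_funX.
  rewrite (eq_integral (fun x => (h x ^+ 2 * w x)%:E))// => x _.
  by rewrite gee0_abs// lee_fin mulr_ge0// sqr_ge0.
apply: le_integrable (integrableD measurableT (sq f mf f2) (sq g mg g2)) => //.
- apply/measurable_EFinP; apply: measurable_funM => //; exact: measurable_funM.
- move=> x _ /=; rewrite lee_fin -mulrDl !normrM (ger0_norm (w0 x)).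
  rewrite ler_wpM2r// [leRHS]ger0_norm ?addr_ge0 ?sqr_ge0// -normrM ler_norml.
  by have := sqr_ge0 (f x + g x); have := sqr_ge0 (f x - g x); nra.
Qed.

Lemma W2D f g : W2 f -> W2 g -> W2 (fun x => f x + g x).
Proof.
move=> hf hg; split; first exact: measurable_funD hf.1 hg.1.
have hff := W2_integrable hf hf; have hgg := W2_integrable hg hg.
have hfg := W2_integrable hf hg.
have := integrableD measurableT (integrableD measurableT hff hgg) (integrableD measurableT hfg hfg).
move=> /integrableP[_]; apply: le_lt_trans.
rewrite le_eqVlt; apply/orP; left; apply/eqP.
apply: eq_integral => x _.
have : 0 <= (f x + g x) ^+ 2 * w x by rewrite mulr_ge0// sqr_ge0.
move=> h; rewrite /=; congr EFin; rewrite ger0_norm; first by ring.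
by apply: le_trans h _; lra.
Qed.

Lemma W2Z (c : R) f : W2 f -> W2 (fun x => c * f x).
Proof.
move=> hf; split; first by apply: measurable_funM hf.1.
have := integrableZl measurableT (c ^+ 2) (W2_integrable hf hf).
move=> /integrableP[_]; apply: le_lt_trans.
rewrite le_eqVlt; apply/orP; left; apply/eqP.
apply: eq_integral => x _; rewrite gee0_abs /=; first by congr EFin; ring.
by rewrite -EFinM lee_fin mulr_ge0 ?sqr_ge0// mulr_ge0// -expr2 sqr_ge0.
Qed.

Lemma wdotC f g : wdot f g = wdot g f.
Proof. by apply: eq_Rintegral => x _; rewrite (mulrC (f x)). Qed.

Lemma wdotDl f g h : W2 f -> W2 g -> W2 h ->
  wdot (fun x => f x + g x) h = wdot f h + wdot g h.
Proof.
move=> hf hg hh; rewrite -RintegralD//; last 2 first.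
- exact: W2_integrable.
- exact: W2_integrable.
by apply: eq_Rintegral => x _; rewrite !mulrDl.
Qed.

Lemma wdotZl (c : R) f h : W2 f -> W2 h ->
  wdot (fun x => c * f x) h = c * wdot f h.
Proof.
move=> hf hh; rewrite -RintegralZl//; last exact: W2_integrable.
by apply: eq_Rintegral => x _; rewrite !mulrA.
Qed.

Lemma wdot_ge0 f : 0 <= wdot f f.
Proof. by apply: Rintegral_ge0 => x _; rewrite mulr_ge0// -expr2 sqr_ge0. Qed.

Lemma wdotE f : W2 f -> ((wdot f f)%:E = \int[m]_x (f x ^+ 2 * w x)%:E)%E.
Proof. by move=> hf; rewrite fineK//; exact: integrable_fin_num (W2_integrable hf hf). Qed.

Lemma wdot_CS f g : W2 f -> W2 g -> (wdot f g) ^+ 2 <= wdot f f * wdot g g.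
Proof.
move=> hf hg; apply: discriminant_le => t.
have := wdot_ge0 (fun x => f x + t * g x).
have hz := W2Z t hg.
rewrite wdotDl//; last exact: W2D.
rewrite wdotZl//; last exact: W2D.
rewrite (wdotC f) (wdotC g) !wdotDl// !wdotZl// (wdotC g f).
by move=> h; apply: le_trans h _; lra.
Qed.
End WeightedDot.

Section AlmostEverywhere.
Context {R : realType}.
Local Notation mu := (@lebesgue_measure R).

Lemma ae_S (P Q : R -> Prop) : (forall x, P x -> Q x) ->
  {ae mu, forall x, P x} -> {ae mu, forall x, Q x}.
Proof. by move=> PQ; apply: negligibleS => x /= nQ Px; apply: nQ; exact: PQ. Qed.

Lemma ae_S2 (P Q S : R -> Prop) : (forall x, P x -> Q x -> S x) ->
  {ae mu, forall x, P x} -> {ae mu, forall x, Q x} -> {ae mu, forall x, S x}.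
Proof.
move=> PQ h1 h2; apply: negligibleS (negligibleU h1 h2) => x /= nS.
by have [Px|nP] := pselect (P x); [right => Qx; apply: nS; exact: PQ|left].
Qed.
End AlmostEverywhere.

(** * The energy space and the form E_L *)

Section Forms.
Context {R : realType}.
Local Notation mu := (@lebesgue_measure R).
Implicit Types (a b c x y L : R) (u v w : R -> R).

Definition L2 u := measurable_fun setT u /\ (normq u < +oo)%E.
Definition dlt u (z : R * R) : R := u z.1 - u z.2.
Definition Dd a b u v : R := wdot (mu \x mu)%E (ker a b) (dlt u) (dlt v).
Definition dot u v : R := \int[mu]_x (u x * v x).
Definition far u v : R := \int[(mu \x mu)%E]_(z in [set z | 1 <= `|z.1 - z.2|])
  (u z.1 * v z.2 / `|z.1 - z.2|).

Definition inH L u := [/\ L2 u, {ae mu, forall x, ~ Omega L x -> u x = 0} &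
  (Dq 0 1 u < +oo)%E].

Lemma dotE u v : dot u v = wdot mu (cst 1) u v.
Proof. by apply: eq_Rintegral => x _; rewrite mulr1. Qed.

Lemma L2W u : L2 u <-> W2 mu (cst 1) u.
Proof.
rewrite /L2 /W2 /normq; have -> // : (\int[mu]_x (u x ^+ 2)%:E =
  \int[mu]_x (u x ^+ 2 * cst 1 x)%:E)%E.
by apply: eq_integral => x _; rewrite mulr1.
Qed.

Lemma measurable_dlt u : measurable_fun setT u -> measurable_fun setT (dlt u).
Proof.
move=> mu_; apply: measurable_funB; [exact: measurable_fst_comp|exact: measurable_snd_comp].
Qed.

Lemma DqW a b u : measurable_fun setT u -> (Dq a b u < +oo)%E ->
  W2 (mu \x mu)%E (ker a b) (dlt u).
Proof. by move=> mu_ Du; split => //; exact: measurable_dlt. Qed.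

Let RR := (measurableTypeR R * measurableTypeR R)%type.
Let mker a b : measurable_fun (setT : set RR) (ker a b : RR -> R).
Proof. exact: measurable_ker. Qed.
Let ker0 a b (z : RR) : 0 <= (ker a b : RR -> R) z.
Proof. exact: ker_ge0. Qed.
Let m1 : measurable_fun (setT : set (measurableTypeR R)) (@cst (measurableTypeR R) R 1).
Proof. exact: measurable_cst. Qed.
Let p1 (x : measurableTypeR R) : 0 <= (@cst (measurableTypeR R) R 1 x).
Proof. exact: ler01. Qed.

Lemma normqE u : L2 u -> (normq u = (dot u u)%:E)%E.
Proof.
move=> /L2W hu; rewrite dotE wdotE//.
by apply: eq_integral => x _; rewrite mulr1.
Qed.

Lemma DqE a b u : measurable_fun setT u -> (Dq a b u < +oo)%E ->
  (Dq a b u = (Dd a b u u)%:E)%E.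
Proof. by move=> mu_ Du; rewrite /Dd (wdotE (mker a b) (ker0 a b) (DqW mu_ Du)). Qed.

Lemma dotC u v : dot u v = dot v u.
Proof. by rewrite !dotE wdotC. Qed.

Lemma dot_ge0 u : 0 <= dot u u.
Proof. by rewrite dotE wdot_ge0. Qed.

Lemma L2D u v : L2 u -> L2 v -> L2 (fun x => u x + v x).
Proof. by move=> /L2W hu /L2W hv; apply/L2W; exact: W2D. Qed.

Lemma L2Z c u : L2 u -> L2 (fun x => c * u x).
Proof. by move=> /L2W hu; apply/L2W; exact: W2Z. Qed.

Lemma dotDl u v w : L2 u -> L2 v -> L2 w ->
  dot (fun x => u x + v x) w = dot u w + dot v w.
Proof. by move=> /L2W hu /L2W hv /L2W hw; rewrite !dotE wdotDl. Qed.

Lemma dotZl c u w : L2 u -> L2 w -> dot (fun x => c * u x) w = c * dot u w.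
Proof. by move=> /L2W hu /L2W hw; rewrite !dotE wdotZl. Qed.

Lemma dot_CS u v : L2 u -> L2 v -> dot u v ^+ 2 <= dot u u * dot v v.
Proof. by move=> /L2W hu /L2W hv; rewrite !dotE wdot_CS. Qed.

Lemma Lfun2P u : u \in Lfun mu 2%:E <-> L2 u.
Proof.
split=> [hu|[mu_ nu]].
  have /integrableP[_] := Lfun2_integrable_sqr hu.
  move: hu; rewrite inE => /andP[]; rewrite !inE/= => mu_ _.
  move=> h; split=> //; apply: le_lt_trans h.
  by apply: ge0_le_integral => //; [by move=> x _; pos|
    by apply/measurable_EFinP; exact: measurable_funX|
    by do 2 apply: measurableT_comp => //; exact: measurable_funX|
    by move=> x _; rewrite lee_fin; exact: ler_norm].
rewrite inE; apply/andP; split; rewrite inE//=.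
rewrite /finite_norm unlock; apply: poweR_lty.
apply: le_lt_trans nu; rewrite le_eqVlt; apply/orP; left; apply/eqP.
by apply: eq_integral => x _ /=; rewrite powR_mulrn// real_normK// num_real.
Qed.

Lemma ker01E x y (r : R) : r / `|x - y| * (y \in `](x - 1), (x + 1)[)%:R = r * ker 0 1 (x, y).
Proof. by rewrite /ker /= normr_ge0 /= normr_Ninner; case: ifP => _; rewrite ?mulr1 ?mulr0. Qed.

Lemma inHP L u : H_space L u <-> inH L u.
Proof.
rewrite /H_space /inH /=; split=> -[hu h0 hD].
  have hu' := (Lfun2P u).1 hu; split=> //.
  rewrite Dq_iter; last by case: hu'.
  apply: le_lt_trans hD; rewrite le_eqVlt; apply/orP; left; apply/eqP.
  apply: eq_integral => x _; rewrite [RHS]integral_mkcond; apply: eq_integral => y _.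
  rewrite patchE mem_setE -ker01E -normrX (ger0_norm (sqr_ge0 _)).
  by case: ifP => _; rewrite ?mulr1 ?mulr0.
have hu' := (Lfun2P u).2 hu; split=> //.
apply: le_lt_trans hD; rewrite Dq_iter; last by case: hu.
rewrite le_eqVlt; apply/orP; left; apply/eqP.
apply: eq_integral => x _; rewrite [LHS]integral_mkcond; apply: eq_integral => y _.
rewrite patchE mem_setE -ker01E -normrX (ger0_norm (sqr_ge0 _)).
by case: ifP => _; rewrite ?mulr1 ?mulr0.
Qed.

Lemma inH_L2 L u : inH L u -> L2 u. Proof. by case. Qed.
Lemma inH_W L u : inH L u -> W2 (mu \x mu)%E (ker 0 1) (dlt u).
Proof. by case=> -[? _] _ ?; exact: DqW. Qed.

(** The iterated integral in [E_L] takes [fine] of each inner integral. It matches the Fubini inner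
    integral only where the latter is finite, that is for almost every x, so the two sides are
    compared almost everywhere. *)
Lemma DdE L u v : inH L u -> inH L v ->
  \int[mu]_x \int[mu]_(y in `](x - 1), (x + 1)[)
            ((u x - u y) * (v x - v y) / `|x - y|) = Dd 0 1 u v.
Proof.
move=> hu hv.
have I := W2_integrable (mker 0 1) (ker0 0 1) (inH_W hu) (inH_W hv).
rewrite /Dd /wdot /Rintegral -(integral12_prod_meas1 I).
congr fine; apply: ae_eq_integral => //.
- apply/measurable_EFinP; apply: (@measurableT_comp _ _ _ _ _ _ fine).
    exact: fine_measurable.
  rewrite (_ : (fun _ => _) = fubini_F mu (EFin \o (fun z : R * R =>
     dlt u z * dlt v z * ker 0 1 z))); first exact: measurable_fubini_F I.
  apply/funext => x; rewrite [LHS]integral_mkcond; apply: eq_integral => y _.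
  by rewrite patchE mem_setE /= -ker01E; case: ifP => _; rewrite ?mulr1 ?mulr0.
- exact: measurable_fubini_F I.
- apply: filterS (integrable_ae measurableT (integrable_fubini_F I)) => x /(_ Logic.I) hx _.
  rewrite -(fineK hx); congr (fine _)%:E.
  rewrite [LHS]integral_mkcond; apply: eq_integral => y _.
  by rewrite patchE mem_setE /= -ker01E; case: ifP => _; rewrite ?mulr1 ?mulr0.
Qed.

Lemma E_LE L u v : inH L u -> inH L v ->
  E_L u v = 2^-1 * Dd 0 1 u v - far u v + rho1 * dot u v.
Proof. by move=> hu hv; rewrite /E_L (DdE hu hv). Qed.

Lemma L2dotE L u v : inH L u -> L2 v -> L2dot L u v = dot u v.
Proof.
move=> hu hv; rewrite /L2dot Rintegral_mkcond /dot /Rintegral; congr fine.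
have [[mu_ _] h0 _] := hu.
apply: ae_eq_integral => //.
- apply/measurable_EFinP; apply/(measurable_restrictT _ _).1 => //.
    exact: measurable_itv.
  by apply: measurable_funS (measurable_funM mu_ hv.1).
- by apply/measurable_EFinP; apply: measurable_funM => //; case: hv.
- apply: ae_S h0 => x hx _; congr EFin; rewrite patchE mem_setE.
  case: ifPn => // xO; rewrite hx ?mul0r//.
  by move=> xO'; move/negP: xO; apply.
Qed.

Lemma inHD L u v : inH L u -> inH L v -> inH L (fun x => u x + v x).
Proof.
move=> hu hv; split; first exact: L2D (inH_L2 hu) (inH_L2 hv).
- have [_ + _] := hu; have [_ + _] := hv; apply: ae_S2 => x h1 h2 hx.
  by rewrite h1// h2// addr0.
- apply: le_lt_trans (le_DqD _ _ (inH_L2 hu).1 (inH_L2 hv).1) _.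
  by apply: lte_add_pinfty; apply: lte_mul_pinfty => //; [case: hu|case: hv].
Qed.

Lemma inHZ L c u : inH L u -> inH L (fun x => c * u x).
Proof.
move=> hu; split; first exact: L2Z (inH_L2 hu).
- by have [_ + _] := hu; apply: ae_S => x h1 hx; rewrite h1// mulr0.
- rewrite DqZ; last exact: (inH_L2 hu).1.
  by apply: lte_mul_pinfty; [rewrite lee_fin sqr_ge0|by []|case: hu].
Qed.

Lemma inH0 L : inH L (fun=> 0).
Proof.
split.
- split; first exact: measurable_cst.
  rewrite /normq (eq_integral (cst 0%E)) ?integral0// => x _.
  by rewrite expr0n.
- by apply: aeW => x.
- rewrite /Dq (eq_integral (cst 0%E)) ?integral0// => x _.
  by rewrite subr0 expr0n mul0r.
Qed.

Lemma DdC a b u v : Dd a b u v = Dd a b v u.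
Proof. by rewrite /Dd wdotC. Qed.

Lemma inH_Wle L a u : 0 <= a -> inH L u -> W2 (mu \x mu)%E (ker a 1) (dlt u).
Proof.
by move=> a0 [[? ?] _ h]; apply: DqW => //; apply: le_lt_trans h; exact: le_Dq.
Qed.

Lemma DdDl L a u v w : 0 <= a -> inH L u -> inH L v -> inH L w ->
  Dd a 1 (fun x => u x + v x) w = Dd a 1 u w + Dd a 1 v w.
Proof.
move=> a0 hu hv hw.
rewrite /Dd -(wdotDl (mker a 1) (ker0 a 1) (inH_Wle a0 hu) (inH_Wle a0 hv) (inH_Wle a0 hw)).
by congr wdot; apply/funext => z; rewrite /dlt; ring.
Qed.

Lemma DdZl L a c u w : 0 <= a -> inH L u -> inH L w ->
  Dd a 1 (fun x => c * u x) w = c * Dd a 1 u w.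
Proof.
move=> a0 hu hw.
rewrite /Dd -(wdotZl (mker a 1) (ker0 a 1) _ (inH_Wle a0 hu) (inH_Wle a0 hw)).
by congr wdot; apply/funext => z; rewrite /dlt; ring.
Qed.

Lemma Dd_ge0 a b u : 0 <= Dd a b u u.
Proof. by apply: wdot_ge0 => // z; exact: ker_ge0. Qed.

End Forms.

(** * The far part of the form, and coercivity *)

Section FarForm.
Context {R : realType}.
Local Notation mu := (@lebesgue_measure R).
Implicit Types (a b c x y L : R) (u v w : R -> R).

Let RR := (measurableTypeR R * measurableTypeR R)%type.

Definition fker (z : R * R) : R :=
  if 1 <= `|z.1 - z.2| then `|z.1 - z.2|^-1 else 0.

Lemma fker_ge0 z : 0 <= fker z. Proof. by rewrite /fker; case: ifP. Qed.

Lemma fker_le1 z : fker z <= 1.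
Proof. by rewrite /fker; case: ifP => // h; rewrite invf_le1// (lt_le_trans _ h). Qed.

Lemma fker_sym x y : fker (x, y) = fker (y, x).
Proof. by rewrite /fker /= distrC. Qed.

Lemma measurable_fker : measurable_fun setT fker.
Proof.
apply: measurable_fun_ifT => /=.
- by apply: measurable_fun_ler => //; exact: measurable_dist.
- apply: measurable_invnorm; apply: measurable_funB.
    exact: measurable_fst.
  exact: measurable_snd.
- exact: measurable_cst.
Qed.

Lemma farE u v : far u v = \int[(mu \x mu)%E]_z (u z.1 * v z.2 * fker z).
Proof.
rewrite /far Rintegral_mkcond; apply: eq_Rintegral => z _.
rewrite patchE /fker; case: ifPn; rewrite ?inE/=.
  by move=> ->.
by move=> /negP; rewrite inE/= => /negP/negbTE ->; rewrite mulr0.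
Qed.

Lemma measurable_tensor u v : measurable_fun setT u -> measurable_fun setT v ->
  measurable_fun setT (fun z : R * R => u z.1 * v z.2 * fker z).
Proof.
move=> mu_ mv; apply: measurable_funM; last exact: measurable_fker.
by apply: measurable_funM; [exact: measurable_fst_comp|exact: measurable_snd_comp].
Qed.

Lemma Omega_indic L : 0 < L -> L2 (\1_(Omega L) : R -> R) /\
  dot (\1_(Omega L) : R -> R) (\1_(Omega L) : R -> R) = L.
Proof.
move=> L0; have mO : measurable (Omega L : set (measurableTypeR R)) by exact: measurable_itv.
have e : normq (\1_(Omega L) : R -> R) = L%:E.
  rewrite /normq; transitivity (\int[mu]_x (\1_(Omega L) x : R)%:E)%E.
    by apply: eq_integral => x _; rewrite indicE; case: (x \in _); rewrite ?expr1n ?expr0n.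
  rewrite integral_indic// setIT; rewrite [LHS](@lebesgue_measure_itv R `]0, L[)/= lte_fin L0.
  by rewrite oppr0 adde0.
have l : L2 (\1_(Omega L) : R -> R).
  by split; [exact: measurable_indic|rewrite e ltry].
by split=> //; have := normqE l; rewrite e => -[].
Qed.

Definition norm1 u : R := \int[mu]_x `|u x|.

Lemma L2_norm u : L2 u -> L2 (fun x => `|u x|).
Proof.
move=> [mu_ h]; split; first exact: measurableT_comp.
rewrite /normq in h *; apply: le_lt_trans h; rewrite le_eqVlt; apply/orP; left; apply/eqP.
by apply: eq_integral => x _; rewrite real_normK ?num_real.
Qed.

(** Cauchy-Schwarz against the indicator of Omega: bounded support turns L^2 bounds into L^1
    bounds. *)
Lemma inH_norm1 L u : 0 < L -> inH L u ->
  ((\int[mu]_x `|u x|%:E = (norm1 u)%:E)%E /\ norm1 u ^+ 2 <= L * dot u u).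
Proof.
move=> L0 hu; have [l dl] := Omega_indic L0.
have [hu2 h0 _] := hu; have hn := L2_norm hu2.
have mabs : measurable_fun setT (fun x => `|u x|) by case: hn.
have I : mu.-integrable setT (EFin \o (fun x => `|u x| * \1_(Omega L) x * cst 1 x)).
  by apply: W2_integrable => //; exact/L2W.
have e : (\int[mu]_x `|u x|%:E = \int[mu]_x (`|u x| * \1_(Omega L) x * cst 1 x)%:E)%E.
  apply: ge0_ae_eq_integral => //.
  - exact/measurable_EFinP.
  - by case/integrableP: I.
  - by move=> x _; rewrite lee_fin !mulr_ge0.
  - apply: ae_S h0 => x hx _; congr EFin; rewrite mulr1 indicE.
    case: (boolP (x \in Omega L)) => [_|/negP xO]; first by rewrite mulr1.
    by rewrite hx ?normr0 ?mul0r// => h; apply: xO; rewrite inE.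
have e2 : norm1 u = dot (fun x => `|u x|) (\1_(Omega L)).
  rewrite /norm1 /dot /Rintegral e; congr fine; apply: eq_integral => x _.
  by rewrite mulr1.
split.
  rewrite e2 dotE /wdot /Rintegral fineK//.
  exact: integrable_fin_num I.
have <- : dot (fun x => `|u x|) (fun x => `|u x|) = dot u u.
  by apply: eq_Rintegral => x _; rewrite -normrM ger0_norm// -expr2 sqr_ge0.
by rewrite e2; apply: le_trans (dot_CS hn l) _; rewrite dl mulrC.
Qed.

Lemma norm1_ge0 u : 0 <= norm1 u.
Proof. by apply: Rintegral_ge0 => x _; exact: normr_ge0. Qed.

(** The far kernel is at most 1, so Tonelli factors the majorant into two L^1 norms. *)
Lemma tensor_le L u v : 0 < L -> inH L u -> inH L v ->
  (\int[(mu \x mu)%E]_z `|u z.1 * v z.2 * fker z|%:E <= (norm1 u * norm1 v)%:E)%E.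
Proof.
move=> L0 hu hv.
have [eu _] := inH_norm1 L0 hu; have [ev _] := inH_norm1 L0 hv.
have mu_ : measurable_fun setT u by case: hu => -[].
have mv_ : measurable_fun setT v by case: hv => -[].
have mm : measurable_fun setT (fun z : R * R => `|u z.1| * `|v z.2|).
  by apply: measurable_funM; apply: measurableT_comp => //;
    [exact: measurable_fst_comp|exact: measurable_snd_comp].
apply: (@le_trans _ _ (\int[(mu \x mu)%E]_z (`|u z.1| * `|v z.2|)%:E)%E).
  apply: ge0_le_integral => //.
  - by do 2 apply: measurableT_comp => //; exact: measurable_tensor.
  - exact/measurable_EFinP.
  - move=> z _; rewrite lee_fin normrM normrM ler_piMr ?mulr_ge0//.
    by rewrite ger0_norm ?fker_ge0 ?fker_le1.
rewrite fubini_tonelli1/=; last 2 first.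
- exact/measurable_EFinP.
- by move=> z; rewrite lee_fin mulr_ge0.
have mU : measurable_fun (setT : set (measurableTypeR R)) (fun x => `|u x|%:E).
  by apply/measurable_EFinP; exact: measurableT_comp.
have V0 : (0 <= (norm1 v)%:E :> \bar R)%E by rewrite lee_fin norm1_ge0.
rewrite EFinM -eu -ge0_integralZr//.
rewrite le_eqVlt; apply/orP; left; apply/eqP; apply: eq_integral => x _.
rewrite /fubini_F/=; under eq_integral do rewrite EFinM.
rewrite ge0_integralZl ?ev//; by apply/measurable_EFinP; exact: measurableT_comp.
Qed.

Lemma tensor_integrable L u v : 0 < L -> inH L u -> inH L v ->
  (mu \x mu)%E.-integrable (setT : set RR) (EFin \o (fun z => u z.1 * v z.2 * fker z)).
Proof.
move=> L0 hu hv; apply/integrableP; split.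
  apply/measurable_EFinP; apply: measurable_tensor; by [case: hu => -[]|case: hv => -[]].
by apply: le_lt_trans (tensor_le L0 hu hv) _; rewrite ltry.
Qed.

Lemma far_le L u v : 0 < L -> inH L u -> inH L v ->
  (far u v) ^+ 2 <= L ^+ 2 * (dot u u * dot v v).
Proof.
move=> L0 hu hv; have I := tensor_integrable L0 hu hv.
have [_ hu1] := inH_norm1 L0 hu; have [_ hv1] := inH_norm1 L0 hv.
have h : `|far u v| <= norm1 u * norm1 v.
  rewrite farE; apply: le_trans (le_normr_Rintegral _ I) _ => //.
  rewrite -lee_fin; apply: le_trans (tensor_le L0 hu hv).
  rewrite /Rintegral fineK//.
  exact: integrable_fin_num (integrable_abse I).
rewrite -real_normK ?num_real//.
apply: (@le_trans _ _ ((norm1 u * norm1 v) ^+ 2)).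
  by rewrite ler_sqr ?nnegrE ?normr_ge0// mulr_ge0// norm1_ge0.
rewrite exprMn (_ : L ^+ 2 * _ = (L * dot u u) * (L * dot v v)); last by ring.
by apply: ler_pM; rewrite ?sqr_ge0.
Qed.

Lemma farDl L u v w : 0 < L -> inH L u -> inH L v -> inH L w ->
  far (fun x => u x + v x) w = far u w + far v w.
Proof.
move=> L0 hu hv hw; rewrite !farE -RintegralD//; last 2 first.
- exact: tensor_integrable hu hw.
- exact: tensor_integrable hv hw.
by apply: eq_Rintegral => x _; rewrite !mulrDl.
Qed.

Lemma farZl L c u w : 0 < L -> inH L u -> inH L w ->
  far (fun x => c * u x) w = c * far u w.
Proof.
move=> L0 hu hw; rewrite !farE -RintegralZl//; last exact: tensor_integrable hu hw.
by apply: eq_Rintegral => x _; rewrite !mulrA.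
Qed.

Lemma farC L u v : 0 < L -> inH L u -> inH L v -> far u v = far v u.
Proof.
move=> L0 hu hv; rewrite !farE /Rintegral; congr fine.
rewrite -(integral12_prod_meas1 (tensor_integrable L0 hu hv)).
rewrite -(integral21_prod_meas1 (tensor_integrable L0 hv hu)).
apply: eq_integral => x _; apply: eq_integral => y _ /=.
by rewrite fker_sym (mulrC (u x)).
Qed.

Lemma E_LC L u v : 0 < L -> inH L u -> inH L v -> E_L u v = E_L v u.
Proof.
by move=> L0 hu hv; rewrite (E_LE hu hv) (E_LE hv hu) DdC (farC L0 hu hv) dotC.
Qed.

Lemma E_LDl L u v w : 0 < L -> inH L u -> inH L v -> inH L w ->
  E_L (fun x => u x + v x) w = E_L u w + E_L v w.
Proof.
move=> L0 hu hv hw; rewrite (E_LE (inHD hu hv) hw) (E_LE hu hw) (E_LE hv hw).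
rewrite (DdDl (lexx 0) hu hv hw) (farDl L0 hu hv hw).
by rewrite (dotDl (inH_L2 hu) (inH_L2 hv) (inH_L2 hw)); lra.
Qed.

Lemma E_LZl L c u w : 0 < L -> inH L u -> inH L w ->
  E_L (fun x => c * u x) w = c * E_L u w.
Proof.
move=> L0 hu hw; rewrite (E_LE (inHZ c hu) hw) (E_LE hu hw).
rewrite (DdZl c (lexx 0) hu hw) (farZl c L0 hu hw).
by rewrite (dotZl c (inH_L2 hu) (inH_L2 hw)); lra.
Qed.

Lemma far_diag_le L u : 0 < L -> inH L u -> `|far u u| <= L * dot u u.
Proof.
move=> L0 hu; have := far_le L0 hu hu.
rewrite -expr2 -exprMn -[_ ^+ 2]real_normK ?num_real//.
by rewrite ler_sqr ?nnegrE ?normr_ge0// mulr_ge0 ?dot_ge0// ltW.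
Qed.

(** A Garding inequality: L absorbs the far part by [far_diag_le], and [|rho1|] absorbs the zeroth
    order term. *)
Lemma E_L_coercive L u : 0 < L -> inH L u ->
  2^-1 * Dd 0 1 u u <= E_L u u + (L + `|rho1|) * dot u u.
Proof.
move=> L0 hu; rewrite (E_LE hu hu).
have := far_diag_le L0 hu; have d0 := dot_ge0 u.
have : - `|rho1| * dot u u <= rho1 * dot u u.
  by rewrite ler_wpM2r// lerNl -normrN ler_norm.
by rewrite ler_norml => h /andP[h1 h2]; lra.
Qed.

Lemma E_L_upper L u : 0 < L -> inH L u ->
  E_L u u <= 2^-1 * Dd 0 1 u u + (L + `|rho1|) * dot u u.
Proof.
move=> L0 hu; rewrite (E_LE hu hu).
have := far_diag_le L0 hu; have d0 := dot_ge0 u.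
have : rho1 * dot u u <= `|rho1| * dot u u by rewrite ler_wpM2r// ler_norm.
by rewrite ler_norml => h /andP[h1 h2]; lra.
Qed.

Lemma dot_eq0P u : L2 u -> ae0 u <-> dot u u = 0.
Proof.
move=> hu; have [mu_ _] := hu.
have h := @ae_eq_integral_abs _ _ _ mu _ measurableT
  (fun x => (u x ^+ 2)%:E).
have m2 : measurable_fun (setT : set (measurableTypeR R)) (fun x => (u x ^+ 2)%:E).
  by apply/measurable_EFinP; exact: measurable_funX.
have e : (\int[mu]_x `|(u x ^+ 2)%:E| = (dot u u)%:E)%E.
  rewrite -normqE//; apply: eq_integral => x _.
  by rewrite gee0_abs// lee_fin sqr_ge0.
split=> [u0|d0].
  have /(h m2) : ae_eq mu setT (fun x => (u x ^+ 2)%:E) (cst 0%E).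
    by apply: ae_S u0 => x -> _; rewrite expr0n.
  by rewrite e => -[].
have : (\int[mu]_x `|(u x ^+ 2)%:E| = 0)%E by rewrite e d0.
move=> /(h m2); apply: ae_S => x /(_ Logic.I) [] /eqP.
by rewrite sqrf_eq0 => /eqP.
Qed.
End FarForm.

(** * Cutting the form at a small distance *)

Section Truncation.
Context {R : realType}.
Local Notation mu := (@lebesgue_measure R).
Implicit Types (a b c x y L : R) (u v w : R -> R).

Let RR := (measurableTypeR R * measurableTypeR R)%type.

Lemma norm_le_of_sqr (r s : R) : 0 <= s -> r ^+ 2 <= s ^+ 2 -> `|r| <= s.
Proof. by move=> s0 h; rewrite -ler_sqr ?nnegrE// real_normK ?num_real. Qed.

(** By [Dq_cvg] the shells away from the diagonal exhaust a finite energy, so little is left near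
    it. The density of the discrete spaces draws its smallness from here. *)
Lemma Dq_small u e : measurable_fun setT u -> (Dq 0 1 u < +oo)%E -> 0 < e ->
  exists2 a, 0 < a < 1 & (Dq 0 a u <= e%:E)%E.
Proof.
move=> mu_ Du e0; have := Dq_cvg mu_.
have fin1 : Dq 0 1 u \is a fin_num by rewrite ge0_fin_numE// Dq_ge0.
rewrite -(fineK fin1) => /fine_cvgP[fn].
move=> /cvgrPdist_le /(_ _ e0) h.
have [n [_ hn]] : exists n : nat, (1 <= n)%N /\ `|fine (Dq 0 1 u) - fine (Dq n.+1%:R^-1 1 u)| <= e.
  by have [N _ H] := h; exists N.+1; split => //; apply: H => /=.
have n1 : n.+2%:R^-1 < 1 :> R by rewrite invf_lt1 ?ltr0n// ltr1n.
have n2 : n.+1%:R^-1 <= 1 :> R by rewrite invf_le1 ?ltr0n// ler1n.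
exists n.+2%:R^-1; first by rewrite invr_gt0 ltr0n.
apply: (@le_trans _ _ (Dq 0 n.+1%:R^-1 u)).
  by apply: le_Dq => //; rewrite lef_pV2 ?posrE ?ltr0n// ler_nat.
have sp := Dq_split mu_ (_ : 0 <= n.+1%:R^-1) n2; rewrite invr_ge0 ler0n in sp.
move: (sp isT) => {}sp.
have fa : Dq 0 n.+1%:R^-1 u \is a fin_num.
  by rewrite ge0_fin_numE ?Dq_ge0//; apply: le_lt_trans Du; exact: le_Dq.
have fb : Dq n.+1%:R^-1 1 u \is a fin_num.
  by rewrite ge0_fin_numE ?Dq_ge0//; apply: le_lt_trans Du; apply: le_Dq.
rewrite -(fineK fa) lee_fin.
have : fine (Dq 0 1 u) = fine (Dq 0 n.+1%:R^-1 u) + fine (Dq n.+1%:R^-1 1 u).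
  by rewrite sp fineD.
move: hn => /[swap] -> ; rewrite addrK ger0_norm// fine_ge0// Dq_ge0//.
Qed.

(** Reduces an energy bound to truncated energies, which the L^2 norm controls; this is how finite
    energy passes to L^2 limits. *)
Lemma Dq_sup u (M : \bar R) : measurable_fun setT u ->
  (forall a, 0 < a < 1 -> (Dq a 1 u <= M)%E) -> (Dq 0 1 u <= M)%E.
Proof.
move=> mu_ h; apply: (cvge_le _ (Dq_cvg mu_)).
exists 1%N => // n /= n1; apply: h.
by rewrite invr_gt0 ltr0n /= invf_lt1 ?ltr0n// ltr1n ltnS.
Qed.

Lemma Dd_fin L u a b : 0 <= a -> b <= 1 -> inH L u ->
  (Dq a b u = (Dd a b u u)%:E)%E.
Proof.
move=> a0 b1 [[mu_ _] _ hD]; rewrite DqE//.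
by apply: le_lt_trans hD; exact: le_Dq.
Qed.

Lemma Dd_W L u a b : 0 <= a -> b <= 1 -> inH L u ->
  W2 (mu \x mu)%E (ker a b) (dlt u).
Proof.
by move=> a0 b1 [[mu_ _] _ hD]; apply: DqW => //; apply: le_lt_trans hD; exact: le_Dq.
Qed.

Lemma Dd_CS L u v a b : 0 <= a -> b <= 1 -> inH L u -> inH L v ->
  (Dd a b u v) ^+ 2 <= Dd a b u u * Dd a b v v.
Proof.
move=> a0 b1 hu hv; apply: wdot_CS; [|move=> z; exact: ker_ge0|exact: Dd_W hu|exact: Dd_W hv].
exact: measurable_ker.
Qed.

Lemma Dd_split L u v a : 0 <= a <= 1 -> inH L u -> inH L v ->
  Dd 0 1 u v = Dd 0 a u v + Dd a 1 u v.
Proof.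
move=> /andP[a0 a1] hu hv; rewrite /Dd /wdot -RintegralD//; last 2 first.
- apply: W2_integrable; [exact: measurable_ker|move=> z; exact: ker_ge0|exact: Dd_W hu|exact: Dd_W hv].
- apply: W2_integrable; [exact: measurable_ker|move=> z; exact: ker_ge0|exact: Dd_W hu|exact: Dd_W hv].
by apply: eq_Rintegral => z _; rewrite -mulrDr -kerD.
Qed.

Lemma le_Dd L u a b : 0 <= a -> b <= 1 -> inH L u -> Dd a b u u <= Dd 0 1 u u.
Proof.
move=> a0 b1 hu; have hb := hu; case: hb => -[mu_ _] _ _.
by rewrite -lee_fin -(Dd_fin a0 b1 hu) -(Dd_fin (lexx 0) (lexx 1) hu) le_Dq.
Qed.

Lemma Dd_le_dot L u a : 0 < a < 1 -> inH L u ->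
  Dd a 1 u u <= - (8 * ln a) * dot u u.
Proof.
move=> /andP[a0 a1] hu; have hb := hu; case: hb => -[mu_ _] _ _.
rewrite -lee_fin -(Dd_fin (ltW a0) (lexx 1) hu) EFinM -normqE; last exact: inH_L2 hu.
by have := Dq_le_normq mu_ a0 (ltW a1); rewrite ln1 sub0r mulrN.
Qed.

(* Only the pairs at distance < a fail to be controlled by the L^2 norm of w,
   and there the contribution of v is small. *)
Lemma E_L_small L v (M e : R) : 0 < L -> inH L v -> 0 < e ->
  exists2 d, 0 < d & forall w, inH L w -> Dd 0 1 w w <= M -> dot w w <= d ->
    `|E_L w v| <= e.
Proof.
move=> L0 hv e0.
have M0 : 0 < `|M| + 1 by rewrite ltr_wpDl.
(* Cauchy-Schwarz below distance a will give (|M| + 1) eta = (e/2)^2. *)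
pose eta := e ^+ 2 / (4 * (`|M| + 1)).
have eta0 : 0 < eta by rewrite divr_gt0 ?exprn_gt0// mulr_gt0.
have [a ha Da] : exists2 a, 0 < a < 1 & (Dq 0 a v <= eta%:E)%E.
  by case: (hv) => -[? _] _ ?; exact: Dq_small.
have /andP[a0 a1] := ha.
rewrite (Dd_fin (lexx 0) (ltW a1) hv) lee_fin in Da.
pose K := - (8 * ln a); have K0 : 0 <= K.
  by rewrite /K oppr_ge0 pmulr_rle0 ?ln_le0 ?(ltW a1).
have V0 := Dd_ge0 0 1 v; have dv0 := dot_ge0 v.
set V := Dd 0 1 v v in V0; set dv := dot v v in dv0.
(* Z dominates the factor of [dot w w] in each of the three remaining terms, so d Z = (e/4)^2 serves
   them all. The final budget is (e/2 + e/2)/2 + e/4 + e/4 = e. *)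
pose Z := K * V + L ^+ 2 * dv + rho1 ^+ 2 * dv + 1.
have z1 : 0 <= K * V by rewrite mulr_ge0.
have z2 : 0 <= L ^+ 2 * dv by rewrite mulr_ge0// sqr_ge0.
have z3 : 0 <= rho1 ^+ 2 * dv by rewrite mulr_ge0// sqr_ge0.
have Z0 : 0 < Z by rewrite /Z; lra.
pose d := e ^+ 2 / 16 / Z.
have d0 : 0 < d by rewrite !divr_gt0// exprn_gt0.
have dZ : d * Z = e ^+ 2 / 16 by rewrite /d divfK// gt_eqF.
have dle X : 0 <= X -> X <= Z -> d * X <= e ^+ 2 / 16.
  by move=> X0 XZ; rewrite -dZ ler_wpM2l// ltW.
exists d => // w hw DM dd.
have dw0 := dot_ge0 w; have DW0 := Dd_ge0 0 1 w.
rewrite (E_LE hw hv) (Dd_split (a := a) _ hw hv) ?(ltW a0) ?(ltW a1)//.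
have e20 := sqr_ge0 e. have e2 : 0 <= e / 2 by lra. have e4 : 0 <= e / 4 by lra.
have h1 : `|Dd 0 a w v| <= e / 2.
  apply: norm_le_of_sqr => //; apply: le_trans (Dd_CS (lexx 0) (ltW a1) hw hv) _.
  have hM : Dd 0 a w w <= `|M| + 1.
    apply: le_trans (le_Dd (lexx 0) (ltW a1) hw) _; apply: le_trans DM _.
    by have := ler_norm M; lra.
  apply: (@le_trans _ _ ((`|M| + 1) * eta)); first by apply: ler_pM => //; exact: Dd_ge0.
  by rewrite /eta le_eqVlt; apply/orP; left; apply/eqP; field; lra.
have h2 : `|Dd a 1 w v| <= e / 2.
  apply: norm_le_of_sqr => //; apply: le_trans (Dd_CS (ltW a0) (lexx 1) hw hv) _.
  apply: (@le_trans _ _ ((K * dot w w) * V)).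
    apply: ler_pM; [exact: Dd_ge0|exact: Dd_ge0|exact: Dd_le_dot ha hw|].
    exact: le_Dd (ltW a0) (lexx 1) hv.
  apply: (@le_trans _ _ (d * (K * V))); first by have := ler_wpM2r z1 dd; lra.
  by apply: le_trans (dle _ z1 _) _; [by rewrite /Z; lra|by lra].
have h3 : `|far w v| <= e / 4.
  apply: norm_le_of_sqr => //; apply: le_trans (far_le L0 hw hv) _; rewrite -/dv.
  apply: (@le_trans _ _ (d * (L ^+ 2 * dv))); first by have := ler_wpM2r z2 dd; lra.
  by apply: le_trans (dle _ z2 _) _; [by rewrite /Z; lra|by lra].
have h4 : `|rho1 * dot w v| <= e / 4.
  apply: norm_le_of_sqr => //; rewrite exprMn.
  apply: (@le_trans _ _ (rho1 ^+ 2 * (dot w w * dv))).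
    by rewrite ler_wpM2l ?sqr_ge0// dot_CS; [|exact: inH_L2 hw|exact: inH_L2 hv].
  apply: (@le_trans _ _ (d * (rho1 ^+ 2 * dv))); first by have := ler_wpM2r z3 dd; lra.
  by apply: le_trans (dle _ z3 _) _; [by rewrite /Z; lra|by lra].
move: h1 h2 h3 h4; rewrite !ler_norml => /andP[? ?] /andP[? ?] /andP[? ?] /andP[? ?].
by apply/andP; split; lra.
Qed.
End Truncation.

(** * Completeness of the energy space *)

Section FastCauchy.
Context {R : realType}.
Local Notation mu := (@lebesgue_measure R).
Implicit Types (u v w : R -> R).

(** The subtracted power lets the induction close; the constant 2 is a convenient bound for the
    geometric sum 4/3. *)
Lemma fast_cauchy_dist (a : nat -> R) s n k : 0 <= s ->
  (forall n, `|a n.+1 - a n| <= 4^-1 ^+ n * s) ->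
  `|a (n + k)%N - a n| <= 2 * s * (4^-1 ^+ n - 4^-1 ^+ (n + k)).
Proof.
move=> s0 h; elim: k => [|k IH]; first by rewrite addn0 !subrr normr0 mulr0.
have -> : a (n + k.+1)%N - a n = (a (n + k).+1 - a (n + k)%N) + (a (n + k)%N - a n).
  by rewrite addrA subrK addnS.
apply: le_trans (ler_normD _ _) _; apply: le_trans (lerD (h _) IH) _.
rewrite addnS exprS; have : 0 <= 4^-1 ^+ (n + k) * s by rewrite mulr_ge0// exprn_ge0.
lra.
Qed.

Lemma fast_cauchy_cvg (a : nat -> R) s : 0 <= s ->
  (forall n, `|a n.+1 - a n| <= 4^-1 ^+ n * s) ->
  cvgn a /\ forall n, `|limn a - a n| <= 2 * s * 4^-1 ^+ n.
Proof.
move=> s0 h.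
have d n m : (n <= m)%N -> `|a m - a n| <= 2 * s * 4^-1 ^+ n.
  move=> nm; rewrite -(subnKC nm); apply: le_trans (fast_cauchy_dist n _ s0 h) _.
  rewrite ler_wpM2l ?mulr_ge0// gerBl exprn_ge0//.
have c : cvgn a.
  apply: cauchy_cvg; apply: cauchy_exP => e e0.
  have : (fun n => 2 * s * 4^-1 ^+ n) @ \oo --> (2 * s * 0 : R).
    apply: cvgMr; apply: cvg_expr.
    by rewrite ger0_norm ?invr_ge0 ?invf_lt1 ?ltr1n.
  rewrite mulr0 => /cvgrPdist_lt /(_ _ e0) [N _ HN].
  exists (a N), N => // m Nm /=; rewrite /ball /= distrC.
  apply: le_lt_trans (d _ _ Nm) _; have := HN N (leqnn N) => /=.
  by rewrite sub0r normrN; apply: le_lt_trans; exact: ler_norm.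
split=> // n.
have cn : (fun m => `|a m - a n|) @ \oo --> `|limn a - a n|.
  by apply: cvg_norm; apply: cvgB => //; exact: cvg_cst.
rewrite -(cvg_lim _ cn)//; apply: limr_le; first by apply/cvg_ex; eexists; exact: cn.
by exists n => // m /= nm; exact: d.
Qed.

Lemma measurable_sqrB u v : measurable_fun setT u -> measurable_fun setT v ->
  measurable_fun setT (fun x => (u x - v x) ^+ 2).
Proof. by move=> mu_ mv; apply: measurable_funX; exact: measurable_funB. Qed.

Lemma geometric4_sum n : (\sum_(0 <= i < n) (4^-1 ^+ i)%:E <= (2:R)%:E)%E.
Proof.
suff h : \sum_(0 <= i < n) 4^-1 ^+ i <= 2 - 2 * 4^-1 ^+ n :> R.
  by rewrite sumEFin lee_fin; apply: le_trans h _; rewrite gerBl mulr_ge0// exprn_ge0.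
elim: n => [|n IH]; first by rewrite big_nil expr0 mulr1 subrr.
rewrite big_nat_recr//=; apply: le_trans (lerD IH (lexx _)) _.
have : 0 <= 4^-1 ^+ n :> R by rewrite exprn_ge0.
by rewrite exprS; lra.
Qed.

(* The weights 16^n make the pointwise increments summable wherever G is finite. *)
Lemma L2_fast_cauchy (u : nat -> R -> R) : (forall n, L2 (u n)) ->
  (forall n, (normq (fun x => u n.+1 x - u n x)%R <= (64^-1 ^+ n)%:E)%E) ->
  exists w, [/\ L2 w,
    (forall n, (normq (fun x => w x - u n x)%R <= (8 * 16^-1 ^+ n)%:E)%E) &
    forall x, (forall n, u n x = 0) -> w x = 0].
Proof.
move=> hu hd.
pose f n x := (16 ^+ n * (u n.+1 x - u n x) ^+ 2)%:E.
have m0 n : measurable_fun setT (u n) by case: (hu n).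
have mf n : measurable_fun (setT : set (measurableTypeR R)) (f n).
  by apply/measurable_EFinP; apply: measurable_funM => //; exact: measurable_sqrB.
have f0 n x : (0 <= f n x)%E by rewrite lee_fin mulr_ge0 ?sqr_ge0// exprn_ge0.
pose G x := (\sum_(n <oo) f n x)%E.
have G0 x : (0 <= G x)%E by exact: nneseries_ge0.
have mG : measurable_fun (setT : set (measurableTypeR R)) G.
  by rewrite /G; apply: ge0_emeasurable_sum.
have iG : (\int[mu]_x G x <= (2:R)%:E)%E.
  rewrite integral_nneseries//.
  have b n : (\int[mu]_x f n x <= (4^-1 ^+ n)%:E)%E.
    rewrite /f; under eq_integral do rewrite EFinM.
    have mq : measurable_fun (setT : set (measurableTypeR R)) (fun x => ((u n.+1 x - u n x) ^+ 2)%:E).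
      by apply/measurable_EFinP; exact: measurable_sqrB.
    have k0 : (0 <= (16 ^+ n)%:E :> \bar R)%E by rewrite lee_fin exprn_ge0.
    rewrite ge0_integralZl//; last by move=> x _; rewrite lee_fin sqr_ge0.
    apply: le_trans (lee_wpmul2l _ (hd n)) _; first by rewrite lee_fin exprn_ge0.
    by rewrite -EFinM lee_fin -exprMn (_ : 16 / 64 = 4^-1)//; field.
  apply: le_trans (lee_nneseries _ (fun n _ => b n)) _.
    by move=> i _ _; exact: integral_ge0.
  apply: lime_le; first by apply: is_cvg_nneseries => n _ _; rewrite lee_fin exprn_ge0.
  by apply: nearW => n; exact: geometric4_sum.
pose A := [set x | (G x < +oo)%E].
have mA : measurable (A : set (measurableTypeR R)).
  by have := emeasurable_fun_infty_o measurableT mG +oo%E; rewrite setTI.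
have aeA : {ae mu, forall x, A x}.
  have /(integrable_ae measurableT) : mu.-integrable setT G.
    apply/integrableP; split=> //; apply: (@le_lt_trans _ _ (2:R)%:E); last exact: ltry.
    by apply: le_trans iG; under eq_integral do rewrite gee0_abs//.
  by apply: ae_S => x /(_ Logic.I); rewrite ge0_fin_numE.
have inc x : A x -> forall n, `|u n.+1 x - u n x| <= 4^-1 ^+ n * Num.sqrt (fine (G x)).
  move=> Ax n; have s0 : 0 <= fine (G x) by rewrite fine_ge0.
  rewrite -ler_sqr ?nnegrE ?mulr_ge0 ?exprn_ge0 ?sqrtr_ge0// real_normK ?num_real//.
  rewrite exprMn sqr_sqrtr// -exprM mulnC exprM (_ : 4^-1 ^+ 2 = 16^-1); last by field.
  rewrite -(ler_pM2l (_ : 0 < 16 ^+ n)) ?exprn_gt0// [leRHS]mulrA -exprMn mulfV// expr1n mul1r.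
  have e : (f n x <= G x)%E.
    apply: le_trans (nneseries_lim_ge (n.+1) _); last by move=> k _ _; exact: f0.
    rewrite big_nat_recr//= leeDr// sume_ge0// => i _; exact: f0.
  by rewrite -lee_fin fineK// ge0_fin_numE.
(* Cutting off outside [A] makes the limit exist at every point, as measurability of the limit
   requires, and keeps the zeros common to all [u n]. *)
pose h n x := u n x * \1_A x.
have hcv x : cvgn (h ^~ x) /\ (A x -> forall n, `|limn (h ^~ x) - u n x| <=
    2 * Num.sqrt (fine (G x)) * 4^-1 ^+ n).
  have [Ax|nA] := pselect (A x).
    have -> : h ^~ x = u ^~ x.
      by apply/funext => n; rewrite /h indicE mem_set// mulr1.
    by have [] := fast_cauchy_cvg (sqrtr_ge0 _) (inc x Ax).
  split=> //; have -> : h ^~ x = cst 0.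
    by apply/funext => n; rewrite /h indicE memNset// mulr0.
  exact: is_cvg_cst.
pose w x := limn (h ^~ x).
have mw : measurable_fun setT w.
  apply: (measurable_fun_cvg (h := h)) => [n|x _]; last by case: (hcv x).
  by apply: measurable_funM => //; exact: measurable_indic.
have nw n : (normq (fun x => w x - u n x)%R <= (8 * 16^-1 ^+ n)%:E)%E.
  (* Square of the pointwise bound 2 sqrt(G) 4^-n; then the integral of [G] is at most 2. *)
  apply: (@le_trans _ _ (\int[mu]_x ((4 * 16^-1 ^+ n)%:E * G x))%E).
    apply: ae_ge0_le_integral => //.
    - by move=> x _; rewrite lee_fin sqr_ge0.
    - by apply/measurable_EFinP; exact: measurable_sqrB.
    - by move=> x _; rewrite mule_ge0// lee_fin mulr_ge0// exprn_ge0.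
    - exact: measurable_funeM.
    - apply: ae_S aeA => x Ax _.
      have /(_ n) b := (hcv x).2 Ax.
      rewrite -[G x]fineK ?ge0_fin_numE// -EFinM lee_fin.
      rewrite -[leLHS]real_normK ?num_real//.
      apply: (@le_trans _ _ ((2 * Num.sqrt (fine (G x)) * 4^-1 ^+ n) ^+ 2)).
        have q0 : 0 <= 2 * Num.sqrt (fine (G x)) * 4^-1 ^+ n.
          by apply: mulr_ge0; [apply: mulr_ge0 => //; exact: sqrtr_ge0|exact: exprn_ge0].
        by rewrite ler_sqr ?nnegrE.
      rewrite !exprMn sqr_sqrtr ?fine_ge0// -exprM mulnC exprM.
      rewrite (_ : 4^-1 ^+ 2 = 16^-1); last by field.
      by rewrite le_eqVlt; apply/orP; left; apply/eqP; ring.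
  have k0 : (0 <= (4 * 16^-1 ^+ n)%:E :> \bar R)%E by rewrite lee_fin mulr_ge0// exprn_ge0.
  rewrite ge0_integralZl//; apply: le_trans (lee_wpmul2l k0 iG) _.
  by rewrite -EFinM lee_fin le_eqVlt; apply/orP; left; apply/eqP; ring.
exists w; split=> //.
  split=> //; apply: (@le_lt_trans _ _ (2%:E * normq (fun x => w x - u 0%N x)%R + 2%:E * normq (u 0%N))%E).
    apply: le_trans (le_normqD _ _) => //; last exact: measurable_funB.
    by rewrite /normq; under [leRHS]eq_integral do rewrite subrK.
  apply: lte_add_pinfty; apply: lte_mul_pinfty => //; last by case: (hu 0%N).
  by apply: le_lt_trans (nw 0%N) _; rewrite ltry.
move=> x hx; rewrite /w (_ : h ^~ x = cst 0) ?lim_cst//.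
by apply/funext => n; rewrite /h hx mul0r.
Qed.
End FastCauchy.

(** * Completeness along filters *)

Section Completeness.
Context {R : realType}.
Local Notation mu := (@lebesgue_measure R).
Implicit Types (a b c x y L : R) (u v w : R -> R).

Lemma normqBC u v : normq (fun x => u x - v x)%R = normq (fun x => v x - u x)%R.
Proof. by apply: eq_integral => x _; rewrite -sqrrN opprB. Qed.

Lemma L2B u v : L2 u -> L2 v -> L2 (fun x => u x - v x).
Proof.
move=> hu hv; have := L2D hu (L2Z (-1) hv).
by congr L2; apply/funext => x; rewrite mulN1r.
Qed.

Lemma inHB L u v : inH L u -> inH L v -> inH L (fun x => u x - v x).
Proof.
move=> hu hv; have := inHD hu (inHZ (-1) hv).
by congr inH; apply/funext => x; rewrite mulN1r.
Qed.

Lemma le_normqB (u v w : R -> R) : L2 u -> L2 v -> L2 w ->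
  (normq (fun x => u x - w x)%R <=
   2%:E * normq (fun x => u x - v x)%R + 2%:E * normq (fun x => v x - w x)%R)%E.
Proof.
move=> hu hv hw; apply: le_trans (le_normqD (L2B hu hv).1 (L2B hv hw).1).
by rewrite /normq; under [leRHS]eq_integral do rewrite subrKA.
Qed.

(** A rapidly converging sequence of indices is drawn from the Cauchy sets of the filter; comparison
    with it yields convergence along the whole filter. The last clause preserves vanishing outside
    Omega. *)
Lemma L2_cauchy_filter (F : set_system nat) {FF : ProperFilter F} (u : nat -> R -> R) :
  (forall i, L2 (u i)) ->
  (forall e, 0 < e -> exists2 A, F A &
    forall i j, A i -> A j -> (normq (fun x => u i x - u j x)%R <= e%:E)%E) ->
  exists w, [/\ L2 w,
    (forall e, 0 < e -> F [set i | (normq (fun x => w x - u i x)%R <= e%:E)%E]) &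
    forall x, (forall n, u n x = 0) -> w x = 0].
Proof.
move=> hu hc.
have p64 n : 0 < 64^-1 ^+ n :> R by rewrite exprn_gt0.
have /choice[B hB] : forall n, exists A, F A /\
    forall i j, A i -> A j -> (normq (fun x => u i x - u j x)%R <= (64^-1 ^+ n)%:E)%E.
  by move=> n; have [A FA hA] := hc _ (p64 n); exists A.
(* The intersections decrease, so the picks of ranks n and n + 1 both lie in [B n]. *)
pose A n := \bigcap_(k in `I_n.+1) B k.
have FA n : F (A n).
  elim: n => [|n IH].
    apply: filterS (hB 0%N).1 => i Bi k /=; rewrite ltnS leqn0 => /eqP ->; exact: Bi.
  apply: filterS2 IH (hB n.+1).1 => i Ai Bi k /=; rewrite ltnS leq_eqVlt => /predU1P[->//|kn].
  exact: Ai.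
have /choice[N hN] : forall n, exists i, A n i by move=> n; exact: filter_ex (FA n).
have AB n m i : (n <= m)%N -> A m i -> B n i.
  by move=> nm; apply => /=; rewrite ltnS.
have [|w [hw wN w0]] := @L2_fast_cauchy R (fun n => u (N n)) (fun n => hu _).
  by move=> n; apply: (hB n).2; [apply: (AB n n.+1)|apply: (AB n n)].
exists w; split=> //; last by move=> x ux; apply: w0.
move=> e e0.
(* Twice the distance 8 16^-n from [w] to the pick, plus twice the diameter 64^-n of [B n], as
   [le_normqB] will ask. *)
have [n hn] : exists n, 16 * 16^-1 ^+ n + 2 * 64^-1 ^+ n <= e.
  have c : (fun n => 16 * 16^-1 ^+ n + 2 * 64^-1 ^+ n) @ \oo --> (16 * 0 + 2 * 0 : R).
    apply: cvgD; apply: cvgMr; apply: cvg_expr;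
      by rewrite ger0_norm ?invr_ge0 ?invf_lt1 ?ltr1n.
  rewrite !mulr0 addr0 in c; move/cvgrPdist_le : c => /(_ _ e0) [n _ /(_ n (leqnn n)) /=].
  by rewrite sub0r normrN => /(le_trans (ler_norm _)) h; exists n.
apply: filterS (FA n) => i Ai /=.
apply: le_trans (le_normqB hw (hu (N n)) (hu i)) _.
apply: (@le_trans _ _ (2%:E * (8 * 16^-1 ^+ n)%:E + 2%:E * (64^-1 ^+ n)%:E)%E).
  apply: leeD; apply: lee_wpmul2l => //.
  by apply: (hB n).2; [apply: (AB n n)|apply: (AB n n)].
rewrite -!EFinM -EFinD lee_fin; apply: le_trans hn; lra.
Qed.

Lemma H_complete (F : set_system nat) {FF : ProperFilter F} L (u : nat -> R -> R) (M : R) :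
  0 < L -> (forall i, inH L (u i)) ->
  F [set i | Dd 0 1 (u i) (u i) <= M] ->
  (forall e, 0 < e -> exists2 A, F A &
    forall i j, A i -> A j -> (normq (fun x => u i x - u j x)%R <= e%:E)%E) ->
  exists w, inH L w /\
    forall e, 0 < e -> F [set i | (normq (fun x => w x - u i x)%R <= e%:E)%E].
Proof.
move=> L0 hu FM hc.
have [w [hw wu w0]] := L2_cauchy_filter (fun i => inH_L2 (hu i)) hc.
exists w; split=> //; split=> //.
  have : {ae mu, forall x, forall i, ~ Omega L x -> u i x = 0}.
    by apply/ae_foralln => i; case: (hu i).
  by apply: ae_S => x hx nx; apply: w0 => i; exact: hx.
have M0 : 0 <= M by have [i] := filter_ex FM; apply: le_trans; exact: Dd_ge0.
(* Lower semicontinuity of the energy: for each cutoff a, an index i depending on a is taken with w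
   - u_i so small in L^2 that its truncated energy is at most 1. The bound 2 + 2 M does not depend
   on a. *)
apply: (@le_lt_trans _ _ (2 + 2 * M)%:E); last exact: ltry.
apply: Dq_sup; first by case: hw.
move=> a ha; have /andP[a0 a1] := ha.
pose K := 8 * (ln 1 - ln a).
have K0 : 0 <= K by rewrite /K mulr_ge0// subr_ge0 ler_ln ?posrE// ltW.
have e0 : 0 < (K + 1)^-1 by rewrite invr_gt0; lra.
have [i [/= hi1 hi2]] := filter_ex (filterI FM (wu _ e0)).
have mu_i : measurable_fun setT (u i) by case: (hu i) => -[].
have -> : w = (fun x => (w x - u i x) + u i x) by apply/funext => x; rewrite subrK.
apply: le_trans (le_DqD _ _ _ _) _ => //; first by apply: measurable_funB => //; case: hw.
have -> : (2 + 2 * M)%:E = ((2:R)%:E + (2:R)%:E * M%:E)%E by [].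
apply: leeD.
  rewrite -[leRHS]mule1; apply: lee_wpmul2l => //.
  apply: le_trans (Dq_le_normq _ a0 (ltW a1)) _; first by apply: measurable_funB => //; case: hw.
  apply: le_trans (lee_wpmul2l _ hi2) _; first by rewrite lee_fin.
  by rewrite -EFinM lee_fin -/K ler_pdivrMr; lra.
apply: lee_wpmul2l => //.
rewrite (Dd_fin (ltW a0) (lexx 1) (hu i)) lee_fin; apply: le_trans hi1.
exact: le_Dd (ltW a0) (lexx 1) (hu i).
Qed.
End Completeness.

(** * Piecewise linear functions *)

Section Hats.
Context {R : realType}.
Implicit Types (x y t L : R) (N : nat).

Definition tri t : R := Num.max 0 (1 - `|t|).

Lemma tri_ge0 t : 0 <= tri t. Proof. by rewrite /tri le_max lexx. Qed.

Lemma tri_out t : 1 <= `|t| -> tri t = 0.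
Proof. by move=> h; apply/max_idPl; rewrite subr_le0. Qed.

Lemma tri_in t : `|t| <= 1 -> tri t = 1 - `|t|.
Proof. by move=> h; apply/max_idPr; rewrite subr_ge0. Qed.

Lemma tri_lip s t : `|tri s - tri t| <= `|s - t|.
Proof.
have h1 := ler_dist_dist s t; have h0 := normr_ge0 (s - t).
move: h1; rewrite !ler_norml => /andP[h1 h2].
have [hs|/ltW hs] := leP 1 `|s|; have [ht|/ltW ht] := leP 1 `|t|;
  rewrite ?(tri_out hs) ?(tri_out ht) ?(tri_in hs) ?(tri_in ht); apply/andP; split; lra.
Qed.

Lemma continuous_tri : continuous tri.
Proof.
move=> t; apply: (@continuous_max R R (cst 0) (fun t => 1 - `|t|)); first exact: cvg_cst.
by apply: cvgB; [exact: cvg_cst|exact: norm_continuous].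
Qed.

Variable (L : R) (L0 : 0 < L).

Lemma mesh_gt0 N : 0 < mesh L N.
Proof. by rewrite /mesh divr_gt0. Qed.

Lemma node_max N : node L N N.+1 = L.
Proof. by rewrite /node /mesh mulrC divfK. Qed.

Lemma node_scale N x i : (x - node L N i) / mesh L N = x / mesh L N - i%:R.
Proof. by rewrite mulrBl /node mulfK// gt_eqF// mesh_gt0. Qed.

Lemma node_le N x i : (node L N i <= x) = (i%:R <= x / mesh L N).
Proof. by rewrite /node ler_pdivlMr ?mesh_gt0. Qed.

Lemma le_node N x i : (x <= node L N i) = (x / mesh L N <= i%:R).
Proof. by rewrite /node ler_pdivrMr ?mesh_gt0. Qed.

Lemma lt_node N x i : (x < node L N i) = (x / mesh L N < i%:R).
Proof. by rewrite /node ltr_pdivrMr ?mesh_gt0. Qed.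

(** In the variable x / h all hats are translates of [tri]; the one-sided first and last ones come
    from the restriction to [0, L]. *)
Lemma hatE N (i : 'I_N.+2) x :
  hat L i x = if 0 <= x <= L then tri (x / mesh L N - i%:R) else 0.
Proof.
have -> : (0 <= x <= L) = (0 <= x / mesh L N <= N.+1%:R).
  by rewrite -le_node node_max pmulr_lge0// invr_gt0 mesh_gt0.
rewrite /hat !node_le !le_node.
rewrite -[node L N i.+1 - x]opprB mulNr !node_scale.
set X := x / mesh L N; have i1 := ltn_ord i; rewrite ltnS in i1.
have : (i%:R <= N.+1%:R :> R) by rewrite ler_nat.
have : 0 <= (i%:R : R) by [].
case: i i1 => -[|i] /= _ i1.
  move=> _ N1; have [X0|X0] := lerP 0 X; last by [].
  rewrite /= subr0; have [h|h] := lerP X 1.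
    by rewrite (le_trans h) ?ler1n// tri_in ger0_norm//; lra.
  by case: ifP => // h2; rewrite tri_out// ger0_norm// ltW.
rewrite -!natr1 => i0 iN; have ig : 0 <= (i%:R : R) by [].
have [/andP[h1 h2]|h] := ifPn (i%:R <= X <= i%:R + 1).
  have -> : 0 <= X <= N%:R + 1 by rewrite (le_trans ig h1) (le_trans h2 iN).
  by rewrite tri_in ler0_norm; lra.
have [/andP[iN1 /andP[h1 h2]]|h'] := ifPn.
  have : (i.+2%:R <= N.+1%:R :> R) by rewrite ler_nat.
  rewrite -!natr1 => iN2.
  have -> : 0 <= X <= N%:R + 1 by rewrite (le_trans _ (le_trans h2 iN2)) ?andbT; lra.
  rewrite tri_in ger0_norm; lra.
(* Neither branch of [hat] applies, so X is at distance at least 1 from the node; for the last node,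
   X cannot lie to its right. *)
case: ifPn => // /andP[X0 XN]; rewrite tri_out//.
have [Xi|Xi] := leP X (i%:R + 1); first by
  rewrite ler0_norm; [|lra]; move: h; rewrite Xi andbT -ltNge; lra.
rewrite ger0_norm; last lra.
have [iN1|iN1] := ltnP i.+1 N.+1.
  by move: h'; rewrite iN1 /= (ltW Xi) /= -ltNge; lra.
have : (N.+1%:R <= i.+1%:R :> R) by rewrite ler_nat.
by rewrite -!natr1; lra.
Qed.

(* The hat functions of the statement are nonzero at the endpoints 0 and L, hence are
   not in V_h; hat0 vanishes there and differs from hat on a null set only. *)
Definition hat0 N (i : 'I_N.+2) x : R := if 0 < x < L then hat L i x else 0.

Lemma hat0E N (i : 'I_N.+2) x :
  hat0 i x = if 0 < x < L then tri (x / mesh L N - i%:R) else 0.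
Proof. by rewrite /hat0 hatE; case: ifP => // /andP[/ltW -> /ltW ->]. Qed.

Lemma cell_exists N (X : R) : 0 <= X <= N.+1%:R ->
  exists2 j : nat, (j <= N)%N & j%:R <= X <= j.+1%:R.
Proof.
move=> /andP[X0]; rewrite le_eqVlt => /predU1P[->|XN].
  by exists N => //; rewrite ler_nat leqnSn lexx.
have /andP[h1 h2] := truncn_itv X0.
exists (Num.truncn X); last by rewrite h1 ltW.
by rewrite -ltnS -(ltr_nat R) (le_lt_trans h1).
Qed.

Lemma tri_sum N (c : 'I_N.+2 -> R) X j (jN : (j <= N)%N) : j%:R <= X <= j.+1%:R ->
  \sum_(i < N.+2) c i * tri (X - i%:R) =
  c (inord j) * (1 - (X - j%:R)) + c (inord j.+1) * (X - j%:R).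
Proof.
move=> /andP[h1 h2]; have e1 : (inord j : 'I_N.+2) = j :> nat by rewrite inordK// !ltnS (leq_trans jN).
have e2 : (inord j.+1 : 'I_N.+2) = j.+1 :> nat by rewrite inordK// !ltnS.
rewrite (bigD1 (inord j))//= (bigD1 (inord j.+1))/=; last first.
  by apply/eqP => /(congr1 val); rewrite /= e1 e2 => /eqP; rewrite gtn_eqF.
rewrite big1 ?addr0.
  rewrite e1 e2 -natr1 in h2 *; congr (_ * _ + _ * _).
    by rewrite tri_in ger0_norm; lra.
  by rewrite tri_in ler0_norm; lra.
move=> i /andP[/eqP i1 /eqP i2]; rewrite tri_out ?mulr0//.
have [ij|ij|ij] := ltngtP i j.
- have : (i.+1%:R <= j%:R :> R) by rewrite ler_nat.
  by rewrite -natr1 => ?; rewrite ger0_norm; lra.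
- rewrite leq_eqVlt in ij; case/predU1P: ij => [ij|ij].
    by case: i2; apply/val_inj; rewrite /= e2.
  have : (j.+2%:R <= i%:R :> R) by rewrite ler_nat.
  by rewrite -!natr1 => ?; rewrite -natr1 in h2; rewrite ler0_norm; lra.
- by case: i1; apply/val_inj; rewrite /= e1.
Qed.

End Hats.

(** * Functions with jumps at 0 and L have finite energy *)

Section JumpEnergy.
Context {R : realType}.
Local Notation mu := (@lebesgue_measure R).
Implicit Types (p x y L : R) (u v : R -> R).

Let RR := (measurableTypeR R * measurableTypeR R)%type.

(** If p separates x and y, then |x - y| is at least the larger of |x - p| and |y - p|. Keeping only
    that larger distance gives an integrable majorant of 1/|x - y|: for fixed x the admissible y
    form an interval of length 2 |x - p|, which cancels the singularity. *)
Definition jump p (z : R * R) : R :=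
  if (`|z.1 - p| < 1) && (`|z.2 - p| <= `|z.1 - p|) then `|z.1 - p|^-1 else 0.

Lemma jump_ge0 p z : 0 <= jump p z.
Proof. by rewrite /jump; case: ifP. Qed.

Lemma measurable_jump p : measurable_fun setT (jump p).
Proof.
have m1 : measurable_fun setT (fun z : R * R => z.1 - p).
  by apply: measurable_funB; [exact: measurable_fst|exact: measurable_cst].
have m2 : measurable_fun setT (fun z : R * R => z.2 - p).
  by apply: measurable_funB; [exact: measurable_snd|exact: measurable_cst].
apply: measurable_fun_ifT => /=.
- apply: measurable_and.
    by apply: measurable_fun_ltr => //; exact: measurableT_comp.
  by apply: measurable_fun_ler; exact: measurableT_comp.
- exact: measurable_invnorm.
- exact: measurable_cst.
Qed.

Lemma integral_jump p : (\int[(mu \x mu)%E]_z (jump p z)%:E <= (4:R)%:E)%E.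
Proof.
rewrite fubini_tonelli1/=; last 2 first.
- by apply/measurable_EFinP; exact: measurable_jump.
- by move=> z; rewrite lee_fin jump_ge0.
pose I : set (measurableTypeR R) := `](p - 1), (p + 1)[%classic.
have mI : measurable I by exact: measurable_itv.
apply: (@le_trans _ _ (\int[mu]_x ((2:R)%:E * (\1_I x)%:E))%E).
  apply: ge0_le_integral => //.
  - by move=> x _; apply: integral_ge0 => y _; rewrite lee_fin jump_ge0.
  - apply: measurable_fun_fubini_tonelli_F.
      by apply/measurable_EFinP; exact: measurable_jump.
    by move=> z; rewrite lee_fin jump_ge0.
  - by apply/measurable_EFinP; apply: measurable_funM => //; exact: measurable_indic.
  move=> x _; rewrite /fubini_F /jump /=; have [xp|xp] := ltP `|x - p| 1; last first.
    by rewrite /= integral0 mule_ge0// lee_fin.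
  have -> : \1_I x = 1 :> R.
    by rewrite indicE mem_set// /I /= in_itv/=; move: xp; rewrite ltr_norml; lra.
  pose J : set (measurableTypeR R) := `[(p - `|x - p|), (p + `|x - p|)]%classic.
  have mJ : measurable J by exact: measurable_itv.
  rewrite (eq_integral (fun y : measurableTypeR R => (`|x - p|^-1)%:E * (\1_J y)%:E)%E); last first.
    move=> y _; rewrite -EFinM indicE /= mem_setE in_itv/= ler_norml.
    congr EFin; have -> : (- `|x - p| <= y - p <= `|x - p|) = (p - `|x - p| <= y <= p + `|x - p|).
      by apply/idP/idP; lra.
    by case: ifP; rewrite ?mulr1 ?mulr0.
  rewrite ge0_integralZl//; last by apply/measurable_EFinP; exact: measurable_indic.
  rewrite integral_indic// setIT [X in (_ * X)%E](@lebesgue_measure_itv R `[(p - `|x - p|), (p + `|x - p|)])/=.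
  rewrite lte_fin; case: ifPn => h; last by rewrite mule0 mule1 lee_fin.
  have x0 : 0 < `|x - p| by lra.
  rewrite -EFinB -!EFinM lee_fin mulr1 (_ : p + _ - _ = 2 * `|x - p|); last by ring.
  by rewrite mulrC mulfK// gt_eqF.
rewrite ge0_integralZl//; last by apply/measurable_EFinP; exact: measurable_indic.
rewrite integral_indic// setIT [X in (_ * X)%E](@lebesgue_measure_itv R `](p - 1), (p + 1)[)/=.
by rewrite lte_fin; case: ifPn => _; rewrite ?mule0 ?lee_fin// -?EFinB -?EFinM ?lee_fin; lra.
Qed.

Lemma integral_jump_swap p :
  (\int[(mu \x mu)%E]_z (jump p (z.2, z.1))%:E <= (4:R)%:E)%E.
Proof.
have ms : measurable_fun setT (fun z : R * R => jump p (z.2, z.1)).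
  apply: (measurableT_comp (measurable_jump p)).
  by apply/measurable_fun_pairP; split; [exact: measurable_snd|exact: measurable_fst].
apply: le_trans (integral_jump p); rewrite fubini_tonelli2/=; last 2 first.
- exact/measurable_EFinP.
- by move=> z; rewrite lee_fin jump_ge0.
rewrite fubini_tonelli1//=; last by move=> z; rewrite lee_fin jump_ge0.
by apply/measurable_EFinP; exact: measurable_jump.
Qed.

Lemma ker_crossing p x y : x != y -> (x <= p <= y) || (y <= p <= x) ->
  ker 0 1 (x, y) <= jump p (x, y) + jump p (y, x).
Proof.
move=> xy h; have d0 : 0 < `|x - y| by rewrite normr_gt0 subr_eq0.
have e : `|x - y| = `|x - p| + `|y - p|.
  case/orP: h => /andP[h1 h2].
    by rewrite (ler0_norm (_ : x - y <= 0)) ?(ler0_norm (_ : x - p <= 0)) ?(ger0_norm (_ : 0 <= y - p)); lra.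
  by rewrite (ger0_norm (_ : 0 <= x - y)) ?(ger0_norm (_ : 0 <= x - p)) ?(ler0_norm (_ : y - p <= 0)); lra.
have nx := normr_ge0 (x - p); have ny := normr_ge0 (y - p).
rewrite /ker /= normr_ge0 /=; case: ifPn => h1; last by rewrite addr_ge0// jump_ge0.
have [le|le] := leP `|y - p| `|x - p|.
  apply: (@le_trans _ _ (jump p (x, y))); last by rewrite lerDl jump_ge0.
  rewrite /jump /= le andbT ifT; last by lra.
  by rewrite lef_pV2 ?posrE; lra.
apply: (@le_trans _ _ (jump p (y, x))); last by rewrite lerDr jump_ge0.
rewrite /jump /= (ltW le) andbT ifT; last by lra.
by rewrite lef_pV2 ?posrE; lra.
Qed.

Definition cut L u x : R := if 0 < x < L then u x else 0.

Lemma measurable_cut L u : measurable_fun setT u -> measurable_fun setT (cut L u).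
Proof.
move=> mu_; apply: measurable_fun_ifT => //=.
by apply: measurable_and; exact: measurable_fun_ltr.
Qed.

Definition crossers L (z : R * R) : R := jump 0 z + jump 0 (z.2, z.1) + (jump L z + jump L (z.2, z.1)).

Lemma crossers_ge0 L z : 0 <= crossers L z.
Proof. by rewrite /crossers !addr_ge0// jump_ge0. Qed.

(** Inside Omega the Lipschitz bound leaves K^2 |x - y| <= K^2. A pair with one point outside
    straddles 0 or L, where the squared difference is at most 1 and the kernel is dominated by
    [jump]. *)
Lemma cut_dist L u K x y : 0 <= K ->
  (forall x, `|u x| <= 1) -> (forall x y, `|u x - u y| <= K * `|x - y|) ->
  (cut L u x - cut L u y) ^+ 2 * ker 0 1 (x, y) <=
    K ^+ 2 * (if (0 < x < L) && (`|x - y| < 1) then 1 else 0) + crossers L (x, y).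
Proof.
move=> K0 u1 uK.
have sq1 (r : R) : `|r| <= 1 -> r ^+ 2 <= 1 by rewrite ler_norml => /andP[? ?]; nra.
have [->|xy] := eqVneq x y.
  by rewrite subrr expr0n/= mul0r addr_ge0 ?crossers_ge0// mulr_ge0 ?sqr_ge0//; case: ifP.
have d0 : 0 < `|x - y| by rewrite normr_gt0 subr_eq0.
have b (r : R) : `|r| <= 1 -> ker 0 1 (x, y) <= crossers L (x, y) ->
    r ^+ 2 * ker 0 1 (x, y) <= crossers L (x, y).
  move=> r1; apply: le_trans; rewrite -[leRHS]mul1r ler_wpM2r ?ker_ge0//.
  exact: sq1.
have cr p : p = 0 \/ p = L -> (x <= p <= y) || (y <= p <= x) -> ker 0 1 (x, y) <= crossers L (x, y).
  move=> hp h; apply: le_trans (ker_crossing xy h) _; rewrite /crossers /=.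
  by case: hp => ->; rewrite ?lerDl ?lerDr addr_ge0// jump_ge0.
rewrite /cut; have [xO|xO] := ifPn (0 < x < L); have [yO|yO] := ifPn (0 < y < L).
- rewrite -[leLHS]addr0 lerD ?crossers_ge0// /ker /= normr_ge0 /=; case: ifPn => h; last by rewrite !mulr0.
  rewrite mulr1; apply: (@le_trans _ _ ((K * `|x - y|) ^+ 2 / `|x - y|)).
    rewrite ler_wpM2r ?invr_ge0// -real_normK ?num_real// ler_sqr ?nnegrE//.
    by rewrite mulr_ge0.
  rewrite exprMn -mulrA expr2 mulfK ?gt_eqF//.
  by rewrite ler_piMr ?sqr_ge0// ltW.
- rewrite subr0; apply: le_trans (b _ (u1 x) _) _; last first.
    by rewrite lerDr mulr_ge0 ?sqr_ge0//; case: ifP.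
  rewrite negb_and -!leNgt in yO; move/andP: xO => [x0 xL].
  case/orP: yO => y0.
    by apply: (cr 0); [left|apply/orP; right; rewrite y0 ltW].
  by apply: (cr L); [right|apply/orP; left; rewrite y0 ltW].
- rewrite sub0r; apply: le_trans (b _ _ _) _; last first.
  + by rewrite lerDr mulr_ge0 ?sqr_ge0//; case: ifP.
  + rewrite negb_and -!leNgt in xO; move/andP: yO => [y0 yL].
    case/orP: xO => x0.
      by apply: (cr 0); [left|apply/orP; left; rewrite x0 ltW].
    by apply: (cr L); [right|apply/orP; right; rewrite x0 ltW].
  + by rewrite normrN.
- by rewrite subrr expr0n mul0r addr_ge0 ?crossers_ge0// mulr_ge0 ?sqr_ge0//; case: ifP.
Qed.

Lemma cut_inH L u K : 0 < L -> 0 <= K -> measurable_fun setT u ->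
  (forall x, `|u x| <= 1) -> (forall x y, `|u x - u y| <= K * `|x - y|) ->
  inH L (cut L u).
Proof.
move=> L0 K0 mu_ u1 uK; have mc := measurable_cut L mu_.
have mO : measurable (Omega L : set (measurableTypeR R)) by exact: measurable_itv.
split.
- split=> //; have [[_ nO] _] := Omega_indic L0; apply: le_lt_trans nO.
  apply: ge0_le_integral => //.
  + by move=> x _; rewrite lee_fin sqr_ge0.
  + by apply/measurable_EFinP; exact: measurable_funX.
  + by apply/measurable_EFinP; apply: measurable_funX; exact: measurable_indic.
  + move=> x _; rewrite lee_fin /cut indicE mem_setE in_itv/=; case: ifP => _; last by rewrite expr0n.
    by rewrite expr1n; have := u1 x; rewrite ler_norml => /andP[? ?]; nra.
- apply: aeW => x; rewrite /Omega/= in_itv/= /cut => /negP/negbTE -> //.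
have mb : measurable_fun setT (fun z : R * R => (if (0 < z.1 < L) && (`|z.1 - z.2| < 1) then 1 else 0 : R)).
  apply: measurable_fun_ifT => //=.
  apply: measurable_and; last by apply: measurable_fun_ltr => //; exact: measurable_dist.
  apply: measurable_and; apply: measurable_fun_ltr => //; exact: measurable_fst.
have mj p : measurable_fun setT (fun z : R * R => jump p z) by exact: measurable_jump.
have ms p : measurable_fun setT (fun z : R * R => jump p (z.2, z.1)).
  apply: (measurableT_comp (measurable_jump p)).
  by apply/measurable_fun_pairP; split; [exact: measurable_snd|exact: measurable_fst].
have I p : (mu \x mu)%E.-integrable (setT : set RR) (EFin \o jump p).
  apply/integrableP; split; first by apply/measurable_EFinP; exact: mj.
  apply: le_lt_trans (le_lt_trans (integral_jump p) (ltry _)).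
  by under eq_integral do rewrite gee0_abs ?lee_fin ?jump_ge0//.
have J p : (mu \x mu)%E.-integrable (setT : set RR) (EFin \o (fun z => jump p (z.2, z.1))).
  apply/integrableP; split; first by apply/measurable_EFinP; exact: ms.
  apply: le_lt_trans (le_lt_trans (integral_jump_swap p) (ltry _)).
  by under eq_integral do rewrite gee0_abs ?lee_fin ?jump_ge0//.
have B0 : (mu \x mu)%E.-integrable (setT : set RR) (EFin \o (fun z : R * R =>
   if (0 < z.1 < L) && (`|z.1 - z.2| < 1) then 1 else 0)).
  apply/integrableP; split; first by apply/measurable_EFinP; exact: mb.
  rewrite (eq_integral (fun z : RR =>
     (if (0 < z.1 < L)%R && (`|z.1 - z.2| < 1)%R then 1 else 0)%:E)); last first.
    by move=> z _; rewrite gee0_abs//= lee_fin; case: ifP.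
  apply: (@le_lt_trans _ _ (2 * L)%:E); last exact: ltry.
  rewrite fubini_tonelli1; [|by apply/measurable_EFinP; exact: mb|by move=> z; rewrite lee_fin; case: ifP].
  rewrite (eq_integral (fun x : measurableTypeR R => (2:R)%:E * (\1_(Omega L) x)%:E)%E).
    rewrite ge0_integralZl//; last by apply/measurable_EFinP; exact: measurable_indic.
    rewrite integral_indic// setIT [X in (_ * X)%E](@lebesgue_measure_itv R `]0, L[)/=.
    by rewrite lte_fin L0 oppr0 adde0.
  move=> x _; rewrite /fubini_F /= indicE mem_setE in_itv/=.
  have [xO|xO] := boolP (0 < x < L); last by rewrite /= integral0 mule0.
  rewrite /=.
  pose J1 : set (measurableTypeR R) := `](x - 1), (x + 1)[%classic.
  have mJ1 : measurable J1 by exact: measurable_itv.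
  rewrite (eq_integral (fun y : measurableTypeR R => (\1_J1 y)%:E)); last first.
    by move=> y _; rewrite normr_Ninner indicE mem_setE; case: ifP.
  rewrite integral_indic// setIT [LHS](@lebesgue_measure_itv R `](x - 1), (x + 1)[)/=.
  by rewrite lte_fin mule1 ifT; [rewrite -EFinB; congr EFin; lra|lra].
have B : (mu \x mu)%E.-integrable (setT : set RR) (EFin \o (fun z : R * R =>
   K ^+ 2 * (if (0 < z.1 < L) && (`|z.1 - z.2| < 1) then 1 else 0))).
  exact: (integrableZl measurableT (K ^+ 2) B0).
have /integrableP[_] := integrableD measurableT B (integrableD measurableT
  (integrableD measurableT (I 0) (J 0)) (integrableD measurableT (I L) (J L))).
apply: le_lt_trans; apply: ge0_le_integral => //.
- by move=> z _; rewrite lee_fin mulr_ge0 ?sqr_ge0 ?ker_ge0.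
- by apply/measurable_EFinP; exact: measurable_Dq.
- do 2 apply: measurableT_comp => //.
  apply: measurable_funD; first by apply: measurable_funM => //; exact: mb.
  by apply: measurable_funD; apply: measurable_funD; by [exact: mj|exact: ms].
- move=> [x y] _; rewrite /= lee_fin; apply: le_trans (ler_norm _).
  exact: cut_dist.
Qed.
End JumpEnergy.

(** * The finite element space and its basis *)

Section FiniteElements.
Context {R : realType}.
Local Notation mu := (@lebesgue_measure R).
Implicit Types (x y t : R) (u v : R -> R).
Variable (L : R) (L0 : 0 < L).

Lemma lin_comb_inH n (c : 'I_n -> R) (b : 'I_n -> R -> R) :
  (forall i, inH L (b i)) -> inH L (lin_comb c b).
Proof.
move=> hb; rewrite /lin_comb.
elim: (index_enum _) => [|i r IH].
  have -> : (fun x => \sum_(i <- [::]) c i * b i x) = (fun=> 0).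
    by apply/funext => x; rewrite big_nil.
  exact: inH0.
have -> : (fun x => \sum_(i <- i :: r) c i * b i x) =
    (fun x => c i * b i x + \sum_(i <- r) c i * b i x).
  by apply/funext => x; rewrite big_cons.
exact: inHD (inHZ _ (hb i)) IH.
Qed.

Lemma hat0_inH N (i : 'I_N.+2) : inH L (hat0 L i).
Proof.
have h0 := mesh_gt0 L0 N.
have -> : hat0 L i = cut L (fun x => tri (x / mesh L N - i%:R)).
  by apply/funext => x; rewrite hat0E.
apply: (@cut_inH _ _ _ (mesh L N)^-1) => //.
- by rewrite invr_ge0 ltW.
- apply: continuous_measurable_fun => x.
  apply: (@continuous_comp _ _ _ (fun x => x / mesh L N - i%:R) tri); last exact: continuous_tri.
  by apply: cvgB; [apply: cvgMl|]; [exact: cvg_id|exact: cvg_cst].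
- move=> x; rewrite ger0_norm ?tri_ge0// /tri ge_max ler01/=.
  by rewrite lerBlDr lerDl.
- move=> x y; apply: le_trans (tri_lip _ _) _.
  rewrite (_ : _ - _ - _ = (mesh L N)^-1 * (x - y)); last by ring.
  by rewrite normrM gtr0_norm ?invr_gt0.
Qed.

Lemma lin_comb_hat0 N (c : 'I_N.+2 -> R) x : lin_comb c (hat0 L (N:=N)) x =
  if 0 < x < L then \sum_(i < N.+2) c i * tri (x / mesh L N - i%:R) else 0.
Proof.
rewrite /lin_comb; case: ifPn => hx.
  by apply: eq_bigr => i _; rewrite hat0E// hx.
by apply: big1 => i _; rewrite hat0E// (negbTE hx) mulr0.
Qed.

Lemma node_in N x j : (j <= N)%N -> node L N j < x < node L N j.+1 -> 0 < x < L.
Proof.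
move=> jN /andP[h1 h2]; have h0 := mesh_gt0 L0 N; apply/andP; split.
  by apply: le_lt_trans h1; rewrite /node mulr_ge0// ltW.
apply: lt_le_trans h2 _; apply: (@le_trans _ _ (node L N N.+1)); last by rewrite node_max.
by rewrite /node ler_wpM2r ?ler_nat// ltW.
Qed.

Lemma cell_lin_comb N (c : 'I_N.+2 -> R) x j : (j <= N)%N ->
  node L N j <= x <= node L N j.+1 -> 0 < x < L ->
  lin_comb c (hat0 L (N:=N)) x =
    c (inord j) * (1 - (x / mesh L N - j%:R)) + c (inord j.+1) * (x / mesh L N - j%:R).
Proof.
move=> jN hx x0; rewrite lin_comb_hat0 x0 (tri_sum c jN)//.
by rewrite -node_le// -le_node.
Qed.

Lemma affine_size (a b : R) : (size (b *: 'X + a%:P)%R <= 2)%N.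
Proof.
rewrite -mul_polyC size_MXaddC; case: ifP => // _.
by rewrite ltnS size_polyC_leq1.
Qed.

Lemma affine_horner (p : {poly R}) x : (size p <= 2)%N -> p.[x] = p`_0 + p`_1 * x.
Proof.
move=> hp; rewrite (horner_coef_wide _ hp) big_ord_recr big_ord1 /=.
by rewrite expr0 expr1 mulr1.
Qed.

Lemma Vh_lin_comb N (c : 'I_N.+2 -> R) : V_h L N (lin_comb c (hat0 L (N:=N))).
Proof.
split.
- apply: (@subspace_eq_continuous _ _ _ (fun x => \sum_(i < N.+2) c i * tri (x / mesh L N - i%:R))).
    by move=> x; rewrite inE /Omega/= in_itv/= => hx; rewrite /from_subspace lin_comb_hat0 hx.
  apply: continuous_subspaceT.
  apply: continuous_big => [|i _ x]; first exact: add_continuous.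
  apply: cvgMr.
  apply: (@continuous_comp _ _ _ (fun x => x / mesh L N - i%:R) tri); last exact: continuous_tri.
  by apply: cvgB; [apply: cvgMl|]; [exact: cvg_id|exact: cvg_cst].
- by move=> x; rewrite /Omega/= in_itv/= lin_comb_hat0 => /negP/negbTE ->.
- move=> j jN; pose a := c (inord j); pose b := c (inord j.+1).
  exists ((b - a) / mesh L N *: 'X + (a - (b - a) * j%:R)%:P); first exact: affine_size.
  move=> x hx; rewrite (cell_lin_comb c jN); last 2 first.
  + by have /andP[/ltW -> /ltW ->] := hx.
  + exact: node_in hx.
  by rewrite hornerD hornerZ hornerX hornerC -/a -/b; ring.
Qed.

(** Membership in [V_h] prescribes polynomials on open cells only; continuity carries their values
    to the interior nodes. *)
Lemma left_limit u (p : {poly R}) a x : a < x -> {for x, continuous u} ->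
  (forall y, a < y < x -> u y = p.[y]) -> u x = p.[x].
Proof.
move=> ax cu up.
have c1 : u y @[y --> x^'-] --> u x by apply: cvg_at_left_filter.
have c2 : p.[y] @[y --> x^'-] --> p.[x].
  by apply: cvg_at_left_filter; exact: continuous_horner.
rewrite -(cvg_lim _ c1)//; apply/cvg_lim => //; apply: cvg_trans c2.
apply: near_eq_cvg; near=> y.
by rewrite up//; apply/andP; split; near: y; [exact: nbhs_left_gt|exact: nbhs_left_lt].
Unshelve. all: by end_near. Qed.

Lemma right_limit u (p : {poly R}) b x : x < b -> {for x, continuous u} ->
  (forall y, x < y < b -> u y = p.[y]) -> u x = p.[x].
Proof.
move=> ax cu up.
have c1 : u y @[y --> x^'+] --> u x by apply: cvg_at_right_filter.
have c2 : p.[y] @[y --> x^'+] --> p.[x].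
  by apply: cvg_at_right_filter; exact: continuous_horner.
rewrite -(cvg_lim _ c1)//; apply/cvg_lim => //; apply: cvg_trans c2.
apply: near_eq_cvg; near=> y.
by rewrite up//; apply/andP; split; near: y; [exact: nbhs_right_gt|exact: nbhs_right_lt].
Unshelve. all: by end_near. Qed.

Lemma node_ltS N j : node L N j < node L N j.+1.
Proof. by rewrite /node ltr_pM2r ?mesh_gt0// ltr_nat. Qed.

Lemma Vh_span N u : V_h L N u -> exists c, u = lin_comb c (hat0 L (N:=N)).
Proof.
move=> [cu u0 up]; have h0 := mesh_gt0 L0 N.
have /choice[p hp] : forall j : nat, exists q : {poly R}, (j <= N)%N ->
    (size q <= 2)%N /\ forall x, node L N j < x < node L N j.+1 -> u x = q.[x].
  move=> j; have [jN|jN] := leqP j N; last by exists 0.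
  by have [q ? ?] := up j jN; exists q.
have cu' x : 0 < x < L -> {for x, continuous u}.
  move=> hx; have := cu; rewrite continuous_open_subspace; last exact: interval_open.
  by apply; rewrite inE /Omega/= in_itv.
have inner j : (j < N)%N -> 0 < node L N j.+1 < L.
  move=> jN; rewrite {1}/node mulr_gt0//=.
  apply: (@lt_le_trans _ _ (node L N N.+1)); last by rewrite node_max.
  by rewrite /node ltr_pM2r// ltr_nat ltnS.
have hl j : (j < N)%N -> u (node L N j.+1) = (p j).[node L N j.+1].
  move=> jN; apply: (left_limit (node_ltS N j)); first exact: cu' (inner _ jN).
  exact: (hp j (ltnW jN)).2.
have hr j : (j < N)%N -> u (node L N j.+1) = (p j.+1).[node L N j.+1].
  move=> jN; apply: (right_limit (node_ltS N j.+1)); first exact: cu' (inner _ jN).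
  exact: (hp j.+1 jN).2.
(* At 0 and L the function itself is 0, so the coefficients there are boundary values of the
   adjacent polynomials. *)
pose c (k : 'I_N.+2) := if (k <= N)%N then (p k).[node L N k] else (p N).[node L N N.+1].
exists c; apply/funext => x.
have [x0|x0] := boolP (0 < x < L); last first.
  rewrite lin_comb_hat0 (negbTE x0) u0// /Omega/= in_itv/=; exact/negP.
have [|j jN /andP[j1 j2]] := @cell_exists R N (x / mesh L N).
  have /andP[x1 x2] := x0.
  by rewrite divr_ge0 ?ltW//= -lt_node// node_max.
rewrite -node_le// in j1; rewrite -le_node// in j2.
rewrite (cell_lin_comb c jN) ?j1 ?j2//.
have cj : c (inord j) = (p j).[node L N j] by rewrite /c inordK ?jN// ltnS leqW.
have cj1 : c (inord j.+1) = (p j).[node L N j.+1].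
  rewrite /c inordK ?ltnS//; case: ifPn => jN1; first by rewrite -hl// hr.
  by have -> : j = N by apply/eqP; rewrite eqn_leq jN leqNgt.
have ux : u x = (p j).[x].
  move: j1; rewrite le_eqVlt => /predU1P[xe|j1].
    rewrite -xe in x0 *; case: j jN {j2 cj cj1} xe x0 => [|j] jN xe x0.
      by move: x0; rewrite /node mul0r ltxx.
    exact: hr.
  move: j2; rewrite le_eqVlt => /predU1P[xe|j2].
    have jN1 : (j < N)%N.
      rewrite ltn_neqAle jN andbT; apply/eqP => e; move: x0.
      by rewrite xe e node_max ltxx andbF.
    by rewrite xe; exact: hl.
  by apply: (hp j jN).2; rewrite j1.
rewrite cj cj1 ux !affine_horner; try by case: (hp j jN).
have := gt_eqF h0; rewrite /node -natr1 => hn; field.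
by rewrite hn.
Qed.

Lemma ae_exists (P : R -> Prop) a b : a < b -> {ae mu, forall x, P x} ->
  exists2 x, a < x < b & P x.
Proof.
move=> ab hP; apply: contrapT => nP.
have neg : mu.-negligible (`]a, b[%classic : set (measurableTypeR R)).
  apply: negligibleS hP => x /=; rewrite in_itv/= => hx Px.
  by apply: nP; exists x.
have mI : measurable (`]a, b[%classic : set (measurableTypeR R)) by exact: measurable_itv.
have := measure_negligible mI neg.
rewrite [LHS](@lebesgue_measure_itv R `]a, b[) /= lte_fin ab -EFinB => -[].
by move/eqP; rewrite subr_eq0 gt_eqF.
Qed.

(** A combination that vanishes almost everywhere vanishes at two distinct points of each open cell,
    and it is affine there. *)
Lemma hat0_indep N (c : 'I_N.+2 -> R) : ae0 (lin_comb c (hat0 L (N:=N))) -> forall i, c i = 0.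
Proof.
move=> h.
have key j : (j <= N)%N -> c (inord j) = 0 /\ c (inord j.+1) = 0.
  move=> jN; have ab := node_ltS N j.
  have [x /andP[x1 x2] xz] := ae_exists ab h.
  have [y /andP[y1 y2] yz] := ae_exists x1 h.
  have hx : node L N j < x < node L N j.+1 by rewrite x1.
  have hy : node L N j < y < node L N j.+1 by rewrite y1 (lt_trans y2).
  rewrite (cell_lin_comb c jN _ (node_in jN hx)) ?(ltW x1) ?(ltW x2)// in xz.
  rewrite (cell_lin_comb c jN _ (node_in jN hy)) ?(ltW y1) ?(ltW (lt_trans y2 x2))// in yz.
  have : y / mesh L N < x / mesh L N by rewrite ltr_pM2r// invr_gt0 mesh_gt0.
  move: xz yz; set s := x / _ - _; set t := y / _ - _ => xz yz hst.
  have st : s - t != 0 by rewrite /s /t; lra.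
  have e : (c (inord j.+1) - c (inord j)) * (s - t) = 0 by lra.
  move/eqP: e; rewrite mulf_eq0 (negbTE st) orbF subr_eq0 => /eqP e.
  by split; [|rewrite e]; move: xz; rewrite e; lra.
move=> i; have := ltn_ord i; rewrite ltnS leq_eqVlt => /predU1P[iN|iN].
  have -> : i = inord N.+1 by apply/val_inj; rewrite /= inordK.
  by have [] := key N (leqnn N).
by have [+ _] := key i iN; rewrite inord_val.
Qed.

Lemma ae0_inH u : measurable_fun setT u -> ae0 u -> inH L u.
Proof.
move=> mu_ u0; have n0 : normq u = 0%E.
  rewrite /normq; transitivity (\int[mu]_x (cst 0%E x))%E; last exact: integral0.
  apply: ge0_ae_eq_integral => //.
  - by apply/measurable_EFinP; exact: measurable_funX.
  - by move=> x _; rewrite lee_fin sqr_ge0.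
  - by apply: ae_S u0 => x -> _; rewrite expr0n.
split.
- by split=> //; rewrite n0.
- by apply: ae_S u0 => x ->.
- apply: (@le_lt_trans _ _ 0%E) => //; apply: Dq_sup => // a /andP[a0 a1].
  by apply: le_trans (Dq_le_normq mu_ a0 (ltW a1)) _; rewrite n0 mule0.
Qed.

(** Since [dot u u = 0], [E_L_small] applies to u itself with every tolerance. The form is thus
    independent of representatives. *)
Lemma E_L_ae0 u v : inH L u -> ae0 u -> inH L v -> E_L u v = 0.
Proof.
move=> hu u0 hv; apply/eqP; rewrite -normr_le0; apply/ler_addgt0Pr => e e0; rewrite add0r.
have [d d0] := E_L_small (Dd 0 1 u u) L0 hv e0; apply=> //.
by rewrite ((dot_eq0P (inH_L2 hu)).1 u0) ltW.
Qed.

Lemma hat_inH N (i : 'I_N.+2) : inH L (hat L i) /\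
  ae0 (fun x => hat L i x - hat0 L i x).
Proof.
have mh : measurable_fun setT (hat L i : R -> R).
  have -> : hat L i = (fun x => if 0 <= x <= L then tri (x / mesh L N - i%:R) else 0).
    by apply/funext => x; rewrite hatE.
  apply: measurable_fun_ifT => //=.
    by apply: measurable_and; exact: measurable_fun_ler.
  apply: continuous_measurable_fun => x.
  apply: (@continuous_comp _ _ _ (fun x => x / mesh L N - i%:R) tri); last exact: continuous_tri.
  by apply: cvgB; [apply: cvgMl|]; [exact: cvg_id|exact: cvg_cst].
have h0 := hat0_inH i.
have a0 : ae0 (fun x => hat L i x - hat0 L i x).
  have : mu.-negligible (([set 0] `|` [set L])%classic : set (measurableTypeR R)).
    have n1 (r : R) : mu.-negligible ([set r] : set (measurableTypeR R)).
      by exists [set r]; split => //; exact: lebesgue_measure_set1.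
    exact: negligibleU (n1 _) (n1 _).
  apply: negligibleS => x /= hx; apply: contrapT => nx; apply: hx.
  rewrite hatE// hat0E//; have [e|e] := eqVneq x 0; first by case: nx; left.
  have [e'|e'] := eqVneq x L; first by case: nx; right.
  by rewrite !lt_neqAle (eq_sym 0) e e' /= subrr.
split=> //.
have := inHD (ae0_inH (measurable_funB mh (inH_L2 h0).1) a0) h0.
by congr inH; apply/funext => x; rewrite subrK.
Qed.

Lemma E_hat N (i j : 'I_N.+2) : E_L (hat L i) (hat L j) = E_L (hat0 L i) (hat0 L j).
Proof.
have [hi ai] := hat_inH i; have [hj aj] := hat_inH j.
have i0 := hat0_inH i; have j0 := hat0_inH j.
have e k (v : R -> R) : inH L v -> E_L (hat L k) v = E_L (hat0 L k : R -> R) v.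
  move=> hv; have [hk ak] := hat_inH k; have k0 := hat0_inH k.
  have -> : hat L k = (fun x => (hat L k x - hat0 L k x) + hat0 L k x).
    by apply/funext => x; rewrite subrK.
  by rewrite (E_LDl L0 (inHB hk k0) k0 hv) (E_L_ae0 (inHB hk k0) ak hv) add0r.
by rewrite e// (E_LC L0 i0 hj) e// (E_LC L0 j0 i0).
Qed.

Lemma dot_hat N (i j : 'I_N.+2) : L2dot L (hat L i) (hat L j) = dot (hat0 L i) (hat0 L j).
Proof.
have [hi ai] := hat_inH i; have [hj aj] := hat_inH j.
have i0 := hat0_inH i; have j0 := hat0_inH j.
rewrite (L2dotE hi (inH_L2 hj)) /dot /Rintegral; congr fine.
have mi := (inH_L2 hi).1; have mj := (inH_L2 hj).1.
have mi0 := (inH_L2 i0).1; have mj0 := (inH_L2 j0).1.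
apply: ae_eq_integral => //; try by apply/measurable_EFinP; exact: measurable_funM.
apply: ae_S2 ai aj => x /eqP + /eqP + _.
by rewrite !subr_eq0 => /eqP -> /eqP ->.
Qed.
End FiniteElements.

(** * Quasi-interpolation by logarithmic averages *)

Section WeightedAverage.
Context {R : realType}.
Local Notation mu := (@lebesgue_measure R).
Variables (w : R -> R) (B l : R).
Hypotheses (mw : measurable_fun setT w) (w0 : forall x, 0 <= w x)
  (wB : forall x, w x <= B) (l0 : 0 < l) (wl : (\int[mu]_x (w x)%:E = l%:E)%E).
Implicit Types u v : R -> R.

Let mw' : measurable_fun (setT : set (measurableTypeR R)) w := mw.
Let w0' : forall x : measurableTypeR R, 0 <= w x := w0.

Definition avg u : R := wdot mu w u (cst 1) / l.

Lemma L2_W2 u : L2 u -> W2 mu w u.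
Proof.
move=> [mu_ hu]; split=> //; apply: (@le_lt_trans _ _ (B%:E * normq u)%E).
  have B0 : 0 <= B by apply: le_trans (wB 0).
  rewrite -ge0_integralZl//; last 2 first.
  - by apply/measurable_EFinP; exact: measurable_funX.
  - by move=> x _; rewrite lee_fin sqr_ge0.
  apply: ge0_le_integral => //.
  - by move=> x _; rewrite lee_fin mulr_ge0 ?sqr_ge0.
  - by apply/measurable_EFinP; apply: measurable_funM => //; exact: measurable_funX.
  - by apply/measurable_EFinP; apply: measurable_funM => //; exact: measurable_funX.
  - by move=> x _; rewrite -EFinM lee_fin mulrC ler_wpM2r ?sqr_ge0.
by apply: lte_mul_pinfty => //; rewrite lee_fin; apply: le_trans (wB 0).
Qed.

Lemma cst_W2 (a : R) : W2 mu w (cst a).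
Proof.
split; first exact: measurable_cst.
rewrite (eq_integral (fun x : measurableTypeR R => (a ^+ 2)%:E * (w x)%:E)%E)//.
have mw2 : measurable_fun (setT : set (measurableTypeR R)) (EFin \o w) by exact/measurable_EFinP.
have a2 : (0 <= (a ^+ 2)%:E)%E by rewrite lee_fin sqr_ge0.
rewrite ge0_integralZl ?wl//; first by rewrite ltry.
by move=> x _; rewrite lee_fin.
Qed.

Lemma wdot_cst (a b : R) : wdot mu w (cst a) (cst b) = a * b * l.
Proof.
rewrite /wdot /= RintegralZl//.
  by rewrite /Rintegral wl.
apply/integrableP; split; first exact/measurable_EFinP.
rewrite (eq_integral (fun x : measurableTypeR R => (w x)%:E)) ?wl ?ltry// => x _.
by rewrite gee0_abs ?lee_fin.
Qed.

Lemma avgB u v : L2 u -> L2 v -> avg (fun x => u x - v x) = avg u - avg v.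
Proof.
move=> hu hv; rewrite /avg -mulrBl; congr (_ / _).
have -> : (fun x => u x - v x) = (fun x => u x + (-1) * v x) by apply/funext => x; rewrite mulN1r.
rewrite (wdotDl mw' w0' (L2_W2 hu) (L2_W2 (L2Z (-1) hv)) (cst_W2 1)).
by rewrite (wdotZl mw' w0' (-1) (L2_W2 hv) (cst_W2 1)) mulN1r.
Qed.

(* Jensen's inequality for the probability density w / l. *)
Lemma avg_dist u a : L2 u ->
  (((avg u - a) ^+ 2)%:E <= (l^-1)%:E * \int[mu]_z ((u z - a) ^+ 2 * w z)%:E)%E.
Proof.
move=> hu; have hu' := L2_W2 hu.
have ha := cst_W2 (- a); have hua := W2D mw' w0' hu' ha.
rewrite -[X in (_ * X)%E](wdotE mw' w0' hua) -EFinM lee_fin.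
have -> : avg u - a = wdot mu w (fun x => u x + cst (- a) x) (cst 1) / l.
  rewrite (wdotDl mw' w0' hu' ha (cst_W2 1)) wdot_cst /avg.
  by field; rewrite gt_eqF.
rewrite exprMn mulrC exprVn -ler_pdivlMl ?exprn_gt0 ?invr_gt0// ?exprn_gt0//.
apply: le_trans (wdot_CS mw' w0' hua (cst_W2 1)) _.
rewrite wdot_cst le_eqVlt; apply/orP; left; apply/eqP.
by field; rewrite gt_eqF.
Qed.

(** Jensen with the weight replaced by its supremum. The constant blows up as the mesh shrinks; it
    serves the compactness argument, where the mesh is fixed. *)
Lemma avg_le u : L2 u -> (avg u) ^+ 2 <= B / l * dot u u.
Proof.
move=> hu; have := avg_dist 0 hu; rewrite subr0 => h.
have mu_ : measurable_fun setT u by case: hu.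
have B0 : 0 <= B by apply: le_trans (wB 0).
rewrite -lee_fin; apply: le_trans h _.
have -> : (B / l * dot u u)%:E = ((l^-1)%:E * (B%:E * normq u))%E.
  by rewrite (normqE hu) -!EFinM; congr EFin; ring.
apply: lee_wpmul2l; first by rewrite lee_fin invr_ge0 ltW.
rewrite -ge0_integralZl//; last 2 first.
- by apply/measurable_EFinP; exact: measurable_funX.
- by move=> x _; rewrite lee_fin sqr_ge0.
apply: ge0_le_integral => //.
- by move=> x _; rewrite lee_fin mulr_ge0 ?sqr_ge0.
- apply/measurable_EFinP; apply: measurable_funM => //; apply: measurable_funX.
  by apply: measurable_funB => //; exact: measurable_cst.
- by apply/measurable_EFinP; apply: measurable_funM => //; exact: measurable_funX.
- by move=> x _; rewrite -EFinM lee_fin subr0 mulrC ler_wpM2r ?sqr_ge0.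
Qed.

Lemma avg_ae0 u : measurable_fun setT u -> {ae mu, forall z, u z * w z = 0} -> avg u = 0.
Proof.
move=> mu_ h; rewrite /avg /wdot /Rintegral (_ : integral _ _ _ = 0%E) ?mul0r//.
rewrite -[RHS](integral0 mu setT); apply: ae_eq_integral => //.
- apply/measurable_EFinP; apply: measurable_funM => //; apply: measurable_funM => //; exact: measurable_cst.
- by apply: ae_S h => z hz _; rewrite /= mulr1 hz.
Qed.
End WeightedAverage.

(** * Piecewise linear functions in the rescaled variable *)

Section PiecewiseLinear.
Context {R : realType} (N : nat) (c : 'I_N.+2 -> R).
Implicit Types X Y a b : R.

Definition pl X : R := \sum_(i < N.+2) c i * tri (X - i%:R).

Lemma convex_sq_le (p q s b : R) : 0 <= s <= 1 -> p ^+ 2 <= b -> q ^+ 2 <= b ->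
  (p * (1 - s) + q * s) ^+ 2 <= b.
Proof.
move=> /andP[s0 s1] hp hq.
have h1 : 0 <= s * (1 - s) * (p - q) ^+ 2 by apply: mulr_ge0; [apply: mulr_ge0 => //; rewrite subr_ge0|exact: sqr_ge0].
have h2 : (1 - s) * p ^+ 2 <= (1 - s) * b by rewrite ler_wpM2l// subr_ge0.
have h3 : s * q ^+ 2 <= s * b by rewrite ler_wpM2l.
lra.
Qed.

Lemma inord_nat j : (j <= N.+1)%N -> (inord j : 'I_N.+2) = j :> nat.
Proof. by move=> jN; rewrite inordK// ltnS. Qed.

(** The value at X is a convex combination of the coefficients at the two ends of its cell. The
    reference value a will be u(x). *)
Lemma pl_near X a b : 0 <= X <= N.+1%:R ->
  (forall i : 'I_N.+2, `|X - i%:R| <= 1 -> (c i - a) ^+ 2 <= b) ->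
  (pl X - a) ^+ 2 <= b.
Proof.
move=> /cell_exists[j jN hj] h; have /andP[h1 h2] := hj.
rewrite /pl (tri_sum c jN hj).
rewrite (_ : _ - a = (c (inord j) - a) * (1 - (X - j%:R)) + (c (inord j.+1) - a) * (X - j%:R)); last by ring.
rewrite -natr1 in h2.
apply: convex_sq_le; first by apply/andP; split; lra.
- by apply: h; rewrite inord_nat ?leqW// ger0_norm; lra.
- by apply: h; rewrite inord_nat// -natr1 ler0_norm; lra.
Qed.

Lemma sqrB_le4 (p q a b : R) : (p - a) ^+ 2 <= b -> (q - a) ^+ 2 <= b ->
  (p - q) ^+ 2 <= 4 * b.
Proof. by move=> hp hq; have := sqr_ge0 (p + q - 2 * a); lra. Qed.

Lemma sqr_chain (p q b s t : R) : 0 <= s -> 0 <= t -> p ^+ 2 <= b -> q ^+ 2 <= b ->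
  (p * s + q * t) ^+ 2 <= b * (s + t) ^+ 2.
Proof.
move=> s0 t0 hp hq.
have pq : p * q <= b by have := sqr_ge0 (p - q); lra.
have h1 : s ^+ 2 * p ^+ 2 <= s ^+ 2 * b by rewrite ler_wpM2l ?sqr_ge0.
have h2 : t ^+ 2 * q ^+ 2 <= t ^+ 2 * b by rewrite ler_wpM2l ?sqr_ge0.
have h3 : (s * t) * (p * q) <= (s * t) * b by rewrite ler_wpM2l ?mulr_ge0.
lra.
Qed.

(** The slope on a cell is a difference of neighbouring coefficients, whose square is at most 4 b;
    an interval of length at most 1 meets at most two cells in its interior, and [sqr_chain] adds
    the two increments. *)
Lemma pl_lip X Y a b : 0 <= X -> X <= Y -> Y <= N.+1%:R -> Y <= X + 1 ->
  (forall i : 'I_N.+2, X - 1 <= i%:R <= Y + 1 -> (c i - a) ^+ 2 <= b) ->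
  (pl X - pl Y) ^+ 2 <= 4 * b * (Y - X) ^+ 2.
Proof.
move=> X0; rewrite le_eqVlt => /predU1P[<- _ _ _|XY YN XY1 h].
  by rewrite !subrr !expr0n mulr0.
have XN : 0 <= X <= N.+1%:R by rewrite X0 (le_trans (ltW XY)).
have [j jN hj] := cell_exists XN; have /andP[h1 h2] := hj.
have e1 : j%:R + 1 = j.+1%:R :> R by rewrite natr1.
have bj : (c (inord j) - a) ^+ 2 <= b.
  by apply: h; rewrite inord_nat ?leqW//; apply/andP; split; lra.
have [Yj|Yj] := leP Y j.+1%:R.
  have hY : j%:R <= Y <= j.+1%:R by rewrite (le_trans h1 (ltW XY)).
  have [e|n1] := eqVneq X j.+1%:R; first by rewrite -e in Yj; move: XY; rewrite ltNge Yj.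
  have bj1 : (c (inord j.+1) - a) ^+ 2 <= b.
    by apply: h; rewrite inord_nat//; apply/andP; split; lra.
  rewrite /pl (tri_sum c jN hj) (tri_sum c jN hY).
  have := sqrB_le4 bj bj1; set d := _ - c (inord j.+1) => hd.
  rewrite (_ : _ - _ = d * (Y - X)); last by rewrite /d; ring.
  by rewrite exprMn ler_wpM2r// sqr_ge0.
have bj1 : (c (inord j.+1) - a) ^+ 2 <= b.
  by apply: h; rewrite inord_nat//; apply/andP; split; lra.
have jN1 : (j < N)%N by rewrite -(ltr_nat R) -(ltrD2r 1) !natr1 (lt_le_trans Yj).
have e2 : j.+1%:R + 1 = j.+2%:R :> R by rewrite natr1.
have hY : j.+1%:R <= Y <= j.+2%:R by apply/andP; split; lra.
have bj2 : (c (inord j.+2) - a) ^+ 2 <= b.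
  by apply: h; rewrite inord_nat//; apply/andP; split; lra.
rewrite /pl (tri_sum c jN hj) (tri_sum c jN1 hY).
have := sqrB_le4 bj bj1; set d := _ - c (inord j.+1) => hd.
have := sqrB_le4 bj1 bj2; set d' := _ - c (inord j.+2) => hd'.
rewrite (_ : _ - _ = d * (j.+1%:R - X) + d' * (Y - j.+1%:R)); last first.
  by rewrite /d /d' -e1; ring.
rewrite (_ : Y - X = (j.+1%:R - X) + (Y - j.+1%:R)); last by ring.
by apply: sqr_chain; lra.
Qed.

(** Replaces the cutoff to Omega. The boundary coefficients of the quasi-interpolant vanish on the
    energy space, so there it is [pl] after [clamp] on the whole line, and pairs that straddle the
    boundary obey the same Lipschitz bound as interior ones. *)
Definition clamp X : R := Num.max 0 (Num.min X N.+1%:R).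

Lemma clamp_itv X : 0 <= clamp X <= N.+1%:R.
Proof. by rewrite /clamp le_max lexx ge_max ler0n ge_min lexx orbT. Qed.

Lemma clamp_low X : X <= 0 -> clamp X = 0.
Proof. by move=> h; apply/max_idPl; rewrite ge_min h. Qed.

Lemma clamp_high X : N.+1%:R <= X -> clamp X = N.+1%:R.
Proof. by move=> h; rewrite /clamp (min_idPr h); apply/max_idPr. Qed.

Lemma clamp_id X : 0 <= X <= N.+1%:R -> clamp X = X.
Proof. by move=> /andP[h1 h2]; rewrite /clamp (min_idPl h2); apply/max_idPr. Qed.

(* All the nodes that enter the difference lie within distance 2 of both points. *)
Lemma pl_clamp_lip_ord X Y a b : 0 <= b -> X <= Y -> Y < X + 1 ->
  (forall i : 'I_N.+2, `|X - i%:R| <= 2 -> `|Y - i%:R| <= 2 -> (c i - a) ^+ 2 <= b) ->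
  (pl (clamp X) - pl (clamp Y)) ^+ 2 <= 4 * b * (Y - X) ^+ 2.
Proof.
move=> b0 XY YX h.
have triv : 0 <= 4 * b * (Y - X) ^+ 2 by apply: mulr_ge0; [exact: mulr_ge0|exact: sqr_ge0].
have N1 : 1 <= N.+1%:R :> R by rewrite ler1n.
have mono s t : 0 <= s -> s <= t -> 4 * b * s ^+ 2 <= 4 * b * t ^+ 2.
  by move=> s0 st; rewrite ler_wpM2l ?mulr_ge0// ler_sqr// nnegrE// (le_trans s0).
have [X0|X0] := leP X 0.
  rewrite (clamp_low X0); have [Y0|Y0] := leP Y 0.
    by rewrite (clamp_low Y0) subrr expr0n.
  rewrite (@clamp_id Y); last by apply/andP; split; lra.
  apply: le_trans (pl_lip (a := a) (b := b) _ _ _ _ _) _; try lra.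
    move=> i /andP[i1 i2]; have i0 : 0 <= i%:R :> R by [].
    have i3 : i%:R <= 1 :> R.
      by rewrite -[leRHS]/(1%:R) ler_nat -ltnS -(ltr_nat R); lra.
    by apply: h; rewrite ler_norml; apply/andP; split; lra.
  by apply: mono; lra.
have [XN|XN] := leP N.+1%:R X.
  by rewrite !clamp_high ?subrr ?expr0n// (le_trans XN).
rewrite (@clamp_id X); last by rewrite !ltW.
have [YN|YN] := leP N.+1%:R Y; last first.
  rewrite (@clamp_id Y); last by apply/andP; split; lra.
  apply: pl_lip; try lra; move=> i /andP[i1 i2].
  by apply: h; rewrite ler_norml; apply/andP; split; lra.
rewrite (clamp_high YN); apply: le_trans (pl_lip (a := a) (b := b) _ _ _ _ _) _; try lra.
  move=> i /andP[i1 i2]; have iN : i%:R <= N.+1%:R :> R by rewrite ler_nat -ltnS.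
  have i3 : N%:R <= i%:R :> R.
    by rewrite ler_nat -ltnS -(ltr_nat R) -(ltrD2r 1) natr1 -natr1; rewrite -natr1 in XN YN *; lra.
  rewrite -natr1 in iN YN XN.
  by apply: h; rewrite ler_norml; apply/andP; split; lra.
by apply: mono; lra.
Qed.

Lemma pl_clamp_lip X Y a b : 0 <= b -> `|X - Y| < 1 ->
  (forall i : 'I_N.+2, `|X - i%:R| <= 2 -> (c i - a) ^+ 2 <= b) ->
  (pl (clamp X) - pl (clamp Y)) ^+ 2 <= 4 * b * (X - Y) ^+ 2.
Proof.
rewrite ltr_norml => b0 /andP[h1 h2] h; have [XY|/ltW XY] := leP X Y.
  rewrite -[X in _ * X]sqrrN opprB; apply: (@pl_clamp_lip_ord _ _ a) => //; first lra.
  by move=> i hX _; exact: h.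
rewrite -sqrrN opprB; apply: (@pl_clamp_lip_ord _ _ a) => //; first lra.
by move=> i _ hY; exact: h.
Qed.
End PiecewiseLinear.

(** * The quasi-interpolant and its stability *)

Section QuasiInterpolation.
Context {R : realType}.
Local Notation mu := (@lebesgue_measure R).
Implicit Types (x y z : R) (u v : R -> R).
Variables (L : R) (N : nat) (delta : R).
Implicit Types (i : 'I_N.+2).
Local Notation h := (mesh L N).
Hypotheses (L0 : 0 < L) (hd : 4 * h < delta) (d1 : 2 * delta <= 1).

Let h0 : 0 < h := mesh_gt0 L0 N.
Let h40 : 0 < 4 * h. Proof. by rewrite mulr_gt0. Qed.
Let de0 : 0 < delta. Proof. exact: lt_trans hd. Qed.

(* The average at an interior or right node looks to the right, the one at 0 to
   the left, so that both boundary values vanish for functions supported in Omega. *)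
Definition wgt (i : 'I_N.+2) z : R :=
  if (0 < i)%N then oker (4 * h) delta (z - node L N i)
  else oker (4 * h) delta (node L N i - z).

Definition loglen : R := ln delta - ln (4 * h).

Definition coef u (i : 'I_N.+2) : R := avg (wgt i) loglen u.

Definition Qi u : R -> R := lin_comb (coef u) (hat0 L (N:=N)).

Lemma loglen_gt0 : 0 < loglen.
Proof. by rewrite subr_gt0 ltr_ln ?posrE. Qed.

Lemma wgt_ge0 i z : 0 <= wgt i z.
Proof. by rewrite /wgt; case: ifP => _; exact: oker_ge0. Qed.

Lemma oker_le t : oker (4 * h) delta t <= (4 * h)^-1.
Proof.
rewrite /oker; case: ifPn => [/andP[t1 t2]|_]; last by rewrite invr_ge0 ltW.
by rewrite ger0_norm ?lef_pV2 ?posrE//; [exact: lt_le_trans t1|apply: le_trans t1; exact: ltW].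
Qed.

Lemma wgt_le i z : wgt i z <= (4 * h)^-1.
Proof. by rewrite /wgt; case: ifP => _; exact: oker_le. Qed.

Lemma measurable_wgt i : measurable_fun setT (wgt i).
Proof.
rewrite /wgt; case: (0 < i)%N; apply: (measurableT_comp (measurable_oker _ _)).
  by apply: measurable_funB => //; exact: measurable_cst.
by apply: measurable_funB => //; exact: measurable_cst.
Qed.

Lemma integral_wgt i : (\int[mu]_z (wgt i z)%:E = loglen%:E)%E.
Proof.
rewrite /wgt; case: (0 < i)%N; first exact: integral_oker_right (ltW hd).
exact: integral_oker_left (ltW hd).
Qed.

Lemma wgt_le_ker i x z : `|x - node L N i| <= 2 * h ->
  wgt i z <= 2 * ker 0 (2 * delta) (x, z).
Proof.
rewrite ler_norml => /andP[x1 x2].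
have dd : 0 <= 2 * delta by rewrite mulr_ge0// ltW.
suff key (t : R) : `|z - node L N i| = `|t| -> oker (4 * h) delta t <= 2 * ker 0 (2 * delta) (x, z).
  by rewrite /wgt; case: ifP => _; apply: key => //; rewrite distrC.
move=> zt; rewrite /oker; case: ifPn => [/andP[t1 t2]|_]; last by rewrite mulr_ge0// ker_ge0.
have t0 : 0 < t := lt_le_trans h40 t1.
have hp : 0 < h := h0.
rewrite (gtr0_norm t0) in zt *.
have b1 : `|x - z| <= 2 * t.
  have := lexx `|z - node L N i|; rewrite {2}zt ler_norml => /andP[z1 z2].
  by rewrite ler_norml; apply/andP; split; lra.
have b2 : 0 < `|x - z|.
  rewrite normr_gt0 subr_eq0; apply/eqP => xz; move: zt; rewrite -xz => e.
  have : `|x - node L N i| <= 2 * h by rewrite ler_norml x1.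
  by rewrite e; lra.
rewrite /ker /= normr_ge0 /= ifT; last by lra.
by rewrite -ler_pdivrMl// -invfM lef_pV2 ?posrE// mulr_gt0.
Qed.

(** Energy density at x; the interpolation estimates hold pointwise in terms of it and are then
    integrated. *)
Definition localD u x : \bar R :=
  (\int[mu]_z ((u x - u z) ^+ 2 * ker 0 (2 * delta) (x, z))%:E)%E.

Lemma localD_ge0 u x : (0 <= localD u x)%E.
Proof. by apply: integral_ge0 => z _; rewrite lee_fin mulr_ge0 ?sqr_ge0 ?ker_ge0. Qed.

Lemma measurable_localD u : measurable_fun setT u -> measurable_fun setT (localD u).
Proof.
move=> mu_; apply: (measurable_fun_fubini_tonelli_F (m2 := mu) (fun z : R * R =>
  ((u z.1 - u z.2) ^+ 2 * ker 0 (2 * delta) z)%:E)).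
  by apply/measurable_EFinP; exact: measurable_Dq.
by move=> z; rewrite lee_fin mulr_ge0 ?sqr_ge0 ?ker_ge0.
Qed.

Lemma integral_localD u : measurable_fun setT u ->
  (\int[mu]_x localD u x = Dq 0 (2 * delta) u)%E.
Proof. by move=> mu_; rewrite Dq_iter. Qed.

Lemma measurable_localker u x : measurable_fun setT u ->
  measurable_fun setT (fun z => (u x - u z) ^+ 2 * ker 0 (2 * delta) (x, z)).
Proof.
move=> mu_; apply: measurable_funM.
  by apply: measurable_funX; apply: measurable_funB => //; exact: measurable_cst.
by apply: (measurableT_comp (measurable_ker _ _)).
Qed.

(** Jensen followed by [wgt_le_ker]. The logarithmic gain enters here, as the total mass [loglen] of
    the weight. *)
Lemma coef_dist u x i : L2 u -> `|x - node L N i| <= 2 * h ->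
  (((coef u i - u x) ^+ 2)%:E <= (2 / loglen)%:E * localD u x)%E.
Proof.
move=> hu hx; have mu_ : measurable_fun setT u by case: hu.
apply: le_trans (avg_dist (measurable_wgt i) (wgt_ge0 i) (wgt_le i) loglen_gt0 (integral_wgt i) (u x) hu) _.
rewrite (mulrC 2) EFinM -muleA; apply: lee_wpmul2l; first by rewrite lee_fin invr_ge0 ltW// loglen_gt0.
have m := measurable_localker x mu_.
rewrite -ge0_integralZl//; last 2 first.
- exact/measurable_EFinP.
- by move=> z _; rewrite lee_fin mulr_ge0 ?sqr_ge0 ?ker_ge0.
apply: ge0_le_integral => //.
- by move=> z _; rewrite lee_fin mulr_ge0 ?sqr_ge0 ?wgt_ge0.
- apply/measurable_EFinP; apply: measurable_funM; last exact: measurable_wgt.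
  by apply: measurable_funX; apply: measurable_funB => //; exact: measurable_cst.
- by apply/measurable_EFinP; apply: measurable_funM.
- move=> z _; rewrite -EFinM lee_fin -(sqrrN (u z - _)) opprB.
  by have := ler_wpM2l (sqr_ge0 (u x - u z)) (wgt_le_ker z hx); lra.
Qed.

Lemma coef_boundary u i : inH L u -> i = 0%N :> nat \/ i = N.+1 :> nat -> coef u i = 0.
Proof.
move=> [[mu_ _] u0 _] hi; have hp : 0 < 4 * h := h40.
rewrite /coef; apply: avg_ae0 => //; first exact: measurable_wgt.
apply: ae_S u0 => z hz; have [zO|zO] := boolP (0 < z < L); last first.
  by rewrite hz ?mul0r// /Omega/= in_itv/=; exact/negP.
rewrite (_ : wgt i z = 0) ?mulr0//; move/andP: zO => [z0 zL].
rewrite /wgt /oker; case: hi => ->.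
  by rewrite /= ifF// /node mul0r; apply/negbTE; rewrite negb_and -!ltNge; apply/orP; left; lra.
by rewrite /= node_max ifF//; apply/negbTE; rewrite negb_and -!ltNge; apply/orP; left; lra.
Qed.

Lemma Qi_pl u x : inH L u -> Qi u x = pl (coef u) (clamp N (x / h)).
Proof.
move=> hu; have c0 := coef_boundary hu.
have e0 : pl (coef u) 0 = 0.
  rewrite /pl (tri_sum (coef u) (leq0n N)) ?lexx ?ler01// !subr0 mulr0 addr0 mulr1.
  by apply: c0; left; rewrite inord_nat.
have e1 : pl (coef u) N.+1%:R = 0.
  rewrite /pl (tri_sum (coef u) (leqnn N)) ?lexx ?andbT ?ler_nat//.
  rewrite (c0 (inord N.+1)); last by right; rewrite inord_nat.
  by rewrite -natr1; ring.
rewrite /Qi lin_comb_hat0//; case: ifPn => [/andP[x0 xL]|].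
  by rewrite clamp_id// divr_ge0 ?(ltW x0) ?(ltW h0)//= -le_node// node_max ltW.
rewrite negb_and -!leNgt => /orP[x0|xL].
  by rewrite clamp_low ?e0// pmulr_lle0// invr_gt0.
by rewrite clamp_high ?e1// -node_le// node_max.
Qed.

Lemma scaled_dist x i : `|x / h - i%:R| <= 2 -> `|x - node L N i| <= 2 * h.
Proof.
by rewrite -node_scale// normrM (gtr0_norm (_ : 0 < h^-1)) ?invr_gt0// ler_pdivrMr.
Qed.

Lemma node_bound u x i : L2 u -> (localD u x < +oo)%E -> `|x / h - i%:R| <= 2 ->
  (coef u i - u x) ^+ 2 <= 2 / loglen * fine (localD u x).
Proof.
move=> hu fx /scaled_dist hi; rewrite -lee_fin.
apply: le_trans (coef_dist hu hi) _.
by rewrite -[in leLHS](@fineK _ (localD u x)) ?ge0_fin_numE ?localD_ge0.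
Qed.

Lemma Qi_L2 u : inH L u ->
  (normq (fun x => u x - Qi u x)%R <= (2 / loglen)%:E * Dq 0 (2 * delta) u)%E.
Proof.
move=> hu; have [[mu_ n2] u0 _] := hu; have l0 := loglen_gt0.
have mQ : measurable_fun setT (Qi u).
  by have [[]] := lin_comb_inH (coef u) (hat0_inH L0 (N:=N)).
have k0 : 0 <= 2 / loglen by rewrite divr_ge0// ltW.
rewrite -integral_localD// -ge0_integralZl//; last 2 first.
- exact: measurable_localD.
- by move=> x _; exact: localD_ge0.
apply: ae_ge0_le_integral => //.
- by move=> x _; rewrite lee_fin sqr_ge0.
- by apply/measurable_EFinP; exact: measurable_sqrB.
- by move=> x _; rewrite mule_ge0// localD_ge0.
- by apply: measurable_funeM; exact: measurable_localD.
- apply: ae_S u0 => x hx _; have [xO|xO] := boolP (0 < x < L); last first.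
    rewrite hx; last by rewrite /Omega/= in_itv/=; exact/negP.
    rewrite /Qi lin_comb_hat0// (negbTE xO) subrr expr0n/=.
    by rewrite mule_ge0// localD_ge0.
  have [fx|] := ltP (localD u x) +oo%E; last first.
    rewrite leye_eq => /eqP ->; rewrite gt0_muley ?leey// lte_fin divr_gt0//.
  rewrite -[localD u x]fineK ?ge0_fin_numE ?localD_ge0// -EFinM lee_fin.
  rewrite Qi_pl// -sqrrN opprB; apply: pl_near; first exact: clamp_itv.
  move=> i hi; apply: (node_bound (inH_L2 hu) fx).
  rewrite clamp_id in hi; first by apply: le_trans hi _; rewrite -[leRHS]natr1 lerDr.
  move/andP: xO => [x0 xL].
  by rewrite divr_ge0 ?(ltW x0) ?(ltW h0)//= -le_node// node_max ltW.
Qed.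

(** For |x - y| < h the Lipschitz bound gives (Qu(x) - Qu(y))^2 / |x - y| <= 4 b / h, where b = (2 /
    loglen) localD(x). Integration over an interval of length 2h leaves 8 b. *)
Lemma Qi_near u : inH L u ->
  (Dq 0 h (Qi u) <= (16 / loglen)%:E * Dq 0 (2 * delta) u)%E.
Proof.
move=> hu; have [[mu_ n2] u0 _] := hu; have l0 := loglen_gt0.
have mQ : measurable_fun setT (Qi u).
  by have [[]] := lin_comb_inH (coef u) (hat0_inH L0 (N:=N)).
have k0 : 0 <= 16 / loglen by rewrite divr_ge0// ltW.
rewrite Dq_iter// -integral_localD// -ge0_integralZl//; last 2 first.
- exact: measurable_localD.
- by move=> x _; exact: localD_ge0.
apply: ge0_le_integral => //.
- by move=> x _; apply: integral_ge0 => y _; rewrite lee_fin mulr_ge0 ?sqr_ge0 ?ker_ge0.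
- apply: (measurable_fun_fubini_tonelli_F (m2 := mu) (fun z : R * R =>
    ((Qi u z.1 - Qi u z.2) ^+ 2 * ker 0 h z)%:E)).
    by apply/measurable_EFinP; exact: measurable_Dq.
  by move=> z; rewrite lee_fin mulr_ge0 ?sqr_ge0 ?ker_ge0.
- by apply: measurable_funeM; exact: measurable_localD.
move=> x _; have [fx|] := ltP (localD u x) +oo%E; last first.
  by rewrite leye_eq => /eqP ->; rewrite gt0_muley ?leey// lte_fin divr_gt0.
pose b := 2 / loglen * fine (localD u x).
have b0 : 0 <= b by rewrite mulr_ge0 ?divr_ge0 ?fine_ge0 ?localD_ge0// ltW.
have q0 : 0 <= 4 * b / h by rewrite divr_ge0 ?(ltW h0)// mulr_ge0.
pose J : set (measurableTypeR R) := `](x - h), (x + h)[%classic.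
have mJ : measurable J by exact: measurable_itv.
apply: (@le_trans _ _ (\int[mu]_y ((4 * b / h)%:E * (\1_J y)%:E))%E).
  apply: ge0_le_integral => //.
  - by move=> y _; rewrite lee_fin mulr_ge0 ?sqr_ge0 ?ker_ge0.
  - apply/measurable_EFinP; apply: measurable_funM.
      by apply: measurable_funX; apply: measurable_funB => //; exact: measurable_cst.
    by apply: (measurableT_comp (measurable_ker _ _)).
  - by apply/measurable_EFinP; apply: measurable_funM => //; exact: measurable_indic.
  move=> y _; rewrite -EFinM lee_fin indicE mem_setE in_itv/= /ker /= normr_ge0 /=.
  have -> : (x - h < y < x + h) = (`|x - y| < h).
    by rewrite ltr_norml; apply/idP/idP; lra.
  case: ifPn => hxy; last by rewrite !mulr0.
  rewrite mulr1 !Qi_pl//.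
  have XY : `|x / h - y / h| < 1.
    by rewrite -mulrBl normrM (gtr0_norm (_ : 0 < h^-1)) ?invr_gt0// ltr_pdivrMr ?mul1r.
  have := @pl_clamp_lip _ N (coef u) _ _ (u x) _ b0 XY.
  move=> /(_ (fun i => node_bound (inH_L2 hu) fx)).
  move=> /(ler_wpM2r (_ : 0 <= `|x - y|^-1)); rewrite invr_ge0 => /(_ (normr_ge0 _)) hh.
  apply: le_trans hh _.
  have [->|xy] := eqVneq x y.
    by rewrite !subrr normr0 invr0 mulr0.
  have d0 : 0 < `|x - y| by rewrite normr_gt0 subr_eq0.
  rewrite -mulrBl exprMn -[(x - y) ^+ 2]real_normK ?num_real//.
  rewrite (_ : _ / `|x - y| = 4 * b / h * (`|x - y| / h)); last first.
    by field; rewrite gt_eqF//= gt_eqF.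
  by rewrite ler_piMr// ler_pdivrMr// mul1r ltW.
rewrite ge0_integralZl//; last by apply/measurable_EFinP; exact: measurable_indic.
rewrite integral_indic// setIT [X in (_ * X)%E](@lebesgue_measure_itv R `](x - h), (x + h)[)/=.
have hp : 0 < h := h0; rewrite lte_fin ifT; last by lra.
rewrite -[localD u x]fineK ?ge0_fin_numE ?localD_ge0// -EFinB -!EFinM lee_fin /b.
rewrite le_eqVlt; apply/orP; left; apply/eqP.
by field; rewrite gt_eqF//= gt_eqF.
Qed.

(** The energy is cut at distance h: below, u and its interpolant are estimated separately; above,
    the factor -8 ln h of [Dq_le_normq] meets the 2 / loglen of [Qi_L2]. *)
Lemma Qi_H u : inH L u -> h <= 1 ->
  (Dq 0 1 (fun x => u x - Qi u x)%R <=
    (2 + 32 / loglen - 16 * ln h / loglen)%:E * Dq 0 (2 * delta) u)%E.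
Proof.
move=> hu h1; have [[mu_ n2] u0 _] := hu; have l0 := loglen_gt0.
have mQ : measurable_fun setT (Qi u).
  by have [[]] := lin_comb_inH (coef u) (hat0_inH L0 (N:=N)).
rewrite (Dq_split (b := h)) ?(ltW h0)//; last exact: measurable_funB.
set D := Dq 0 (2 * delta) u; have D0 : (0 <= D)%E := Dq_ge0 _ _ _.
have k1 : 0 <= 32 / loglen by rewrite divr_ge0// ltW.
have lh : 0 <= - ln h by rewrite oppr_ge0 ln_le0.
have k2 : 0 <= - (16 * ln h / loglen).
  by rewrite (_ : - _ = 16 * (- ln h) / loglen); [rewrite divr_ge0 ?mulr_ge0// ltW|ring].
rewrite EFinD ge0_muleDl; last 2 first.
- by rewrite lee_fin addr_ge0.
- by rewrite lee_fin.
apply: leeD.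
  rewrite EFinD ge0_muleDl ?lee_fin//.
  have -> : (fun x => u x - Qi u x) = (fun x => u x + (-1) * Qi u x).
    by apply/funext => x; rewrite mulN1r.
  apply: le_trans (le_DqD _ _ mu_ _) _; first exact: measurable_funM.
  apply: leeD.
    have hp : 0 < h := h0; have hq : 4 * h < delta := hd.
    apply: lee_wpmul2l => //; apply: le_Dq => //.
    lra.
  rewrite DqZ// sqrrN expr1n mul1e.
  apply: (@le_trans _ _ (2%:E * ((16 / loglen)%:E * D))%E).
    by apply: lee_wpmul2l => //; exact: Qi_near.
  by rewrite muleA -EFinM; apply: lee_wpmul2r => //; rewrite lee_fin le_eqVlt; apply/orP; left; apply/eqP; ring.
apply: le_trans (Dq_le_normq _ h0 h1) _; first exact: measurable_funB.
rewrite ln1 sub0r.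
apply: (@le_trans _ _ ((8 * - ln h)%:E * ((2 / loglen)%:E * D))%E).
  by apply: lee_wpmul2l; [rewrite lee_fin mulr_ge0|exact: Qi_L2].
rewrite muleA -EFinM; apply: lee_wpmul2r => //; rewrite lee_fin.
by rewrite le_eqVlt; apply/orP; left; apply/eqP; ring.
Qed.

Lemma coef_le u i : L2 u -> coef u i ^+ 2 <= (4 * h)^-1 / loglen * dot u u.
Proof.
exact: (avg_le (measurable_wgt i) (wgt_ge0 i) (wgt_le i) loglen_gt0 (integral_wgt i)).
Qed.

Lemma coefB u v i : L2 u -> L2 v -> coef (fun x => u x - v x) i = coef u i - coef v i.
Proof.
exact: (avgB (measurable_wgt i) (wgt_ge0 i) (wgt_le i) (integral_wgt i)).
Qed.

Lemma QiB u v x : L2 u -> L2 v -> Qi u x - Qi v x = Qi (fun x => u x - v x) x.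
Proof.
move=> hu hv; rewrite /Qi /lin_comb -sumrB; apply: eq_bigr => i _.
by rewrite coefB// mulrBl.
Qed.

Lemma Qi_bound u e : (forall i, coef u i ^+ 2 <= e) ->
  (normq (Qi u) <= (L * e)%:E)%E.
Proof.
move=> he; have e0 : 0 <= e by apply: le_trans (he ord0); exact: sqr_ge0.
have mQ : measurable_fun setT (Qi u).
  by have [[]] := lin_comb_inH (coef u) (hat0_inH L0 (N:=N)).
have mO : measurable (Omega L : set (measurableTypeR R)) by exact: measurable_itv.
apply: (@le_trans _ _ (\int[mu]_x (e%:E * (\1_(Omega L) x)%:E))%E).
  apply: ge0_le_integral => //.
  - by move=> x _; rewrite lee_fin sqr_ge0.
  - by apply/measurable_EFinP; exact: measurable_funX.
  - by apply/measurable_EFinP; apply: measurable_funM => //; exact: measurable_indic.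
  move=> x _; rewrite -EFinM lee_fin indicE mem_setE in_itv/=.
  rewrite /Qi lin_comb_hat0//; case: ifPn => [/andP[x0 xL]|_]; last by rewrite expr0n/= mulr0.
  rewrite mulr1 -[X in X ^+ 2]subr0; apply: pl_near => [|i _]; last by rewrite subr0.
  by rewrite divr_ge0 ?(ltW x0) ?(ltW h0)//= -le_node// node_max ltW.
rewrite ge0_integralZl//; last by apply/measurable_EFinP; exact: measurable_indic.
rewrite integral_indic// setIT [X in (_ * X)%E](@lebesgue_measure_itv R `]0, L[)/=.
by rewrite lte_fin L0 oppr0 adde0 -EFinM mulrC.
Qed.
End QuasiInterpolation.

(** * Density of the discrete spaces, and compactness *)

Section Approximation.
Context {R : realType}.
Local Notation mu := (@lebesgue_measure R).
Implicit Types (u v : R -> R).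
Variables (L : R) (L0 : 0 < L).

Lemma mesh_small (e : R) : 0 < e -> exists N0, forall N, (N0 <= N)%N -> mesh L N <= e.
Proof.
move=> e0; exists (Num.truncn (L / e)) => N hN.
rewrite /mesh ler_pdivrMr// mulrC -ler_pdivrMr//.
have /andP[_ h] := truncn_itv (ltW (divr_gt0 L0 e0)).
by rewrite (le_trans (ltW h))// ler_nat ltnS.
Qed.

(** With K bounding |ln 4 - ln delta|, the mass [loglen] is at least -ln h - K. The threshold -ln h
    >= 2 K + T makes this at least T and at least half of -ln h. *)
Lemma mesh_regime (delta T : R) : 0 < delta -> 1 <= T -> exists N0, forall N, (N0 <= N)%N ->
  [/\ 4 * mesh L N < delta, mesh L N <= 1, T <= loglen L N delta &
      - ln (mesh L N) <= 2 * loglen L N delta].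
Proof.
move=> d0 T1; pose K := `|ln 4 - ln delta|.
have K0 : 0 <= K := normr_ge0 _.
have [N0 hN] := mesh_small (expR_gt0 (- (2 * K + T))).
exists N0 => N /hN hle; have h0 := mesh_gt0 L0 N.
have lnh : ln (mesh L N) <= - (2 * K + T).
  by rewrite -[leRHS]expRK ler_ln ?posrE// expR_gt0.
have l4 : ln (4 * mesh L N) = ln 4 + ln (mesh L N) by rewrite lnM ?posrE.
have Kle : ln 4 - ln delta <= K := ler_norm _.
have ll : T <= loglen L N delta by rewrite /loglen l4; lra.
have b4 : 4 * mesh L N < delta.
  rewrite -ltr_ln ?posrE ?mulr_gt0//.
  by move: ll; rewrite /loglen; lra.
split=> //.
  by rewrite -ler_ln ?posrE// ln1; lra.
by rewrite /loglen l4; lra.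
Qed.

Lemma Vh_dense u e : inH L u -> 0 < e -> exists N0, forall N, (N0 <= N)%N ->
  exists c : 'I_N.+2 -> R,
    (normq (fun x => u x - lin_comb c (hat0 L (N:=N)) x)%R <= e%:E)%E /\
    (Dq 0 1 (fun x => u x - lin_comb c (hat0 L (N:=N)) x)%R <= e%:E)%E.
Proof.
move=> hu e0; have [[mu_ n2] u0 Du] := hu.
(* With delta = a/2 the energy in [Qi_H] is the one below distance a, and its constant is at most 2
   + 32 + 32 = 66 < 100. *)
have e1 : 0 < e / 100 by rewrite divr_gt0.
have [a /andP[a0 a1] Da] := Dq_small mu_ Du e1.
have d0 : 0 < a / 2 by rewrite divr_gt0.
have [N0 hN] := mesh_regime d0 (lexx 1); exists N0 => N /hN[h1 h2 h3 h4].
have aE : 2 * (a / 2) = a by rewrite mulrC divfK.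
have ad : 2 * (a / 2) <= 1 by rewrite aE ltW.
have l0 : 0 < loglen L N (a / 2) by lra.
exists (coef L (N:=N) (a / 2) u); split.
  have := Qi_L2 L0 h1 hu; rewrite aE => /le_trans; apply.
  apply: (@le_trans _ _ ((2:R)%:E * (e / 100)%:E)%E); last by rewrite -EFinM lee_fin; lra.
  apply: le_trans (lee_wpmul2r _ _) _; last by apply: lee_wpmul2l => //; exact: Da.
    exact: Dq_ge0.
  by rewrite lee_fin ler_pdivrMr//; lra.
have := Qi_H L0 h1 hu h2; rewrite aE => /le_trans; apply.
apply: (@le_trans _ _ ((66:R)%:E * (e / 100)%:E)%E); last by rewrite -EFinM lee_fin; lra.
apply: le_trans (lee_wpmul2r _ _) _; last by apply: lee_wpmul2l => //; exact: Da.
  exact: Dq_ge0.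
rewrite lee_fin -mulrN1 -!mulrA.
have q1 : 32 / loglen L N (a / 2) <= 32 by rewrite ler_pdivrMr//; lra.
have q2 : - (16 * ln (mesh L N)) / loglen L N (a / 2) <= 32 by rewrite ler_pdivrMr//; lra.
lra.
Qed.

Lemma ultra_bounded_cvg (F : set_system nat) {UF : UltraFilter F} (a : nat -> R) (C : R) :
  F [set i | `|a i| <= C] -> exists l : R, a i @[i --> F] --> l.
Proof.
move=> Fa.
have FI : F (a @^-1` `[(- C), C]%classic).
  by apply: filterS Fa => i /=; rewrite in_itv/= ler_norml.
have [l [_ hl]] := @segment_compact R (- C) C _ (fmap_proper_filter a _) FI.
(* An ultrafilter converges to each of its cluster points. *)
exists l => B nB; have [//|nF] := in_ultra_setVsetC (a @^-1` B) UF.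
by have [x [/= ? ?]] := hl (~` B) B nF nB.
Qed.

(** One mesh is fixed for the given tolerance. The interpolants on it are determined by finitely
    many bounded coefficients, which converge along the ultrafilter; hence the sequence is Cauchy
    along it, and completeness applies. *)
Lemma H_precompact (F : set_system nat) {UF : UltraFilter F} (u : nat -> R -> R) (M : R) :
  (forall i, inH L (u i)) -> 0 <= M ->
  F [set i | dot (u i) (u i) <= 1 /\ Dd 0 1 (u i) (u i) <= M] ->
  exists w, inH L w /\
    forall e, 0 < e -> F [set i | (normq (fun x => w x - u i x)%R <= e%:E)%E].
Proof.
move=> hu M0 FM.
apply: (@H_complete R F _ L u M L0 hu); first by apply: filterS FM => i [].
move=> e e0.
(* This lower bound on [loglen] makes the interpolation error 2 M / loglen at most e/12; delta = 1/2
   is taken because then 2 delta = 1 covers the whole near form. *)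
have T1 : 1 <= 24 * M / e + 1 by rewrite lerDr divr_ge0 ?mulr_ge0// ltW.
have d0 : 0 < 2^-1 :> R by rewrite invr_gt0.
have [N hN] := mesh_regime d0 T1; have [h1 h2 h3 h4] := hN N (leqnn N).
have dE : 2 * 2^-1 = 1 :> R by rewrite mulfV.
set l := loglen L N 2^-1 in h3 h4; have l0 : 0 < l by lra.
have QL i : Dd 0 1 (u i) (u i) <= M ->
    (normq (fun x => u i x - Qi L N 2^-1 (u i) x)%R <= (e / 12)%:E)%E.
  move=> hM; have := Qi_L2 L0 h1 (hu i); rewrite dE => /le_trans; apply.
  rewrite (Dd_fin (lexx 0) (lexx 1) (hu i)) -EFinM lee_fin -/l.
  apply: (@le_trans _ _ (2 / l * M)); first by rewrite ler_wpM2l// divr_ge0// ltW.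
  rewrite mulrAC ler_pdivrMr//.
  have : e * (24 * M / e + 1) <= e * l by rewrite ler_wpM2l// ltW.
  rewrite mulrDr mulrCA mulfV ?gt_eqF//; lra.
pose C := Num.sqrt ((4 * mesh L N)^-1 / l).
have bc k i : dot (u i) (u i) <= 1 -> `|coef L (N:=N) 2^-1 (u i) k| <= C.
  move=> hd; have k0 : 0 <= (4 * mesh L N)^-1 / l.
    by rewrite divr_ge0 ?invr_ge0 ?mulr_ge0// ltW// mesh_gt0.
  rewrite -sqrtr_sqr ler_sqrt//; apply: le_trans (coef_le L0 h1 k (inH_L2 (hu i))) _.
  by rewrite -/l ler_piMr.
have cl k : exists r : R, coef L (N:=N) 2^-1 (u i) k @[i --> F] --> r.
  by apply: (@ultra_bounded_cvg F UF _ C); apply: filterS FM => i /= [hd _]; exact: bc.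
have /choice[r hr] := cl.
(* Two coefficients within eta of their limit differ by at most 2 eta, so the interpolants differ by
   4 L eta^2 = e/8. The total is 2 e/12 + 2 (2 e/8 + 2 e/12) = e. *)
pose eta := Num.sqrt (e / (32 * L)).
have eta0 : 0 < eta by rewrite sqrtr_gt0 divr_gt0// mulr_gt0.
have Fr : F [set i | forall k, `|r k - coef L (N:=N) 2^-1 (u i) k| <= eta].
  apply: filter_forall => k; move/cvgrPdist_le : (hr k); exact.
exists ([set i | dot (u i) (u i) <= 1 /\ Dd 0 1 (u i) (u i) <= M] `&`
        [set i | forall k, `|r k - coef L (N:=N) 2^-1 (u i) k| <= eta]).
  exact: filterI.
move=> i j [[_ Mi] ri] [[_ Mj] rj].
have Qin k : inH L (Qi L N 2^-1 (u k)) := lin_comb_inH _ (hat0_inH L0 (N:=N)).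
have LQ k := inH_L2 (Qin k); have Lu k := inH_L2 (hu k).
apply: le_trans (le_normqB (Lu i) (LQ i) (Lu j)) _.
apply: (@le_trans _ _ (2%:E * (e / 12)%:E + 2%:E * (2%:E * (e / 8)%:E + 2%:E * (e / 12)%:E))%E).
  apply: leeD; first by apply: lee_wpmul2l => //; exact: QL.
  apply: lee_wpmul2l => //; apply: le_trans (le_normqB (LQ i) (LQ j) (Lu j)) _.
  apply: leeD; apply: lee_wpmul2l => //; last by rewrite normqBC; exact: QL.
  have -> : (fun x => Qi L N 2^-1 (u i) x - Qi L N 2^-1 (u j) x) =
      Qi L N 2^-1 (fun x => u i x - u j x).
    by apply/funext => x; rewrite QiB.
  apply: (@le_trans _ _ (L * (4 * eta ^+ 2))%:E).
    apply: Qi_bound => // k; rewrite coefB//.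
    have := ri k; have := rj k; rewrite !ler_norml => /andP[? ?] /andP[? ?].
    nra.
  rewrite lee_fin sqr_sqrtr; last by rewrite divr_ge0 ?mulr_ge0// ltW.
  by rewrite le_eqVlt; apply/orP; left; apply/eqP; field; rewrite gt_eqF.
rewrite -[leLHS]/((2 * (e / 12) + 2 * (2 * (e / 8) + 2 * (e / 12)))%:E) lee_fin; lra.
Qed.
End Approximation.

(** * Symmetric matrix pencils *)

Section SimultaneousDiagonalization.
Context {R : realType}.

Lemma nontrivial_kernel m n (G : 'M[R]_(m, n)) : (n < m)%N ->
  exists2 x : 'rV_m, x != 0 & x *m G = 0.
Proof.
move=> nm; exists (nz_row (kermx G)); last by apply/sub_kermxP; exact: nz_row_sub.
rewrite nz_row_eq0 kermx_eq0; apply: contraTN nm => /eqP rG.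
by rewrite -leqNgt -rG rank_leq_col.
Qed.

Variable n : nat.
Implicit Types (M A B : 'M[R]_n.+1) (x y z : 'rV[R]_n.+1).

Definition bil M x y : R := (x *m M *m y^T) 0 0.

Lemma bilDl M x y z : bil M (x + y) z = bil M x z + bil M y z.
Proof. by rewrite /bil !mulmxDl mxE. Qed.

Lemma bilZl M (a : R) x z : bil M (a *: x) z = a * bil M x z.
Proof. by rewrite /bil -!scalemxAl mxE. Qed.

Lemma bilDr M x y z : bil M z (x + y) = bil M z x + bil M z y.
Proof. by rewrite /bil linearD /= mulmxDr mxE. Qed.

Lemma bilZr M (a : R) x z : bil M z (a *: x) = a * bil M z x.
Proof. by rewrite /bil linearZ /= -scalemxAr mxE. Qed.

Lemma bilC M x y : M^T = M -> bil M x y = bil M y x.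
Proof.
move=> sM; rewrite /bil -[in LHS](trmxK (x *m M *m y^T)) [LHS]mxE.
by rewrite !trmx_mul trmxK sM mulmxA.
Qed.

Lemma bil0r M x : bil M x 0 = 0.
Proof. by rewrite -(scale0r (0 : 'rV[R]_n.+1)) bilZr mul0r. Qed.

Lemma bilBr M x y z : bil M z (x - y) = bil M z x - bil M z y.
Proof. by have := bilDr M (x - y) y z; rewrite subrK => ->; rewrite addrK. Qed.

Lemma bil_sumr M x k (F : 'I_k -> 'rV[R]_n.+1) :
  bil M x (\sum_(i < k) F i) = \sum_(i < k) bil M x (F i).
Proof. by apply: (big_morph _ (fun y z => bilDr M y z x) (bil0r M x)). Qed.

Lemma bilE M x y : bil M x y = \sum_j (\sum_i x 0 i * M i j) * y 0 j.
Proof.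
by rewrite /bil mxE; apply: eq_bigr => j _; rewrite !mxE.
Qed.

Lemma continuous_sum_fun (T : topologicalType) k (F : 'I_k -> T -> R) :
  (forall i, continuous (F i)) -> continuous (fun t : T => \sum_(i < k) F i t).
Proof. by move=> cF; apply: continuous_big => [|i _]; [exact: add_continuous|exact: cF]. Qed.

Lemma bil_diag_continuous M : continuous (fun x => bil M x x).
Proof.
have -> : (fun x => bil M x x) = (fun x => \sum_j (\sum_i x 0 i * M i j) * x 0 j).
  by apply/funext => x; rewrite bilE.
have c j : continuous (fun x : 'rV[R]_n.+1 => \sum_i x 0 i * M i j).
  apply: (@continuous_sum_fun _ _ (fun i (x : 'rV[R]_n.+1) => x 0 i * M i j)) => i x.
  by apply: cvgMl; [exact: nbhs_filter|exact: coord_continuous].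
apply: (@continuous_sum_fun _ _ (fun j (x : 'rV[R]_n.+1) => (\sum_i x 0 i * M i j) * x 0 j)) => j x.
by apply: cvgM; [exact: nbhs_filter|exact: c|exact: coord_continuous].
Qed.

Lemma bil_continuous M y : continuous (fun x => bil M y x).
Proof.
have -> : (fun x => bil M y x) = (fun x => \sum_j (\sum_i y 0 i * M i j) * x 0 j).
  by apply/funext => x; rewrite bilE.
apply: (@continuous_sum_fun _ _ (fun j (x : 'rV[R]_n.+1) => (\sum_i y 0 i * M i j) * x 0 j)) => j x.
by apply: cvgMr; [exact: nbhs_filter|exact: coord_continuous].
Qed.

Variables (A B : 'M[R]_n.+1).
Hypotheses (sA : A^T = A) (sB : B^T = B)
  (pB : forall x, x != 0 -> 0 < bil B x x).

(** A partial diagonalisation by the first k vectors. The last clause keeps each chosen value below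
    every Rayleigh quotient on the orthogonal complement of all k vectors, so the list stays sorted
    when it is extended. *)
Definition eigen_system k (p : nat -> 'rV[R]_n.+1) (s : nat -> R) :=
  [/\ forall i j, (i < k)%N -> (j < k)%N -> bil B (p i) (p j) = (i == j)%:R,
      forall i y, (i < k)%N -> bil A (p i) y = s i * bil B (p i) y,
      forall i j, (i <= j)%N -> (j < k)%N -> s i <= s j &
      forall i y, (i < k)%N -> (forall j, (j < k)%N -> bil B (p j) y = 0) ->
        s i * bil B y y <= bil A y y].

(* Courant's minimisation: the next eigenvector minimises the Rayleigh quotient
   on the orthogonal complement of the previous ones. *)
Lemma rayleigh_min k (p : nat -> 'rV[R]_n.+1) : (k < n.+1)%N ->
  exists x, [/\ x != 0, forall j, (j < k)%N -> bil B (p j) x = 0 &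
    forall y, (forall j, (j < k)%N -> bil B (p j) y = 0) ->
      bil A x x / bil B x x * bil B y y <= bil A y y].
Proof.
move=> kn; pose f x := bil A x x / bil B x x.
(* Compactness is taken from the unit sphere of the ambient norm; the quotient is homogeneous of
   degree 0, so this normalisation is as good as that by B. *)
pose S := [set x : 'rV[R]_n.+1 | `|x| = 1] `&`
  \bigcap_(j in `I_k) [set x | bil B (p j) x = 0].
have S0 : S !=set0.
  pose G : 'M[R]_(n.+1, k) := \matrix_(i, j) (B *m (p j)^T) i 0.
  have [x x0 xG] := nontrivial_kernel G kn.
  have x1 : `|x| != 0 by rewrite normr_eq0.
  exists (`|x|^-1 *: x); split.
    by rewrite /= normrZ normfV normr_id mulVf.
  move=> j /= jk; rewrite bilZr bilC//.
  suff -> : bil B x (p j) = (x *m G) 0 (Ordinal jk) by rewrite xG mxE mulr0.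
  rewrite /bil -mulmxA [LHS]mxE [RHS]mxE; apply: eq_bigr => i _.
  by rewrite [in RHS]mxE.
have cS : compact S.
  apply: bounded_closed_compact.
    exists 1; split => // r r1 x [/= -> _]; exact: ltW.
  apply: closedI.
    apply: (@preimage_closed _ _ (fun x : 'rV[R]_n.+1 => `|x|) [set 1]); last exact: closed_eq.
    by move=> x _; exact: norm_continuous.
  apply: closed_bigI => j _.
  apply: (@preimage_closed _ _ (fun x => bil B (p j) x) [set 0]); last exact: closed_eq.
  by move=> x _; exact: bil_continuous.
have Sn0 x : S x -> x != 0.
  by move=> [/= x1 _]; rewrite -normr_eq0 x1 oner_eq0.
have cf : {within S, continuous f}.
  apply: continuous_in_subspaceT => x; rewrite inE => /Sn0 x0.
  apply: cvgM; [exact: nbhs_filter|exact: bil_diag_continuous|].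
  apply: cvgV; [exact: nbhs_filter|by rewrite gt_eqF// pB|exact: bil_diag_continuous].
have [x xS xmin] := compact_EVT_min S0 cS cf.
rewrite inE in xS; exists x; split; [exact: Sn0|by move=> j jk; exact: xS.2|].
move=> y hy; have [->|y0] := eqVneq y 0; first by rewrite !bil0r mulr0.
have y1 : `|y| != 0 by rewrite normr_eq0.
have yS : `|y|^-1 *: y \in S.
  rewrite inE; split; first by rewrite /= normrZ normfV normr_id mulVf.
  by move=> j /= jk; rewrite bilZr hy// mulr0.
have := xmin _ yS; rewrite {2}/f !bilZr !bilZl.
have bn : bil B y y != 0 by rewrite gt_eqF// pB.
rewrite (_ : _ / _ = bil A y y / bil B y y); last by field; rewrite bn y1.
by rewrite ler_pdivlMr ?pB.
Qed.

(** First-order condition at a minimum: the discriminant with zero constant term. *)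
Lemma linear_term_zero (a b : R) : (forall t, 0 <= 2 * t * a + t ^+ 2 * b) -> a = 0.
Proof.
move=> h; have := @discriminant_le R 0 a b _; rewrite mul0r => hh.
have /hh : forall t, 0 <= 0 + 2 * a * t + b * t ^+ 2 by move=> t; have := h t; lra.
by rewrite -[X in _ <= X]/(0) => h0; apply/eqP; rewrite -sqrf_eq0 eq_le h0 sqr_ge0.
Qed.

Lemma eigen_step k p s : (k < n.+1)%N -> eigen_system k p s ->
  exists p' s', eigen_system k.+1 p' s'.
Proof.
move=> kn [po pe ps pm]; have [x [x0 xo xm]] := rayleigh_min p kn.
pose m := bil A x x / bil B x x; have bx := pB x0.
have Axx : bil A x x = m * bil B x x by rewrite /m divfK// gt_eqF.
have sm i : (i < k)%N -> s i <= m by move=> ik; rewrite /m ler_pdivlMr// pm.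
(* Euler-Lagrange equation, for variations orthogonal to the earlier vectors. *)
have xe0 y : (forall j, (j < k)%N -> bil B (p j) y = 0) -> bil A x y = m * bil B x y.
  move=> hy; apply/eqP; rewrite -subr_eq0; apply/eqP.
  apply: (@linear_term_zero _ (bil A y y - m * bil B y y)) => t.
  have hx j : (j < k)%N -> bil B (p j) (x + t *: y) = 0.
    by move=> jk; rewrite bilDr bilZr xo// hy// mulr0 addr0.
  have := xm _ hx; rewrite -/m.
  rewrite !bilDl !bilDr !bilZl !bilZr (bilC y x sA) (bilC y x sB) Axx.
  by move=> h; lra.
(* In the direction of an earlier vector both sides vanish, because that vector is an eigenvector
   orthogonal to x. *)
have xe y : bil A x y = m * bil B x y.
  pose y' := y - \sum_(i < k) bil B (p i) y *: p i.
  have ey : y = y' + \sum_(i < k) bil B (p i) y *: p i by rewrite subrK.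
  have oy j : (j < k)%N -> bil B (p j) y' = 0.
    move=> jk; rewrite /y' bilBr bil_sumr.
    rewrite (bigD1 (Ordinal jk))//= bilZr po// eqxx mulr1 big1 ?addr0 ?subrr//.
    move=> i /eqP ij; rewrite bilZr po// (_ : (j == i) = false) ?mulr0//.
    by apply/eqP => e; apply: ij; apply/val_inj.
  rewrite ey; clearbody y'; rewrite !bilDr !bil_sumr (xe0 _ oy).
  rewrite !big1 ?addr0// => i _; rewrite bilZr.
    by rewrite (bilC x _ sB) xo ?mulr0.
  by rewrite (bilC x _ sA) pe// xo// !mulr0.
have q0 : 0 < Num.sqrt (bil B x x) by rewrite sqrtr_gt0.
pose v := (Num.sqrt (bil B x x))^-1 *: x.
have vv : bil B v v = 1.
  rewrite /v bilZl bilZr mulrA -invfM -expr2 sqr_sqrtr ?ltW// mulVf// gt_eqF//.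
have vo j : (j < k)%N -> bil B (p j) v = 0 by move=> jk; rewrite /v bilZr xo// mulr0.
pose p' i := if i == k then v else p i; pose s' i := if i == k then m else s i.
exists p', s'; split.
- move=> i j; rewrite !ltnS /p' => ik jk.
  case: (ltngtP i k) ik => // [ik|eik] _; case: (ltngtP j k) jk => // [jk|ejk] _.
  + exact: po.
  + by rewrite vo// ejk ltn_eqF.
  + by rewrite bilC// vo// eik gtn_eqF.
  + by rewrite vv eik ejk eqxx.
- move=> i y; rewrite ltnS /p' /s' => ik; have [_|ni] := eqVneq i k.
    by rewrite /v !bilZl xe mulrCA.
  by rewrite pe// ltn_neqAle ni.
- move=> i j ij; rewrite ltnS /s' => jk; have [ejk|nj] := eqVneq j k.
    by have [//|ni] := eqVneq i k; apply: sm; rewrite ltn_neqAle ni (leq_trans ij jk).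
  have jk' : (j < k)%N by rewrite ltn_neqAle nj.
  have [e|ni] := eqVneq i k; first by move: ij; rewrite e leqNgt jk'.
  exact: ps.
- move=> i y; rewrite ltnS /s' => ik hy.
  have hy' j : (j < k)%N -> bil B (p j) y = 0.
    move=> jk; have := hy j (ltnW jk); rewrite /p' ifF//; exact: ltn_eqF.
  have [_|ni] := eqVneq i k; first exact: xm.
  by apply: pm => //; rewrite ltn_neqAle ni.
Qed.

Lemma eigen_system_exists k : (k <= n.+1)%N -> exists p s, eigen_system k p s.
Proof.
elim: k => [|k IH] kn; first by exists (fun=> 0), (fun=> 0); split.
by have [p [s h]] := IH (ltnW kn); exact: eigen_step h.
Qed.

Lemma eigen_system_basis p s : eigen_system n.+1 p s ->
  let P := \matrix_(j < n.+1) p j in P *m (B *m P^T) = 1%:M.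
Proof.
move=> [po _ _ _] P; apply/matrixP => i j; rewrite mulmxA.
have := po i j (ltn_ord i) (ltn_ord j); rewrite /bil.
rewrite !mxE -[i == j]/(val i == val j) => <-; apply: eq_bigr => k _.
rewrite !mxE; congr (_ * _); apply: eq_bigr => l _; by rewrite !mxE.
Qed.

Lemma eigen_system_expand p s y : eigen_system n.+1 p s ->
  y = \sum_(j < n.+1) bil B y (p j) *: p j.
Proof.
move=> /eigen_system_basis/mulmx1C e; rewrite -[LHS]mulmx1 -e mulmxA mulmx_sum_row.
apply: eq_bigr => j _; rewrite rowK; congr (_ *: _).
by rewrite /bil mulmxA !mxE; apply: eq_bigr => k _; rewrite !mxE.
Qed.

(** Expansion in the full eigenbasis. Orthogonality to the vectors before i suffices, whereas the
    last clause of [eigen_system] asks for all of them. *)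
Lemma eigen_system_min p s i y : eigen_system n.+1 p s -> (i < n.+1)%N ->
  (forall j, (j < i)%N -> bil B (p j) y = 0) -> s i * bil B y y <= bil A y y.
Proof.
move=> h im hy; have ey := eigen_system_expand y h; have [po pe ps _] := h.
have -> : bil B y y = \sum_(j < n.+1) bil B y (p j) ^+ 2.
  by rewrite [X in bil B y X]ey bil_sumr; apply: eq_bigr => j _; rewrite bilZr.
have -> : bil A y y = \sum_(j < n.+1) s j * bil B y (p j) ^+ 2.
  rewrite [X in bil A y X]ey bil_sumr; apply: eq_bigr => j _.
  by rewrite bilZr (bilC y (p j) sA) pe// (bilC (p j) y sB); ring.
rewrite mulr_sumr; apply: ler_sum => j _.
have [ji|ij] := ltnP j i; last by rewrite ler_wpM2r ?sqr_ge0 ?ps.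
by rewrite (bilC y (p j) sB) hy// expr0n !mulr0.
Qed.

(** The rows of P are B-orthonormal eigenvectors, so [P^T] conjugates [invmx B *m A] to a diagonal
    matrix; the determinants are compared after cancelling that of [P^T]. *)
Lemma eigen_system_char_poly p s : eigen_system n.+1 p s ->
  char_poly (invmx B *m A) = \prod_(a <- [seq s j | j <- iota 0 n.+1]) ('X - a%:P).
Proof.
move=> h; have [_ pe _ _] := h; have e := eigen_system_basis h.
set P := \matrix_(j < n.+1) p j in e.
pose D : 'M[R]_n.+1 := diag_mx (\row_j s j).
have uB : B \in unitmx.
  by have := mulmx1C e; rewrite -mulmxA => /mulmx1_unit[].
have ePA : P *m A = D *m P *m B.
  apply/matrixP => i j; have := pe i (delta_mx 0 j) (ltn_ord i).
  rewrite /bil trmx_delta -!colE ![col _ _ _ _]mxE => hij.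
  have er M : (P *m M) i j = (p i *m M) 0 j.
    by rewrite -[p i](rowK p) -row_mul [RHS]mxE.
  have -> : (D *m P *m B) i j = s i * (P *m B) i j.
    by rewrite -mulmxA mul_diag_mx !mxE.
  by rewrite !er.
have eA : invmx B *m A *m P^T = P^T *m D.
  have := congr1 trmx ePA; rewrite !trmx_mul sA sB tr_diag_mx => eT.
  by rewrite -mulmxA eT mulKmx.
have dP : \det (map_mx polyC P^T) != 0.
  rewrite det_map_mx/= polyC_eq0 -unitfE -unitmxE unitmx_tr.
  by have [] := mulmx1_unit e.
apply: (mulIf dP); rewrite /char_poly -det_mulmx.
have -> : char_poly_mx (invmx B *m A) *m map_mx polyC P^T = map_mx polyC P^T *m char_poly_mx D.
  rewrite /char_poly_mx mulmxBl mulmxBr -!map_mxM/= eA.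
  by rewrite mul_scalar_mx mul_mx_scalar.
rewrite det_mulmx mulrC; congr (_ * _).
rewrite -/(char_poly D) char_poly_trig ?diag_mx_is_trig// big_map.
rewrite -[iota 0 _]/(index_iota 0 n.+1) big_mkord.
by apply: eq_bigr => j _; rewrite !mxE eqxx mulr1n.
Qed.
End SimultaneousDiagonalization.

(** * Symmetric forms and semidefiniteness *)

Section SymmetricForms.
Context {R : realType} {V : lmodType R}.

Definition sym_bilinear (Q : V -> V -> R) :=
  (forall a u v w, Q (a *: u + v) w = a * Q u w + Q v w) /\ (forall u v, Q u v = Q v u).

Variables (Q : V -> V -> R) (bQ : sym_bilinear Q).
Implicit Types u v w : V.

Lemma sbC u v : Q u v = Q v u. Proof. exact: bQ.2. Qed.

Lemma sbDl u v w : Q (u + v) w = Q u w + Q v w.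
Proof. by rewrite -[u]scale1r bQ.1 mul1r scale1r. Qed.

Lemma sb0l w : Q 0 w = 0.
Proof. by have := sbDl 0 0 w; rewrite addr0 => h; lra. Qed.

Lemma sbZl a u w : Q (a *: u) w = a * Q u w.
Proof. by rewrite -[a *: u]addr0 bQ.1 sb0l addr0. Qed.

Lemma sbNl u w : Q (- u) w = - Q u w.
Proof. by rewrite -scaleN1r sbZl mulN1r. Qed.

Lemma sbBl u v w : Q (u - v) w = Q u w - Q v w.
Proof. by rewrite sbDl sbNl. Qed.

Lemma sbDr u v w : Q w (u + v) = Q w u + Q w v.
Proof. by rewrite !(sbC w) sbDl. Qed.

Lemma sbZr a u w : Q w (a *: u) = a * Q w u.
Proof. by rewrite !(sbC w) sbZl. Qed.

Lemma sbBr u v w : Q w (u - v) = Q w u - Q w v.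
Proof. by rewrite !(sbC w) sbBl. Qed.

Lemma sb_suml n (F : 'I_n -> V) w : Q (\sum_i F i) w = \sum_i Q (F i) w.
Proof. by apply: (big_morph (Q^~ w) (fun u v => sbDl u v w) (sb0l w)). Qed.

Lemma sb_sumr n (F : 'I_n -> V) w : Q w (\sum_i F i) = \sum_i Q w (F i).
Proof. by rewrite sbC sb_suml; apply: eq_bigr => i _; rewrite sbC. Qed.

Hypothesis pQ : forall u, 0 <= Q u u.

Lemma sb_CS u v : Q u v ^+ 2 <= Q u u * Q v v.
Proof.
apply: discriminant_le => t; have := pQ (u + t *: v).
by rewrite sbDl !sbDr !sbZl !sbZr (sbC v u) => h; apply: le_trans h _; lra.
Qed.

Lemma sb_null u v : Q u u = 0 -> Q u v = 0.
Proof.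
move=> u0; have := sb_CS u v; rewrite u0 mul0r => h.
by apply/eqP; rewrite -sqrf_eq0 eq_le h sqr_ge0.
Qed.

Lemma sb_addle u v : Q (u + v) (u + v) <= 2 * Q u u + 2 * Q v v.
Proof.
have := pQ (u - v); rewrite !sbBl !sbBr sbDl !sbDr (sbC v u); lra.
Qed.

Lemma sb_suble u v : Q (u - v) (u - v) <= 2 * Q u u + 2 * Q v v.
Proof.
have := pQ (u + v); rewrite !sbBl !sbBr sbDl !sbDr (sbC v u); lra.
Qed.

(** The crude factor 2^n comes from iterating [sb_addle]. It is harmless because e can be made small
    after n is fixed. *)
Lemma sb_sumle n (c : 'I_n -> R) (z : 'I_n -> V) e : 0 <= e ->
  (forall i, Q (z i) (z i) <= e) ->
  Q (\sum_i c i *: z i) (\sum_i c i *: z i) <= 2 ^+ n * e * \sum_i c i ^+ 2.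
Proof.
move=> e0; elim: n c z => [|n IH] c z hz.
  by rewrite !big_ord0 sb0l mulr0.
rewrite !big_ord_recr /=; apply: le_trans (sb_addle _ _) _.
have h1 := IH (fun i => c (widen_ord (leqnSn n) i)) (fun i => z (widen_ord (leqnSn n) i)) (fun i => hz _).
have h2 : Q (c ord_max *: z ord_max) (c ord_max *: z ord_max) <= e * c ord_max ^+ 2.
  rewrite sbZl sbZr mulrA -expr2 mulrC.
  by have := ler_wpM2r (sqr_ge0 (c ord_max)) (hz ord_max).
have h3 : e * c ord_max ^+ 2 <= 2 ^+ n * (e * c ord_max ^+ 2).
  apply: ler_peMl; first by apply: mulr_ge0 => //; exact: sqr_ge0.
  by apply: exprn_ege1; rewrite ler1n.
rewrite exprS; set X := 2 ^+ n in h1 h3 *; move: h1 h2 h3.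
set S := \sum_(i < n) _ ^+ 2; set T := Q _ _; set W := Q _ _; lra.
Qed.

Lemma orthonormal_sum n (c : 'I_n -> R) (f : 'I_n -> V) (l : 'I_n -> R) :
  (forall i j, Q (f i) (f j) = l i * (i == j)%:R) ->
  Q (\sum_i c i *: f i) (\sum_i c i *: f i) = \sum_i l i * c i ^+ 2.
Proof.
move=> hf; rewrite sb_suml; apply: eq_bigr => i _; rewrite sb_sumr (bigD1 i)//=.
rewrite big1 ?addr0 => [|j ji]; rewrite sbZl sbZr hf.
  by rewrite eqxx mulr1; ring.
by rewrite eq_sym (negbTE ji) !mulr0.
Qed.
End SymmetricForms.

(** * Multiplicities counted by lists *)

Section FiberCardinality.

(** The upper bound serves to construct orthonormal eigenvectors, the list of full length to show
    that they fill an eigenspace. *)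
Lemma card_eq_seq (A : set nat) m : (A #= `I_m)%card ->
  (forall s : seq nat, uniq s -> (forall j, j \in s -> A j) -> (size s <= m)%N) /\
  (exists s : seq nat, [/\ uniq s, size s = m & forall j, j \in s -> A j]).
Proof.
rewrite card_eq_le => /andP[/pcard_leP[g] /pcard_leP[h]]; split.
  move=> s us hs; rewrite -(size_map g).
  apply: (@leq_trans (size (iota 0 m))); last by rewrite size_iota.
  apply: uniq_leq_size.
    rewrite map_inj_in_uniq// => i j /hs iA /hs jA.
    move=> hij; apply: (@inj _ _ _ g i j _ _ hij); by rewrite inE.
  move=> _ /mapP[i /hs iA ->]; rewrite mem_iota add0n /=.
  by have : `I_m (g i) := @funS _ _ _ _ g i iA.
exists (map h (iota 0 m)); split.
- rewrite map_inj_in_uniq ?iota_uniq// => i j; rewrite !mem_iota !add0n /= => im jm.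
  move=> hij; apply: (@inj _ _ _ h i j _ _ hij); by rewrite inE.
- by rewrite size_map size_iota.
- by move=> j /mapP[i + ->]; rewrite mem_iota add0n /= => im; exact: (@funS _ _ _ _ h i im).
Qed.
End FiberCardinality.

(** * Abstract convergence of Galerkin eigenvalues *)

Section SpectralApproximation.
Context {R : realType} {V : lmodType R}.
Variables (b E : V -> V -> R) (C : R).
Hypotheses (bb : sym_bilinear b) (bE : sym_bilinear E).
Hypotheses (pb : forall u, 0 <= b u u) (pG : forall u, 0 <= E u u + C * b u u).
Implicit Types (u v w : V) (l : R).

(** The shift makes E semidefinite, so that Cauchy-Schwarz applies to it. *)
Definition shifted u v : R := E u v + C * b u v.

Lemma shifted_sym_bilinear : sym_bilinear shifted.
Proof.
split=> [a u v w|u v]; rewrite /shifted; last by rewrite (sbC bE) (sbC bb).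
by rewrite bE.1 bb.1; ring.
Qed.

Let bG := shifted_sym_bilinear.

Definition eig l u := forall v, E u v = l * b u v.

Lemma eig_orth l m u v : eig l u -> eig m v -> l != m -> b u v = 0.
Proof.
move=> hu hv lm; have := hu v; rewrite (sbC bE) hv (sbC bb v) => h.
have : (l - m) * b u v = 0 by rewrite mulrBl h subrr.
by move/eqP; rewrite mulf_eq0 subr_eq0 (negbTE lm) => /eqP.
Qed.

Lemma eig_sum l n (c : 'I_n -> R) (f : 'I_n -> V) :
  (forall i, eig l (f i)) -> eig l (\sum_i c i *: f i).
Proof.
move=> hf v; rewrite (sb_suml bE) (sb_suml bb) mulr_sumr; apply: eq_bigr => i _.
by rewrite (sbZl bE) (sbZl bb) hf mulrCA.
Qed.

Lemma eigB l u v : eig l u -> eig l v -> eig l (u - v).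
Proof. by move=> hu hv x; rewrite (sbBl bE) (sbBl bb) hu hv mulrBr. Qed.

Lemma eigZ l a u : eig l u -> eig l (a *: u).
Proof. by move=> hu x; rewrite (sbZl bE) (sbZl bb) hu mulrCA. Qed.

(** A basis of the eigenspace modulo null vectors of b, since functions equal almost everywhere
    remain distinct. *)
Definition spans_eig l m (f : 'I_m -> V) :=
  [/\ forall i, eig l (f i),
      forall c : 'I_m -> R, b (\sum_i c i *: f i) (\sum_i c i *: f i) = 0 -> forall i, c i = 0 &
      forall u, eig l u -> exists c : 'I_m -> R,
        b (u - \sum_i c i *: f i) (u - \sum_i c i *: f i) = 0].

Lemma normalize u : 0 < b u u -> exists2 a, a != 0 & b (a *: u) (a *: u) = 1.
Proof.
move=> u0; have s0 : 0 < Num.sqrt (b u u) by rewrite sqrtr_gt0.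
exists (Num.sqrt (b u u))^-1; first by rewrite invr_eq0 gt_eqF.
by rewrite (sbZl bb) (sbZr bb) mulrA -invfM -expr2 sqr_sqrtr ?ltW// mulVf ?gt_eqF.
Qed.

Lemma spans_eig_dependent l m (f : 'I_m -> V) (g : 'I_m.+1 -> V) :
  spans_eig l f -> (forall i, eig l (g i)) ->
  exists2 c : 'I_m.+1 -> R, (exists i, c i != 0) &
    b (\sum_i c i *: g i) (\sum_i c i *: g i) = 0.
Proof.
move=> [hf _ sp] hg.
have /choice[X hX] : forall i, exists c : 'I_m -> R,
    b (g i - \sum_j c j *: f j) (g i - \sum_j c j *: f j) = 0.
  by move=> i; exact: sp.
have [c c0 cX] := nontrivial_kernel (\matrix_(i < m.+1, j < m) X i j) (ltnSn m).
exists (fun i => c 0 i); first by have /rV0Pn := c0.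
(* The coefficients annihilate the coordinates in f, so only a combination of null vectors is
   left. *)
have -> : \sum_i c 0 i *: g i = \sum_i c 0 i *: (g i - \sum_j X i j *: f j).
  under [in RHS]eq_bigr do rewrite scalerBr.
  rewrite sumrB; apply/esym/eqP; rewrite subr_eq addrC -subr_eq subrr eq_sym; apply/eqP.
  under eq_bigr do rewrite scaler_sumr.
  rewrite exchange_big big1//= => j _.
  under eq_bigr do rewrite scalerA.
  rewrite -scaler_suml (_ : \sum_i _ = 0) ?scale0r//.
  have /rowP/(_ j) := cX; rewrite mxE [RHS]mxE => h; rewrite -[RHS]h.
  by apply: eq_bigr => i _; rewrite mxE.
rewrite (sb_suml bb) big1// => i _; rewrite (sbZl bb) (sb_null bb pb) ?mulr0//.
Qed.

Variable lam : nat -> R.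
Hypotheses (lam_mono : {homo lam : i j / (i <= j)%N >-> i <= j})
  (lam_all : forall l u, eig l u -> 0 < b u u -> exists i, lam i = l)
  (lam_mult : forall i, exists m (f : 'I_m -> V),
     ([set j | lam j = lam i] #= `I_m)%card /\ spans_eig (lam i) f).

(** The eigenspace of [lam k] has as many dimensions as there are indices with this value. The index
    k is one of them, so those below k leave room for an orthogonal vector; other eigenspaces are
    orthogonal by [eig_orth]. *)
Lemma orthonormal_eigenvectors k : exists w : nat -> V,
  (forall i, (i < k)%N -> eig (lam i) (w i)) /\
  (forall i j, (i < k)%N -> (j < k)%N -> b (w i) (w j) = (i == j)%:R).
Proof.
elim: k => [|k [w [we wo]]]; first by exists (fun=> 0); split.
have [m [f [cm [fe fi fs]]]] := lam_mult k.
have [lem _] := card_eq_seq cm.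
pose s := [seq i <- iota 0 k | lam i == lam k].
have sm : (size s < m)%N.
  have us : uniq (k :: s).
    by rewrite /= filter_uniq ?iota_uniq// andbT mem_filter mem_iota add0n ltnn !andbF.
  apply: (lem _ us) => j; rewrite inE => /predU1P[->//|].
  by rewrite mem_filter => /andP[/eqP].
have [c c0 cG] := nontrivial_kernel (\matrix_(a < m, i < size s) b (f a) (w (nth 0%N s i))) sm.
pose u := \sum_a c 0 a *: f a.
have ue : eig (lam k) u by exact: eig_sum.
have u0 : 0 < b u u.
  rewrite lt_neqAle pb andbT eq_sym; apply/eqP => /fi h.
  by move/rV0Pn : c0 => [a]; rewrite h eqxx.
have uo i : (i < k)%N -> b u (w i) = 0.
  move=> ik; have [e|ne] := eqVneq (lam i) (lam k); last first.
    by apply: (eig_orth ue (we i ik)); rewrite eq_sym.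
  have is_ : i \in s by rewrite mem_filter e eqxx mem_iota.
  have si : (index i s < size s)%N by rewrite index_mem.
  have /rowP/(_ (Ordinal si)) := cG; rewrite mxE [RHS]mxE => h.
  rewrite /u (sb_suml bb) -[RHS]h; apply: eq_bigr => a _.
  by rewrite (sbZl bb) mxE /= nth_index.
have [a a0 ha] := normalize u0.
exists (fun i => if i == k then a *: u else w i); split=> [i|i j].
  rewrite ltnS leq_eqVlt => /predU1P[->|ik]; first by rewrite eqxx; exact: eigZ.
  by rewrite (ltn_eqF ik); exact: we.
rewrite !ltnS; case: (ltngtP i k) => // [ik|ik] _; case: (ltngtP j k) => // [jk|jk] _.
- exact: wo.
- by rewrite (sbC bb) (sbZl bb) uo// mulr0 jk ltn_eqF.
- by rewrite (sbZl bb) uo// mulr0 ik gtn_eqF.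
- by rewrite ha ik jk eqxx.
Qed.

(** All indices of an eigenvalue below [lam k] are smaller than k, so the k vectors f already fill
    its eigenspace. The k + 1 orthonormal w would then lie, modulo null vectors, in a span of k
    vectors. *)
Lemma eigenvalue_count k (w : nat -> V) (mu : nat -> R) :
  (forall i, (i <= k)%N -> eig (mu i) (w i)) ->
  (forall i j, (i <= k)%N -> (j <= k)%N -> b (w i) (w j) = (i == j)%:R) ->
  (forall i, (i <= k)%N -> mu i < lam k) -> False.
Proof.
move=> ue uo mul; have [f [fe fo]] := orthonormal_eigenvectors k.
pose r i := w i - \sum_(j < k) b (w i) (f j) *: f j.
have rf i j : (i <= k)%N -> (j < k)%N -> b (r i) (f j) = 0.
  move=> ik jk; rewrite /r (sbBl bb) (sb_suml bb) (bigD1 (Ordinal jk))//= big1 => [|a aj].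
    by rewrite (sbZl bb) fo// eqxx mulr1 addr0 subrr.
  rewrite (sbZl bb) fo//; have -> : (a == j :> nat) = false.
    by apply/negbTE; apply: contra aj => /eqP e; apply/eqP/val_inj.
  by rewrite mulr0.
(* Each projection on f_j either lies in the same eigenspace or has coefficient 0. *)
have re i : (i <= k)%N -> eig (mu i) (r i).
  move=> ik; apply: eigB; first exact: ue.
  move=> v; rewrite (sb_suml bE) (sb_suml bb) mulr_sumr; apply: eq_bigr => j _.
  rewrite (sbZl bE) (sbZl bb) fe// mulrCA.
  have [->|ne] := eqVneq (mu i) (lam j); first by [].
  by rewrite (eig_orth (ue i ik) (fe j (ltn_ord j)) ne) !mul0r !mulr0.
have r0 i : (i <= k)%N -> b (r i) (r i) = 0.
  move=> ik; apply/eqP; apply: contraT => rn.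
  have rp : 0 < b (r i) (r i) by rewrite lt_neqAle eq_sym rn pb.
  have [i0 hi0] := lam_all (re i ik) rp.
  have [m [h [cm sp]]] := lam_mult i0; rewrite hi0 in cm sp.
  have [_ [s [us ss sA]]] := card_eq_seq cm.
  have sk j : j \in s -> (j < k)%N.
    move=> js; rewrite ltnNge; apply/negP => kj; have := lam_mono kj.
    by rewrite (sA j js) leNgt mul.
  (* A non-null residual would complete the m vectors f of this eigenvalue to m + 1 independent
     ones. *)
  pose g (a : 'I_m.+1) := if (a < m)%N then f (nth 0%N s a) else r i.
  have sn (a : 'I_m.+1) : (a < m)%N -> nth 0%N s a \in s by move=> am; rewrite mem_nth ?ss.
  have ge a : eig (mu i) (g a).
    rewrite /g; case: ifPn => am; last exact: re.
    by rewrite -(sA _ (sn a am)); apply: fe; apply: sk; exact: sn.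
  have go a a' : a != a' -> b (g a) (g a') = 0.
    move=> aa; rewrite /g; case: ifPn => am; case: ifPn => am'.
    - rewrite fo ?sk ?sn//; have -> : (nth 0%N s a == nth 0%N s a') = false; last by [].
      by rewrite nth_uniq ?ss//; apply/negbTE; apply: contra aa => /eqP e; apply/eqP/val_inj.
    - by rewrite (sbC bb) rf// sk// sn.
    - by rewrite rf// sk// sn.
    - case/negP: aa; apply/eqP/val_inj => /=.
      have := ltn_ord a; have := ltn_ord a'; rewrite !ltnS => h1 h2.
      move: am am'; rewrite -!leqNgt => m1 m2; apply/eqP.
      by rewrite eqn_leq (leq_trans h2 m2) (leq_trans h1 m1).
  have gp a : b (g a) (g a) != 0.
    by rewrite /g; case: ifPn => am //; rewrite fo ?sk ?sn// eqxx oner_eq0.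
  have [c [a ca] cz] := spans_eig_dependent sp ge.
  have := sb_null bb pb (g a) cz; rewrite (sb_suml bb) (bigD1 a)//= big1 => [|a' aa].
    by move/eqP; rewrite addr0 (sbZl bb) mulf_eq0 (negbTE ca) (negbTE (gp a)).
  by rewrite (sbZl bb) go// mulr0.
pose G : 'M[R]_(k.+1, k) := \matrix_(i, j) b (w i) (f j).
(* The identity of size k + 1 cannot factor through dimension k. *)
suff : G *m G^T = 1%:M by move/mulmx1_min; rewrite ltnn.
apply/matrixP => i j; rewrite !mxE.
have ik : (i <= k)%N by rewrite -ltnS. have jk : (j <= k)%N by rewrite -ltnS.
have -> : (i == j) = (i == j :> nat) by [].
rewrite -[RHS](uo i j ik jk).
have -> : w i = r i + \sum_(a < k) b (w i) (f a) *: f a by rewrite subrK.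
rewrite (sbDl bb) (sb_null bb pb _ (r0 i ik)) add0r (sb_suml bb).
by apply: eq_bigr => a _; rewrite !mxE (sbZl bb) (sbC bb (f a)).
Qed.

(** * Discrete spaces, their eigenpairs, and the limits of these *)

Variables (d : nat -> nat) (W : nat -> V -> Prop).
Variables (p : nat -> nat -> V) (s : nat -> nat -> R).
Hypotheses (W_sum : forall N n (c : 'I_n -> R) (q : 'I_n -> V),
    (forall i, W N (q i)) -> W N (\sum_i c i *: q i))
  (p_in : forall N j, (j < d N)%N -> W N (p N j))
  (p_on : forall N i j, (i < d N)%N -> (j < d N)%N -> b (p N i) (p N j) = (i == j)%:R)
  (p_eig : forall N j v, (j < d N)%N -> W N v -> E (p N j) v = s N j * b (p N j) v)
  (s_mono : forall N i j, (i <= j)%N -> (j < d N)%N -> s N i <= s N j)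
  (s_min : forall N i v, (i < d N)%N -> W N v ->
     (forall j, (j < i)%N -> b (p N j) v = 0) -> s N i * b v v <= E v v)
  (d_large : forall k, \forall N \near \oo, (k < d N)%N)
  (W_dense : forall v e, 0 < e -> \forall N \near \oo,
     exists2 w, W N w & b (v - w) (v - w) <= e /\ shifted (v - w) (v - w) <= e)
  (E_weak : forall v M e, 0 < e -> exists2 del, 0 < del &
     forall w, shifted w w <= M -> b w w <= del -> `|E w v| <= e)
  (H_compact : forall (F : set_system nat) (u : nat -> V) M, UltraFilter F ->
     F [set i | b (u i) (u i) <= 1 /\ shifted (u i) (u i) <= M] ->
     exists w, forall e, 0 < e -> F [set i | b (w - u i) (w - u i) <= e]).

Lemma shifted_p N j : (j < d N)%N -> shifted (p N j) (p N j) = s N j + C.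
Proof. by move=> jd; rewrite /shifted (p_eig jd (p_in jd)) p_on// eqxx !mulr1. Qed.

Lemma s_lower N j : (j < d N)%N -> 0 <= s N j + C.
Proof. by move=> jd; rewrite -shifted_p//; exact: pG. Qed.

(* Courant's principle applied to the span of approximations of the first k+1
   exact eigenvectors. *)
Lemma s_upper k e : 0 < e -> \forall N \near \oo, s N k <= lam k + e.
Proof.
move=> e0; have [w [we wo]] := orthonormal_eigenvectors k.+1.
have G0 i : (i < k.+1)%N -> shifted (w i) (w i) = lam i + C.
  by move=> ik; rewrite /shifted we// wo// eqxx !mulr1.
pose g := lam k + C.
have g0 : 0 <= g by rewrite /g -G0//; exact: pG.
(* Chosen so that g + 2 (g + 1) t + t^2 <= (g + e)(1 - 2 t), the numerator and denominator of the
   perturbed Rayleigh quotient; the term 4 e also gives t <= 1/4. *)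
pose t := e / (2 * (g + 1) + 1 + 2 * g + 4 * e).
have den0 : 0 < 2 * (g + 1) + 1 + 2 * g + 4 * e by lra.
have t0 : 0 < t by rewrite divr_gt0.
have te : t * (2 * (g + 1) + 1 + 2 * g + 4 * e) = e by rewrite /t divfK// gt_eqF.
have t4 : t <= 4^-1 by rewrite /t ler_pdivrMr//; lra.
(* Compensates the factor 2^(k+1) of [sb_sumle]. *)
pose eta := t ^+ 2 / 2 ^+ k.+1.
have eta0 : 0 < eta by rewrite divr_gt0 ?exprn_gt0.
have etaE : 2 ^+ k.+1 * eta = t ^+ 2 by rewrite /eta mulrC divfK// expf_neq0.
have near_q : \forall N \near \oo, forall i : 'I_k.+1, exists2 q, W N q &
    b (w i - q) (w i - q) <= eta /\ shifted (w i - q) (w i - q) <= eta.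
  by apply: filter_forall => i; exact: W_dense.
near=> N.
have kd : (k < d N)%N by near: N; exact: d_large.
have /choice[q hq] : forall i : 'I_k.+1, exists q, W N q /\
    (b (w i - q) (w i - q) <= eta /\ shifted (w i - q) (w i - q) <= eta).
  move=> i; have H : forall i : 'I_k.+1, exists2 q, W N q &
    b (w i - q) (w i - q) <= eta /\ shifted (w i - q) (w i - q) <= eta by near: N.
  by have [q0 ? ?] := H i; exists q0.
(* Among the k + 1 approximations some combination is orthogonal to the first k discrete
   eigenvectors, hence admissible in [s_min]. *)
have [c c0 cG] := nontrivial_kernel (\matrix_(a < k.+1, j < k) b (q a) (p N j)) (ltnSn k).
pose u := \sum_a c 0 a *: q a; pose y := \sum_(a < k.+1) c 0 a *: w a.
pose z := \sum_(a < k.+1) c 0 a *: (w a - q a).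
have uyz : u = y - z.
  by rewrite /u /y /z -sumrB; apply: eq_bigr => a _; rewrite -scalerBr subKr.
pose S := \sum_(a < k.+1) c 0 a ^+ 2.
have S0 : 0 < S.
  have /rV0Pn[a ca] := c0; rewrite /S (bigD1 a)//= ltr_pwDl//.
    by rewrite exprn_even_gt0//= ca.
  by apply: sumr_ge0 => i _; exact: sqr_ge0.
have uW : W N u by apply: W_sum => i; exact: (hq i).1.
have uo j : (j < k)%N -> b (p N j) u = 0.
  move=> jk; have /rowP/(_ (Ordinal jk)) := cG; rewrite mxE [RHS]mxE => h.
  rewrite (sbC bb) /u (sb_suml bb) -[RHS]h; apply: eq_bigr => a _.
  by rewrite (sbZl bb) mxE.
have su := s_min kd uW uo.
have by_ : b y y = S.
  rewrite /y (@orthonormal_sum _ _ _ bb _ _ _ (fun=> 1)); first by apply: eq_bigr => a _; rewrite mul1r.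
  by move=> i j; rewrite wo// mul1r.
have Gy : shifted y y <= g * S.
  rewrite /y (@orthonormal_sum _ _ _ bG _ _ _ (fun i : 'I_k.+1 => lam i + C)); last first.
    by move=> i j; rewrite /shifted we// wo// -mulrDl.
  rewrite mulr_sumr; apply: ler_sum => i _; rewrite ler_wpM2r ?sqr_ge0// lerD2r.
  by apply: lam_mono; rewrite -ltnS.
have bz : b z z <= t ^+ 2 * S.
  by rewrite -etaE /z /S; apply: (@sb_sumle _ _ _ bb pb _ (c 0) _ _ (ltW eta0)) => i; exact: (hq i).2.1.
have Gz : shifted z z <= t ^+ 2 * S.
  by rewrite -etaE /z /S; apply: (@sb_sumle _ _ _ bG pG _ (c 0) _ _ (ltW eta0)) => i; exact: (hq i).2.2.
have tS : 0 <= t * S by rewrite mulr_ge0// ltW.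
have byz : `|b y z| <= t * S.
  apply: norm_le_of_sqr => //; apply: le_trans (sb_CS bb pb y z) _.
  rewrite by_ exprMn; have := ler_wpM2l (ltW S0) bz.
  by rewrite (_ : S * (t ^+ 2 * S) = t ^+ 2 * S ^+ 2)//; ring.
have Gyz : `|shifted y z| <= (g + 1) * t * S.
  have gt0 : 0 <= (g + 1) * t * S by rewrite -mulrA mulr_ge0// addr_ge0.
  apply: norm_le_of_sqr => //; apply: le_trans (sb_CS bG pG y z) _.
  apply: (@le_trans _ _ ((g * S) * (t ^+ 2 * S))); first by apply: ler_pM => //; exact: pG.
  rewrite (_ : g * S * _ = g * (t * S) ^+ 2); last by ring.
  rewrite (_ : (_ * S) ^+ 2 = (g + 1) ^+ 2 * (t * S) ^+ 2); last by ring.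
  by rewrite ler_wpM2r ?sqr_ge0//; nra.
have Gu : shifted u u <= (g + 2 * (g + 1) * t + t ^+ 2) * S.
  rewrite uyz (sbBl bG) !(sbBr bG) (sbC bG z y).
  by move: Gyz; rewrite ler_norml => /andP[? ?]; lra.
have bu : (1 - 2 * t) * S <= b u u.
  rewrite uyz (sbBl bb) !(sbBr bb) (sbC bb z y) by_.
  by have := pb z; move: byz; rewrite ler_norml => /andP[? ?]; lra.
have sC := s_lower kd.
have h1 : (s N k + C) * ((1 - 2 * t) * S) <= (g + 2 * (g + 1) * t + t ^+ 2) * S.
  apply: le_trans Gu; apply: le_trans (ler_wpM2l sC bu) _.
  by rewrite /shifted mulrDl lerD2r.
rewrite mulrA ler_pM2r// in h1.
have t1 : t ^+ 2 <= t by rewrite expr2 ler_piMr ?ltW//; lra.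
have h2 : g + 2 * (g + 1) * t + t ^+ 2 <= (g + e) * (1 - 2 * t).
  have : t * (2 * (g + 1) + 1 + 2 * g + 4 * e) <= e by rewrite te.
  have : 0 <= t * e by rewrite mulr_ge0 ?ltW.
  lra.
have h3 : (s N k + C) * (1 - 2 * t) <= (g + e) * (1 - 2 * t) := le_trans h1 h2.
have t2 : 0 < 1 - 2 * t by lra.
by rewrite ler_pM2r// in h3; move: h3; rewrite /g; lra.
Unshelve. all: by end_near. Qed.

Lemma l2_limit_cvg (F : set_system nat) {FF : Filter F} (u : nat -> V) w v :
  (forall e, 0 < e -> F [set i | b (w - u i) (w - u i) <= e]) ->
  b (u i) v @[i --> F] --> b w v.
Proof.
move=> hu; apply/cvgrPdist_le => e e0.
pose D := b v v + 1; have D0 : 0 < D by rewrite /D ltr_wpDl.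
have e2 : 0 < e ^+ 2 / D by rewrite divr_gt0 ?exprn_gt0.
apply: filterS (hu _ e2) => i /= hi; rewrite -(sbBl bb).
apply: norm_le_of_sqr; first exact: ltW.
apply: le_trans (sb_CS bb pb _ _) _.
apply: (@le_trans _ _ (e ^+ 2 / D * b v v)); first by rewrite ler_wpM2r.
by rewrite mulrAC ler_pdivrMr// ler_wpM2l ?sqr_ge0// /D lerDl.
Qed.

Lemma weak_limit_cvg (F : set_system nat) {FF : Filter F} (u : nat -> V) w v M :
  F [set i | shifted (u i) (u i) <= M] ->
  (forall e, 0 < e -> F [set i | b (w - u i) (w - u i) <= e]) ->
  E (u i) v @[i --> F] --> E w v.
Proof.
move=> FM hu; apply/cvgrPdist_le => e e0.
have [del del0 hdel] := E_weak v (2 * shifted w w + 2 * M) e0.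
apply: filterS2 FM (hu _ del0) => i /= hM hi; rewrite -(sbBl bE).
apply: hdel => //; apply: le_trans (sb_suble bG pG _ _) _.
by rewrite lerD2l ler_wpM2l.
Qed.

Lemma discrete_limit_eig (F : set_system nat) {FF : ProperFilter F} j w mu T :
  F `=>` \oo ->
  F [set N | (j < d N)%N /\ s N j + C <= T] ->
  s N j @[N --> F] --> mu ->
  (forall e, 0 < e -> F [set N | b (w - p N j) (w - p N j) <= e]) ->
  eig mu w.
Proof.
move=> Foo FT smu pw v.
have T0 : 0 <= T by have [N [/= jd]] := filter_ex FT; apply: le_trans; exact: s_lower.
have c1 : E (p N j) v - s N j * b (p N j) v @[N --> F] --> E w v - mu * b w v.
  apply: cvgB; last by apply: cvgM => //; exact: l2_limit_cvg.
  apply: (weak_limit_cvg (M := T)) => //.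
  by apply: filterS FT => N [jd hT]; rewrite /= shifted_p.
have c2 : E (p N j) v - s N j * b (p N j) v @[N --> F] --> (0 : R).
  apply/cvgrPdist_le => e e0.
  pose K := 2 * T + 2 * T ^+ 2 + 1.
  have K0 : 0 < K by have := sqr_ge0 T; rewrite /K; lra.
  have e2 : 0 < e ^+ 2 / K by rewrite divr_gt0 ?exprn_gt0.
  apply: filterS2 FT (Foo _ (W_dense v e2)) => N [jd hT] [q qW [bq Gq]].
  rewrite sub0r normrN.
  (* The discrete equation removes q, so only the small v - q is tested. Writing the residual with
     [shifted] makes Cauchy-Schwarz available; K collects the resulting factors. *)
  have -> : E (p N j) v - s N j * b (p N j) v =
      shifted (p N j) (v - q) - (s N j + C) * b (p N j) (v - q).
    have := p_eig jd qW; rewrite /shifted !(sbBr bE) !(sbBr bb) => ->; ring.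
  apply: norm_le_of_sqr; first exact: ltW.
  apply: le_trans (sqrB_le _ _) _.
  have h1 := sb_CS bG pG (p N j) (v - q).
  have h2 := sb_CS bb pb (p N j) (v - q).
  rewrite shifted_p// in h1; rewrite p_on// eqxx mul1r in h2.
  have sC := s_lower jd; have Gn := pG (v - q); rewrite -/(shifted _ _) in Gn.
  have sT : (s N j + C) ^+ 2 <= T ^+ 2 by rewrite ler_sqr ?nnegrE.
  have h3 : (s N j + C) * shifted (v - q) (v - q) <= T * (e ^+ 2 / K) by apply: ler_pM.
  have h4 : (s N j + C) ^+ 2 * b (p N j) (v - q) ^+ 2 <= T ^+ 2 * (e ^+ 2 / K).
    by apply: ler_pM => //; rewrite ?sqr_ge0// (le_trans h2).
  rewrite exprMn.
  have eK : e ^+ 2 = K * (e ^+ 2 / K) by rewrite mulrC divfK// gt_eqF.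
  rewrite eK; set x := e ^+ 2 / K in h3 h4 e2 *; rewrite /K; lra.
have := cvg_unique _ c1 c2 => /(_ _) h.
by apply/eqP; rewrite -subr_eq0; apply/eqP; apply: h.
Qed.

Lemma limit_orthonormal (F : set_system nat) {FF : ProperFilter F} i j w w' :
  F [set N | (i < d N)%N /\ (j < d N)%N] ->
  (forall e, 0 < e -> F [set N | b (w - p N i) (w - p N i) <= e]) ->
  (forall e, 0 < e -> F [set N | b (w' - p N j) (w' - p N j) <= e]) ->
  b w w' = (i == j)%:R.
Proof.
move=> Fd hw hw'.
have c1 : b w (p N j) @[N --> F] --> b w w'.
  rewrite (_ : (fun N => b w (p N j)) = (fun N => b (p N j) w)).
    by rewrite (sbC bb w w'); exact: l2_limit_cvg.
  by apply/funext => N; exact: sbC.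
have c2 : b w (p N j) @[N --> F] --> ((i == j)%:R : R).
  apply/cvgrPdist_le => e e0; have e2 : 0 < e ^+ 2 by rewrite exprn_gt0.
  apply: filterS2 Fd (hw _ e2) => N [id jd] /= h.
  rewrite distrC -(p_on id jd) -(sbBl bb); apply: norm_le_of_sqr; first exact: ltW.
  by apply: le_trans (sb_CS bb pb _ _) _; rewrite (p_on jd jd) eqxx mulr1.
by have := cvg_unique _ c1 c2; apply.
Qed.

Lemma s_cvg k : s N k @[N --> \oo] --> lam k.
Proof.
apply/cvgrPdist_le => e e0; apply: contrapT => nF.
pose P := [set N | s N k < lam k - e].
pose F0 := within P \oo.
(* The upper side is settled by [s_upper], so failure of convergence means that P recurs for
   arbitrarily large N. *)
have PF0 : ProperFilter F0.
  split; last exact: within_filter.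
  move=> F00; apply: nF; have F1 : \forall N \near \oo, P N -> False := F00.
  apply: filterS2 F1 (s_upper k e0) => N hN hu.
  have lo : lam k - e <= s N k by rewrite leNgt; apply/negP => /hN.
  by rewrite ler_norml; apply/andP; split; lra.
have [U [UU FU]] := ultraFilterLemma PF0.
have Uoo : U `=>` \oo by move=> A FA; apply: FU; apply: filterS FA => N AN _.
have UP : U P by apply: FU; exact: withinT.
have Ud : U [set N | s N k < lam k - e /\ (k < d N)%N].
  by apply: filterS2 UP (Uoo _ (d_large k)) => N; split.
have /choice[x hx] : forall j, exists x : R * V, (j <= k)%N ->
    [/\ s N j @[N --> U] --> x.1, x.1 <= lam k - e &
      forall r, 0 < r -> U [set N | b (x.2 - p N j) (x.2 - p N j) <= r]].
  move=> j; have [jk|jk] := leqP j k; last by exists (0, 0).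
  have Uj : U [set N | (j < d N)%N /\ s N j <= lam k - e].
    apply: filterS Ud => N [h kd]; split; first exact: leq_ltn_trans kd.
    by apply: le_trans (ltW h); exact: s_mono.
  have [mu hmu] : exists mu : R, s N j @[N --> U] --> mu.
    (* The discrete eigenvalues lie between -C, by [s_lower], and lam k - e. *)
    apply: (@ultra_bounded_cvg _ U UU _ (`|C| + `|lam k - e|)).
    apply: filterS Uj => N [jd h]; have := s_lower jd.
    have := ler_norm C; have := ler_norm (lam k - e); have := normr_ge0 C.
    have := normr_ge0 (lam k - e); rewrite /= ler_norml => *; apply/andP; split; lra.
  have [|w hw] := @H_compact U (fun N => p N j) (lam k - e + C) UU.
    apply: filterS Uj => N [jd h]; rewrite /= p_on// eqxx shifted_p//.
    by rewrite lerD2r.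
  exists (mu, w) => _; split => //=.
  rewrite -(cvg_lim _ hmu)//; apply: limr_le; first by apply/cvg_ex; exists mu.
  by apply: filterS Uj => N [].
apply: (@eigenvalue_count k (fun j => (x j).2) (fun j => (x j).1)).
- move=> j jk; have [c1 c2 c3] := hx j jk.
  apply: (@discrete_limit_eig U _ j _ _ (lam k + C)) => //.
  apply: filterS Ud => N [h kd] /=; split; first exact: leq_ltn_trans kd.
  rewrite lerD2r; apply: le_trans (s_mono jk kd) _; lra.
- move=> i j ik jk; have [_ _ ci] := hx i ik; have [_ _ cj] := hx j jk.
  apply: (limit_orthonormal (F := U)) ci cj.
  by apply: filterS Ud => N [_ kd]; split; exact: leq_ltn_trans kd.
- by move=> j jk; have [_ c2 _] := hx j jk; apply: le_lt_trans c2 _; lra.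
Qed.
End SpectralApproximation.

(** * Application to the logarithmic Laplacian *)

Section EnergySpace.
Context {R : realType} (L : R).

Definition Hpred : {pred (R -> R)} := mem [set u : R -> R | inH L u].

Lemma HpredP (u : R -> R) : reflect (inH L u) (u \in Hpred).
Proof. by apply: (iffP idP); rewrite inE. Qed.

Lemma Hpred_submod_closed : submod_closed Hpred.
Proof.
split=> [|a u v /HpredP hu /HpredP hv]; first by apply/HpredP; exact: inH0.
by apply/HpredP; exact: inHD (inHZ a hu) hv.
Qed.

HB.instance Definition _ := GRing.isSubmodClosed.Build _ _ Hpred Hpred_submod_closed.

(** The energy space as a submodule of the functions on the line, with pointwise operations, so that
    the abstract theorem applies to representatives directly. *)
Record energy_space := EnergySpace { hval :> R -> R; hval_pred : hval \in Hpred }.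

HB.instance Definition _ := [isSub for hval].
HB.instance Definition _ := [Choice of energy_space by <:].
HB.instance Definition _ := [SubChoice_isSubLmodule of energy_space by <:].

Lemma hvalP (u : energy_space) : inH L u. Proof. exact/HpredP/hval_pred. Qed.

Definition toH (u : R -> R) (hu : inH L u) : energy_space := EnergySpace (introT (HpredP u) hu).

Lemma hvalE (a : R) (u v : energy_space) : hval (a *: u + v) = (fun x => a * u x + v x).
Proof. by []. Qed.

Lemma hval_sum n (c : 'I_n -> R) (f : 'I_n -> energy_space) :
  hval (\sum_i c i *: f i) = lin_comb c (fun i => hval (f i)).
Proof.
apply/funext => x; rewrite /lin_comb.
apply: (big_ind2 (fun (u : energy_space) (r : R) => u x = r)) => //.
by move=> u r v t hu hv; rewrite -hu -hv.
Qed.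
End EnergySpace.

(** * The discrete problem in matrix form *)

Section Galerkin.
Context {R : realType}.
Local Notation mu := (@lebesgue_measure R).
Variables (L : R) (L0 : 0 < L).
Local Notation H := (energy_space L).
Implicit Types (u v w : H) (N : nat).

Definition bH u v : R := dot u v.
Definition eH u v : R := E_L u v.
Definition cH : R := L + `|rho1 : R|.

Lemma bH_sym_bilinear : sym_bilinear bH.
Proof.
split=> [a u v w|u v]; last exact: dotC.
have h x := inH_L2 (hvalP (L := L) x).
by rewrite /bH hvalE dotDl ?dotZl//; exact: L2Z.
Qed.

Lemma eH_sym_bilinear : sym_bilinear eH.
Proof.
split=> [a u v w|u v]; last by apply: (E_LC L0); exact: hvalP.
have h x := hvalP (L := L) x.
by rewrite /eH hvalE (E_LDl L0 (inHZ _ (h u)) (h v) (h w)) (E_LZl _ L0).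
Qed.

Lemma bH_ge0 u : 0 <= bH u u. Proof. exact: dot_ge0. Qed.

Lemma Dd_le_shifted u : Dd 0 1 u u <= 2 * shifted bH eH cH u u.
Proof. by have := E_L_coercive L0 (hvalP u); rewrite /shifted /bH /eH /cH; lra. Qed.

Lemma shiftedH_ge0 u : 0 <= eH u u + cH * bH u u.
Proof. by have := Dd_le_shifted u; have := Dd_ge0 0 1 u; rewrite /shifted; lra. Qed.

Lemma cH_ge0 : 0 <= cH.
Proof. by rewrite /cH addr_ge0// ltW. Qed.

Lemma shifted_le u : shifted bH eH cH u u <= 2^-1 * Dd 0 1 u u + 2 * cH * bH u u.
Proof. by have := E_L_upper L0 (hvalP u); rewrite /shifted /bH /eH /cH; lra. Qed.

Lemma bH_eq0P u : bH u u = 0 <-> ae0 u.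
Proof. by rewrite dot_eq0P//; exact: inH_L2 (hvalP u). Qed.

Lemma hvalB u v : hval (u - v) = (fun x => u x - v x).
Proof. by []. Qed.

Definition hatH N (i : 'I_N.+2) : H := toH (hat0_inH L0 i).
Definition combH N (c : 'rV[R]_N.+2) : H := \sum_i c 0 i *: hatH i.

Lemma hval_combH N (c : 'rV[R]_N.+2) : hval (combH c) = lin_comb (c 0) (hat0 L (N := N)).
Proof. exact: hval_sum. Qed.

Lemma VhP N u : V_h L N u <-> exists c, u = combH (N := N) c.
Proof.
split=> [/(Vh_span L0)[c hc]|[c ->]]; last by rewrite hval_combH; exact: Vh_lin_comb.
exists (\row_i c i); apply/val_inj => /=; rewrite [LHS]hc hval_combH.
by congr lin_comb; apply/funext => i; rewrite mxE.
Qed.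

Lemma combHD N a (c c' : 'rV[R]_N.+2) : combH (a *: c + c') = a *: combH c + combH c'.
Proof.
rewrite /combH scaler_sumr -big_split/=; apply: eq_bigr => i _.
by rewrite !mxE scalerDl scalerA.
Qed.

Lemma combH_sum N n (a : 'I_n -> R) (c : 'I_n -> 'rV[R]_N.+2) :
  combH (\sum_i a i *: c i) = \sum_i a i *: combH (c i).
Proof.
apply: (big_rec2 (fun x y => combH x = y)) => [|i x y _ <-]; last exact: combHD.
by rewrite /combH big1// => i _; rewrite mxE scale0r.
Qed.

Lemma Vh_sum N n (c : 'I_n -> R) (q : 'I_n -> H) :
  (forall i, V_h L N (q i)) -> V_h L N (\sum_i c i *: q i).
Proof.
move=> hq; have /choice[a ha] i := (VhP N (q i)).1 (hq i).
apply/VhP; exists (\sum_i c i *: a i).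
by rewrite combH_sum; apply: eq_bigr => i _; rewrite ha.
Qed.

Lemma bil_combH (Q : H -> H -> R) N (c c' : 'rV[R]_N.+2) : sym_bilinear Q ->
  Q (combH c) (combH c') = bil (\matrix_(i, j) Q (hatH i) (hatH j)) c c'.
Proof.
move=> bQ; rewrite bilE (sb_sumr bQ); apply: eq_bigr => j _.
rewrite (sbZr bQ) (sb_suml bQ) mulrC; congr (_ * _); apply: eq_bigr => i _.
by rewrite (sbZl bQ) mxE.
Qed.

Lemma stiffnessE N : stiffness L N = \matrix_(i, j) eH (hatH i) (hatH j).
Proof. by apply/matrixP => i j; rewrite !mxE (E_hat L0). Qed.

Lemma massE N : mass L N = \matrix_(i, j) bH (hatH i) (hatH j).
Proof. by apply/matrixP => i j; rewrite !mxE (dot_hat L0). Qed.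

Lemma eH_comb N (c c' : 'rV[R]_N.+2) : eH (combH c) (combH c') = bil (stiffness L N) c c'.
Proof. by rewrite stiffnessE bil_combH//; exact: eH_sym_bilinear. Qed.

Lemma bH_comb N (c c' : 'rV[R]_N.+2) : bH (combH c) (combH c') = bil (mass L N) c c'.
Proof. by rewrite massE bil_combH//; exact: bH_sym_bilinear. Qed.

Lemma stiffness_sym N : (stiffness L N)^T = stiffness L N.
Proof. by apply/matrixP => i j; rewrite stiffnessE !mxE (sbC eH_sym_bilinear). Qed.

Lemma mass_sym N : (mass L N)^T = mass L N.
Proof. by apply/matrixP => i j; rewrite massE !mxE (sbC bH_sym_bilinear). Qed.

Lemma mass_pos N (c : 'rV[R]_N.+2) : c != 0 -> 0 < bil (mass L N) c c.
Proof.
move=> c0; rewrite -bH_comb lt_neqAle bH_ge0 andbT eq_sym; apply: contra c0 => /eqP.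
move=> /bH_eq0P; rewrite hval_combH => /(hat0_indep L0) h.
by apply/eqP/rowP => i; rewrite h mxE.
Qed.

Lemma galerkin_system N : exists p s,
  eigen_system (stiffness L N) (mass L N) N.+2 p s.
Proof.
by apply: eigen_system_exists; [exact: stiffness_sym|exact: mass_sym|exact: mass_pos|].
Qed.

Section FixedMesh.
Variables (N : nat) (p : nat -> 'rV[R]_N.+2) (s : nat -> R).
Hypothesis ps : eigen_system (stiffness L N) (mass L N) N.+2 p s.

Lemma galerkin_orthonormal i j : (i < N.+2)%N -> (j < N.+2)%N ->
  bH (combH (p i)) (combH (p j)) = (i == j)%:R.
Proof. by case: ps => po _ _ _ iN jN; rewrite bH_comb po. Qed.

Lemma galerkin_eig j v : (j < N.+2)%N -> V_h L N v ->
  eH (combH (p j)) v = s j * bH (combH (p j)) v.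
Proof. by case: ps => _ pe _ _ jN /VhP[c ->]; rewrite eH_comb bH_comb pe. Qed.

Lemma galerkin_min i v : (i < N.+2)%N -> V_h L N v ->
  (forall j, (j < i)%N -> bH (combH (p j)) v = 0) -> s i * bH v v <= eH v v.
Proof.
move=> iN /VhP[c ->] h; rewrite eH_comb bH_comb.
apply: (eigen_system_min (stiffness_sym N) (mass_sym N) ps) => // j ji.
by rewrite -bH_comb h.
Qed.

Lemma eigenvalues_rel_galerkin :
  eigenvalues_rel (stiffness L N) (mass L N) [seq s j | j <- iota 0 N.+2].
Proof.
split; last first.
  by rewrite (eigen_system_char_poly (stiffness_sym N) (mass_sym N) ps).
case: ps => _ _ smono _; apply/(sortedP 0) => i; rewrite size_map size_iota => iN.
rewrite !(nth_map 0%N) ?size_iota// 1?ltnW// !nth_iota// 1?ltnW//.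
exact: smono.
Qed.
End FixedMesh.
End Galerkin.

(** * The hypotheses of the abstract theorem *)

Section Spectrum.
Context {R : realType}.
Local Notation mu := (@lebesgue_measure R).
Variables (L : R) (L0 : 0 < L).
Local Notation H := (energy_space L).
Local Notation b := (@bH R L).
Local Notation E := (@eH R L).
Local Notation C := (cH L).
Implicit Types (u v w : H) (N : nat).

Let bb := bH_sym_bilinear L.
Let bE := eH_sym_bilinear L0.

Lemma eigenspaceP l u : Defs.eigenspace L l u <-> eig b E l u.
Proof.
split=> [[_ h] v|h]; last split; [|exact/inHP/hvalP|].
  have := h v; rewrite (L2dotE (hvalP u) (inH_L2 (hvalP v))); apply.
  exact/inHP/hvalP.
move=> v /inHP hv; rewrite (L2dotE (hvalP u) (inH_L2 hv)).
exact: (h (toH hv)).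
Qed.

Variable lam : nat -> R.
Hypothesis hlam : eigenvalue_sequence L lam.

Lemma spectrum_complete l u : eig b E l u -> 0 < b u u -> exists i, lam i = l.
Proof.
move=> hu u0; case: hlam => _ lamE _.
have : [set l | is_eigenvalue L l] l.
  exists u; first exact/eigenspaceP.
  by move/bH_eq0P => h; rewrite h ltxx in u0.
by rewrite -lamE => -[i _ <-]; exists i.
Qed.

Lemma spectrum_multiplicity i : exists m (f : 'I_m -> H),
  ([set j | lam j = lam i] #= `I_m)%card /\ spans_eig b E (lam i) f.
Proof.
case: hlam => _ lamE lamm.
have : [set l | is_eigenvalue L l] (lam i) by rewrite -lamE; exists i.
move=> /lamm[m cm [f [fin find fsp]]].
have fH j : inH L (f j) by apply/inHP; have [] := fin j.
exists m, (fun j => toH (fH j)); split => //; split.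
- by move=> j; apply/eigenspaceP; exact: fin.
- by move=> c /bH_eq0P; rewrite hval_sum => /find.
- move=> u /eigenspaceP/fsp[c hc]; exists c; apply/bH_eq0P.
  by rewrite hvalB hval_sum.
Qed.

Lemma Vh_dense_shifted v e : 0 < e -> \forall N \near \oo,
  exists2 w : H, V_h L N w &
    b (v - w) (v - w) <= e /\ shifted b E C (v - w) (v - w) <= e.
Proof.
move=> e0; have c0 := cH_ge0 L0.
(* By [shifted_le] the shifted form of the error is at most r/2 + 2 C r <= e. *)
pose r := e / (1 + 2 * C).
have r0 : 0 < r by rewrite divr_gt0// ltr_wpDr// mulr_ge0.
have re : r * (1 + 2 * C) = e by rewrite divfK// gt_eqF// ltr_wpDr// mulr_ge0.
have [N0 h] := Vh_dense L0 (hvalP v) r0.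
exists N0 => // N /= N0N; have [c [hn hD]] := h N N0N.
pose w : H := combH L0 (\row_i c i).
have wE : hval w = lin_comb c (hat0 L (N := N)).
  by rewrite hval_combH; congr lin_comb; apply/funext => i; rewrite mxE.
exists w; first by apply/VhP => //; exists (\row_i c i).
have vwE : hval (v - w) = (fun x => v x - lin_comb c (hat0 L (N := N)) x).
  by rewrite hvalB wE.
have vwH := hvalP (v - w).
have hb : b (v - w) (v - w) <= r.
  by rewrite -lee_fin -(normqE (inH_L2 vwH)) vwE.
have hd : Dd 0 1 (v - w) (v - w) <= r.
  by rewrite -lee_fin -(Dd_fin _ _ vwH)// vwE.
have rc : 0 <= r * C by rewrite mulr_ge0// ltW.
split; first by lra.
apply: le_trans (shifted_le L0 _) _.
have : C * b (v - w) (v - w) <= C * r by rewrite ler_wpM2l.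
by rewrite -re; lra.
Qed.

Lemma energy_small v M e : 0 < e -> exists2 del, 0 < del &
  forall w, shifted b E C w w <= M -> b w w <= del -> `|E w v| <= e.
Proof.
move=> e0; have [d d0 h] := E_L_small (2 * M) L0 (hvalP v) e0.
exists d => // w hM hw; apply: h => //; first exact: hvalP.
by apply: le_trans (Dd_le_shifted L0 w) _; rewrite ler_pM2l.
Qed.

Lemma energy_compact (F : set_system nat) (u : nat -> H) M : UltraFilter F ->
  F [set i | b (u i) (u i) <= 1 /\ shifted b E C (u i) (u i) <= M] ->
  exists w, forall e, 0 < e -> F [set i | b (w - u i) (w - u i) <= e].
Proof.
move=> UF FM.
(* Coercivity turns the bound M into 2 M; the absolute value supplies a nonnegative bound. *)
have [||w [hw h]] := @H_precompact R L L0 F UF (fun i => hval (u i)) `|2 * M| _ (normr_ge0 _).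
- by move=> i; exact: hvalP.
- apply: filterS FM => i [h1 h2]; split => //=.
  apply: le_trans (Dd_le_shifted L0 (u i)) _.
  by apply: le_trans (ler_norm _); rewrite ler_pM2l.
exists (toH hw) => e /h; apply: filterS => i /=.
by rewrite -lee_fin -normqE//; exact: inH_L2 (hvalP (toH hw - u i)).
Qed.

Lemma galerkin_cvg (p : forall N, nat -> 'rV[R]_N.+2) (s : nat -> nat -> R) k :
  (forall N, eigen_system (stiffness L N) (mass L N) N.+2 (p N) (s N)) ->
  s N k @[N --> \oo] --> lam k.
Proof.
move=> ps.
apply: (@s_cvg R H b E C bb bE (@bH_ge0 R L) (shiftedH_ge0 L0) lam _ _ _
  (fun N => N.+2) (fun N u => V_h L N u) (fun N j => combH L0 (p N j))).
- by case: hlam.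
- exact: spectrum_complete.
- exact: spectrum_multiplicity.
- by move=> N n c q; exact: Vh_sum.
- by move=> N j _; apply/(VhP L0); exists (p N j).
- by move=> N i j; exact: galerkin_orthonormal.
- by move=> N j v; exact: galerkin_eig.
- by move=> N i j ij jN; case: (ps N) => _ _ + _; exact.
- by move=> N i v; exact: galerkin_min.
- by move=> j; exists j => // N /= jN; rewrite ltnS leqW.
- exact: Vh_dense_shifted.
- exact: energy_small.
- exact: energy_compact.
Qed.
End Spectrum.

(** * The discrete min-max values *)

Section MinMax.
Context {R : realType}.

Lemma inf_attained (A : set R) m : A m -> lbound A m -> inf A = m.
Proof.
move=> Am lA; apply/eqP; rewrite eq_le ge_inf//=; last by exists m.
by apply: lb_le_inf => //; exists m.
Qed.

Lemma subspace_lin_comb (M : set (R -> R)) n (c : 'I_n -> R) (f : 'I_n -> R -> R) :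
  linear_subspace M -> (forall i, M (f i)) -> M (lin_comb c f).
Proof.
move=> [M0 MD] hf; elim: n c f hf => [|n IH] c f hf.
  by rewrite (_ : lin_comb c f = fun=> 0)//; apply/funext => x; rewrite /lin_comb big_ord0.
rewrite (_ : lin_comb c f = fun x => c ord0 * f ord0 x +
    lin_comb (fun i => c (lift ord0 i)) (fun i => f (lift ord0 i)) x).
  by apply: MD => //; exact: IH.
by apply/funext => x; rewrite /lin_comb big_ord_recl.
Qed.

Variables (L : R) (L0 : 0 < L).
Local Notation H := (energy_space L).
Local Notation b := (@bH R L).
Local Notation E := (@eH R L).
Implicit Types u : H.

Let bb := bH_sym_bilinear L.
Let bE := eH_sym_bilinear L0.

Lemma L2norm_eq1 u : L2norm L u = 1 <-> b u u = 1.
Proof.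
rewrite /L2norm (L2dotE (hvalP u) (inH_L2 (hvalP u))) -/(b u u); split => [h|->].
  by rewrite -[LHS]sqr_sqrtr ?dot_ge0// h expr1n.
by rewrite sqrtr1.
Qed.

Variables (N : nat) (p : nat -> 'rV[R]_N.+2) (s : nat -> R) (k : nat).
Hypothesis ps : eigen_system (stiffness L N) (mass L N) N.+2 p s.
Hypothesis kN : (k < N.+2)%N.
Local Notation f := (fun i : 'I_k.+1 => combH L0 (p i)).

Let f_lt (i : 'I_k.+1) : (i < N.+2)%N. Proof. exact: leq_trans (ltn_ord i) _. Qed.

Let b_sum (c : 'I_k.+1 -> R) :
  b (\sum_i c i *: f i) (\sum_i c i *: f i) = \sum_i c i ^+ 2.
Proof.
rewrite (@orthonormal_sum _ _ _ bb _ _ _ (fun=> 1)) => [|i j].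
  by apply: eq_bigr => i _; rewrite mul1r.
by rewrite (galerkin_orthonormal L0 ps) ?f_lt// mul1r.
Qed.

Let E_sum (c : 'I_k.+1 -> R) :
  E (\sum_i c i *: f i) (\sum_i c i *: f i) = \sum_(i < k.+1) s i * c i ^+ 2.
Proof.
apply: (@orthonormal_sum _ _ _ bE) => i j.
rewrite (galerkin_eig L0 ps) ?f_lt//; last by apply/VhP; exists (p j).
by rewrite (galerkin_orthonormal L0 ps) ?f_lt.
Qed.

(** The span of the first k + 1 discrete eigenvectors, on which the form is diagonal with largest
    entry [s k], attained at the last of them. *)
Lemma eigenspan_minmax : exists M : set (R -> R),
  [/\ M `<=` V_h L N, linear_subspace M, has_dim M k.+1 &
      is_max [set E_L u u | u in M `&` [set u | L2norm L u = 1]] (s k)].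
Proof.
pose g i : R -> R := hval (f i).
have gE c : lin_comb c g = hval (\sum_i c i *: f i) by rewrite hval_sum.
exists [set u | exists c, u = lin_comb c g]; split.
- move=> _ [c ->]; rewrite gE; apply: (Vh_sum L0) => i.
  by apply/(VhP L0); exists (p i).
- split; first by exists (fun=> 0); apply/funext => x; rewrite /lin_comb big1// => i _; rewrite mul0r.
  move=> a _ _ [c ->] [c' ->]; exists (fun i => a * c i + c' i); apply/funext => x.
  rewrite /lin_comb mulr_sumr -big_split/=; apply: eq_bigr => i _.
  by rewrite mulrDl mulrA.
- exists g; split.
  + move=> i; exists (fun j => (j == i)%:R); apply/funext => x.
    rewrite /lin_comb (bigD1 i)//= eqxx mul1r big1 ?addr0// => j /negbTE ->.
    by rewrite mul0r.
  + move=> c; rewrite gE => /bH_eq0P; rewrite b_sum => /eqP.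
    rewrite psumr_eq0 => [/allP h i|i _]; last exact: sqr_ge0.
    by have /h := mem_index_enum i; rewrite sqrf_eq0 => /eqP.
  + move=> u [c ->]; exists c; apply: aeW => x; exact: subrr.
- split.
    exists (hval (f ord_max)); last first.
      rewrite -/(E _ _) (galerkin_eig L0 ps) ?f_lt//; last by apply/VhP; exists (p k).
      by rewrite (galerkin_orthonormal L0 ps) ?f_lt// eqxx mulr1.
    split; last by apply/L2norm_eq1; rewrite (galerkin_orthonormal L0 ps) ?f_lt// eqxx.
    exists (fun j => (j == ord_max)%:R); apply/funext => x.
    rewrite /lin_comb (bigD1 ord_max)//= eqxx mul1r big1 ?addr0// => j /negbTE ->.
    by rewrite mul0r.
  move=> _ [_ [[c ->]] /= + <-]; rewrite gE => /L2norm_eq1; rewrite b_sum => c1.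
  rewrite -/(E _ _) E_sum -[leRHS]mulr1 -c1 mulr_sumr; apply: ler_sum => i _.
  rewrite ler_wpM2r ?sqr_ge0//; case: ps => _ _ + _; apply => //.
  by rewrite -ltnS.
Qed.

(** A subspace of dimension k + 1 contains a unit vector orthogonal to the first k discrete
    eigenvectors, where the form is at least [s k]. *)
Lemma minmax_lower (M : set (R -> R)) m : M `<=` V_h L N -> linear_subspace M ->
  has_dim M k.+1 ->
  ubound [set E_L u u | u in M `&` [set u | L2norm L u = 1]] m -> s k <= m.
Proof.
move=> MV Ml [g [gM gi _]] mM.
have /choice[a ga] i : exists c, g i = hval (combH L0 (N := N) c).
  have [c hc] := Vh_span L0 (MV _ (gM i)); exists (\row_i c i); rewrite hval_combH hc.
  by congr lin_comb; apply/funext => j; rewrite mxE.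
pose q i := combH L0 (a i).
have [x x0 xG] := nontrivial_kernel (\matrix_(i < k.+1, j < k) b (q i) (combH L0 (p j))) (ltnSn k).
pose w : H := \sum_i x 0 i *: q i.
have wE : hval w = lin_comb (x 0) g.
  by rewrite hval_sum; congr lin_comb; apply/funext => i; rewrite ga.
have w0 : 0 < b w w.
  rewrite lt_neqAle bH_ge0 andbT eq_sym; apply: contra x0 => /eqP/bH_eq0P.
  by rewrite wE => /gi h; apply/eqP/rowP => i; rewrite h mxE.
have [t t0 tw] := normalize bb w0.
have twE : hval (t *: w) = lin_comb (fun i => t * x 0 i) g.
  apply/funext => y; rewrite -[LHS]/(t * hval w y) wE /lin_comb mulr_sumr.
  by apply: eq_bigr => i _; rewrite mulrA.
have twM : M (hval (t *: w)) by rewrite twE; exact: subspace_lin_comb.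
have wo j : (j < k)%N -> b (combH L0 (p j)) (t *: w) = 0.
  move=> jk; rewrite (sbZr bb) (sbC bb) (sb_suml bb).
  have /rowP/(_ (Ordinal jk)) := xG; rewrite mxE [RHS]mxE => h.
  rewrite (_ : \sum_i _ = 0) ?mulr0// -[RHS]h; apply: eq_bigr => i _.
  by rewrite (sbZl bb) mxE.
have := galerkin_min ps kN (MV _ twM) wo; rewrite tw mulr1 => /le_trans; apply.
by apply: mM; exists (hval (t *: w)) => //; split => //; apply/L2norm_eq1.
Qed.

Lemma lambda_h_galerkin : lambda_h L N k.+1 = s k.
Proof.
apply: inf_attained; first exact: eigenspan_minmax.
by move=> m [M [MV Ml Md [_ mM]]]; exact: minmax_lower mM.
Qed.
End MinMax.

Unset Implicit Arguments.

Theorem proposition7p2 (R : realType) (L : R) (k : nat) (lam : nat -> R)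
    (hL : 0 < L) (hk : (0 < k)%N) (hlam : eigenvalue_sequence L lam) :
  ((fun N : nat => lambda_h L N k) @ \oo --> lam k.-1) /\
  (forall N : nat, (k <= N + 2)%N ->
     exists2 s : seq R, eigenvalues_rel (stiffness L N) (mass L N) s &
       lambda_h L N k = nth 0 s k.-1).
Proof.
(* The type of [p N] depends on N, so the eigenvectors are extracted by [cid]; [choice] then
   suffices for the eigenvalues. *)
pose P N := cid (galerkin_system hL N); pose p N := projT1 (P N).
have /choice[s ps] N : exists s, eigen_system (stiffness L N) (mass L N) N.+2 (p N) s := projT2 (P N).
case: k hk => // k _; split.
  apply: cvg_trans (galerkin_cvg hL hlam (k := k) ps); apply: near_eq_cvg.
  exists k => // N /= kN; rewrite (lambda_h_galerkin hL (ps N))//.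
  by rewrite ltnS leqW.
move=> N; rewrite addn2 => kN; exists [seq s N j | j <- iota 0 N.+2].
  exact: eigenvalues_rel_galerkin.
by rewrite (lambda_h_galerkin hL (ps N))// (nth_map 0%N) ?size_iota// nth_iota.
Qed.
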